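(* Let $n\ge 14$. Then the Hamiltonian cycle $(1,3,5,7,9,11,13,8,10,12,14,15,16,\dots,n,2,4,6)$ in $\widetilde{K}_n$ is ambient isotopic to a connected sum $T\# T$, where $T$ is the trefoil knot type of the cycle $(1,3,5,7,2,4,6)$ in $\widetilde{K}_7$.
   Context: Canonical book representation $\widetilde{K}_n$: label the vertices of the complete graph $K_n$ by $1,\dots,n$ and place them in this cyclic order on a round circle $C$ in a plane $P\subset\mathbb{R}^3$. The ''sheets'' $S_1,\dots,S_k$ are topological disks in $\mathbb{R}^3$ with common boundary $C$ and pairwise disjoint interiors, stacked so that, in the projection to $P$, $S_a$ lies above $S_b$ whenever $a<b$. Each edge $\{i,j\}$ is embedded as a chord with endpoints $i,j$ inside exactly one sheet, chords in a common sheet being disjoint except at shared endpoints; the resulting spatial graph is determined up to ambient isotopy by the assignment of edges to sheets. If $n=2m$ there are $m$ sheets, and for $1\le i\le m$ sheet $S_i$ contains the edges $\{i,i+j\}$ for $1\le j\le m$ and $\{i+m,(i+m+j)\bmod 2m\}$ for $1\le j\le m-1$. If $n=2m+1$ there are $m+1$ sheets; for $1\le i\le m$ sheet $S_i$ contains the edges $\{i,i+j\}$ and $\{i+m+1,(i+m+j+1)\bmod(2m+1)\}$ for $1\le j\le m$, and $S_{m+1}$ contains the edges $\{m+1,m+1+j\}$ for $1\le j\le m$. Residues mod $n$ are taken in $\{1,\dots,n\}$. A cycle $(\alpha_1,\dots,\alpha_r)$ of distinct vertices denotes the closed curve formed by the embedded edges $\{\alpha_1,\alpha_2\},\dots,\{\alpha_{r-1},\alpha_r\},\{\alpha_r,\alpha_1\}$,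 regarded as a knot in $\mathbb{R}^3$; it is Hamiltonian if it uses all vertices of the graph. The cycle $(1,3,5,7,2,4,6)$ in $\widetilde{K}_7$ is a (right-handed) trefoil. *)

(* Defs.v *)
From Stdlib Require Import Reals Lra Lia Arith List.
Import ListNotations.
Open Scope R_scope.

Definition pt : Type := (R * R * R)%type.

Definition dist3 (p q : pt) : R :=
  match p, q with
  | (x1, y1, z1), (x2, y2, z2) =>
      Rmax (Rabs (x1 - x2)) (Rmax (Rabs (y1 - y2)) (Rabs (z1 - z2)))
  end.

Definition continuous3 (f : pt -> pt) : Prop :=
  forall x eps, 0 < eps -> exists delta, 0 < delta /\
    forall y, dist3 x y < delta -> dist3 (f x) (f y) < eps.

Definition ambient_isotopic (A B : pt -> Prop) : Prop :=
  exists H : R -> pt -> pt,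
    (forall t x, 0 <= t <= 1 -> forall eps, 0 < eps -> exists delta, 0 < delta /\
       forall s y, 0 <= s <= 1 -> Rabs (s - t) < delta -> dist3 x y < delta ->
         dist3 (H t x) (H s y) < eps) /\
    (forall x, H 0 x = x) /\
    (forall t, 0 <= t <= 1 -> exists G : pt -> pt, continuous3 G /\
       forall x, G (H t x) = x /\ H t (G x) = x) /\
    (forall y, B y <-> exists x, A x /\ H 1 x = y).

Definition resid (n r : nat) : nat := ((r + n - 1) mod n + 1)%nat.

Definition edgeInSheet (n a x y : nat) : Prop :=
  if Nat.even n then
    let m := Nat.div2 n in
    (1 <= a <= m)%nat /\
    ((exists j, (1 <= j <= m)%nat /\ x = a /\ y = resid n (a + j)) \/
     (exists j, (1 <= j <= m - 1)%nat /\ x = (a + m)%nat /\ y = resid n (a + m + j)))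
  else
    let m := Nat.div2 n in
    ((1 <= a <= m)%nat /\
     ((exists j, (1 <= j <= m)%nat /\ x = a /\ y = (a + j)%nat) \/
      (exists j, (1 <= j <= m)%nat /\ x = (a + m + 1)%nat /\
                  y = resid n (a + m + j + 1)))) \/
    (a = (m + 1)%nat /\
     exists j, (1 <= j <= m)%nat /\ x = (m + 1)%nat /\ y = (m + 1 + j)%nat).

Definition inSheet (n a x y : nat) : Prop :=
  edgeInSheet n a x y \/ edgeInSheet n a y x.

Definition nsheets (n : nat) : nat :=
  if Nat.even n then Nat.div2 n else (Nat.div2 n + 1)%nat.

Definition vx (n i : nat) : R := cos (2 * PI * INR i / INR n).
Definition vy (n i : nat) : R := sin (2 * PI * INR i / INR n).

(** Sheet S_a is the disk { (u, v, c_a (1 - u^2 - v^2)) : u^2+v^2 <= 1 } with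
    heights c_a = nsheets+1-a decreasing in a, so S_a lies above S_b for a < b;
    all sheets have common boundary C and pairwise disjoint interiors.
    The edge {x,y} in sheet a is the straight chord from x to y, lifted to S_a. *)
Definition onChord (n a x y : nat) (p : pt) : Prop :=
  exists t, 0 <= t <= 1 /\
    let u := (1 - t) * vx n x + t * vx n y in
    let v := (1 - t) * vy n x + t * vy n y in
    p = (u, v, INR (nsheets n + 1 - a) * (1 - u * u - v * v)).

Fixpoint consec (l : list nat) : list (nat * nat) :=
  match l with
  | x :: ((y :: _) as l') => (x, y) :: consec l'
  | _ => []
  end.
Definition cycle_pairs (l : list nat) : list (nat * nat) :=
  match l with
  | [] => []
  | x :: _ => consec (l ++ [x])
  end.

Definition cycleKnot (n : nat) (l : list nat) (p : pt) : Prop :=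
  exists x y, In (x, y) (cycle_pairs l) /\
    exists a, inSheet n a x y /\ onChord n a x y p.

(** right-handed trefoil (1,3,5,7,2,4,6) in K~_7 *)
Definition trefoil : pt -> Prop := cycleKnot 7 [1;3;5;7;2;4;6]%nat.

Definition px (p : pt) : R := match p with (x, _, _) => x end.

Definition onSegment (p q r : pt) : Prop :=
  exists t, 0 <= t <= 1 /\
  match p, q with
  | (x1, y1, z1), (x2, y2, z2) =>
      r = ((1 - t) * x1 + t * x2, (1 - t) * y1 + t * y2, (1 - t) * z1 + t * z2)
  end.

Definition is_connected_sum (K A B : pt -> Prop) : Prop :=
  exists (K' : pt -> Prop) (p q : pt),
    ambient_isotopic K K' /\ p <> q /\
    (forall r, (K' r /\ px r = 0) <-> (r = p \/ r = q)) /\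
    ambient_isotopic (fun r => (K' r /\ px r <= 0) \/ onSegment p q r) A /\
    ambient_isotopic (fun r => (K' r /\ px r >= 0) \/ onSegment p q r) B.

Definition cycle9 (n : nat) : list nat :=
  ([1;3;5;7;9;11;13;8;10;12] ++ seq 14 (n - 13) ++ [2;4;6])%nat.

(* Main.v *)
Require Import Defs.
From Stdlib Require Import Reals Lra Lia List Arith ClassicalEpsilon.
Import ListNotations.
Open Scope R_scope.

(** A family of embeddings f_u of a set S is realized by an ambient isotopy as soon as
    c |D f_u' - D f_u| <= |u' - u| |D f_u| for all pairs of points (D f the difference of the
    two values): for small steps the displacement is 1/2-Lipschitz, hence extends to R^3
    (McShane), and the identity plus such a map is a homeomorphism (Banach).  For unions of
    finitely many moving arcs this is checked pair by pair, so chords of a circle lifted to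
    paraboloids may be moved freely as long as the order of the vertices and the order of the
    sheets at the crossings are kept.

    The line through the vertices 7 and 14 meets the cycle only there.  In both halves the path
    along the boundary can be shortened to one chord, leaving the heptagram: the closed 2-braid
    with seven crossings, of which five have one sign and two the other.  Swinging a
    chord around the vertex that it cuts off moves a crossing of the second kind to the next position,
    so all these heptagrams are isotopic to the trefoil of K_7. *)

(** The estimate has to hold for all pairs of points, hence also where their distance tends to 0: on
    a single arc and at a common end of two arcs. This is why every arc is polynomial in its
    parameter: a difference then splits off the factor that vanishes, and the remaining factor only
    has to be Lipschitz in time.

    The combinatorial obstacle is the numbering of the sheets. The sheet of an edge {z, z + d} with
    2d < n depends on z alone, and for z = 1, 2, ... the sheets go down until the numbering starts
    again after about half of the vertices. For the vertices 1 to 5 it never starts again, but among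
    7 to 12 the place of the jump varies with n as long as n < 23. So the two crossings of the
    second kind occur at six different pairs of positions, besides the pair that belongs to K_7, and
    each of the six has to be connected with that of K_7 by swings.

    The knot is cut by the vertical plane through 7 and 14. Both halves are closed by the same chord
    at height 0, which is a straight segment and so becomes the segment required by
    [is_connected_sum] after a rigid motion. *)

(** * The maximum norm on R^3 *)

Definition nrm (p : pt) : R :=
  match p with (x, y, z) => Rmax (Rabs x) (Rmax (Rabs y) (Rabs z)) end.
Definition vadd (p q : pt) : pt :=
  match p, q with (x1, y1, z1), (x2, y2, z2) => (x1 + x2, y1 + y2, z1 + z2) end.
Definition vsub (p q : pt) : pt :=
  match p, q with (x1, y1, z1), (x2, y2, z2) => (x1 - x2, y1 - y2, z1 - z2) end.
Definition vscal (t : R) (p : pt) : pt :=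
  match p with (x, y, z) => (t * x, t * y, t * z) end.

Lemma nrm_le x y z r :
  nrm (x, y, z) <= r <-> Rabs x <= r /\ Rabs y <= r /\ Rabs z <= r.
Proof.
  unfold nrm; split.
  - intros H.
    pose proof (Rmax_l (Rabs x) (Rmax (Rabs y) (Rabs z))).
    pose proof (Rmax_r (Rabs x) (Rmax (Rabs y) (Rabs z))).
    pose proof (Rmax_l (Rabs y) (Rabs z)).
    pose proof (Rmax_r (Rabs y) (Rabs z)). lra.
  - intros (H1 & H2 & H3). repeat apply Rmax_lub; assumption.
Qed.

Lemma nrm_bounds x y z :
  Rabs x <= nrm (x, y, z) /\ Rabs y <= nrm (x, y, z) /\ Rabs z <= nrm (x, y, z).
Proof. apply nrm_le, Rle_refl. Qed.

Lemma dist3_nrm p q : dist3 p q = nrm (vsub p q).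
Proof. destruct p as [[? ?] ?], q as [[? ?] ?]; reflexivity. Qed.

Lemma nrm_nonneg p : 0 <= nrm p.
Proof.
  destruct p as [[x y] z].
  pose proof (nrm_bounds x y z); pose proof (Rabs_pos x); lra.
Qed.

Lemma nrm_vadd p q : nrm (vadd p q) <= nrm p + nrm q.
Proof.
  destruct p as [[x y] z], q as [[x' y'] z']; simpl vadd.
  apply nrm_le.
  pose proof (nrm_bounds x y z); pose proof (nrm_bounds x' y' z').
  pose proof (Rabs_triang x x'); pose proof (Rabs_triang y y');
    pose proof (Rabs_triang z z'); lra.
Qed.

Lemma nrm_vscal t p : nrm (vscal t p) <= Rabs t * nrm p.
Proof.
  destruct p as [[x y] z]; simpl vscal. apply nrm_le.
  rewrite !Rabs_mult. pose proof (nrm_bounds x y z). pose proof (Rabs_pos t).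
  repeat split; apply Rmult_le_compat_l; lra.
Qed.

Lemma nrm_opp x y z : nrm (- x, - y, - z) = nrm (x, y, z).
Proof. unfold nrm; rewrite !Rabs_Ropp; reflexivity. Qed.

Lemma dist3_nonneg p q : 0 <= dist3 p q.
Proof. rewrite dist3_nrm; apply nrm_nonneg. Qed.

Lemma dist3_refl p : dist3 p p = 0.
Proof.
  rewrite dist3_nrm; apply Rle_antisym; [| apply nrm_nonneg].
  destruct p as [[x y] z]; simpl vsub; apply nrm_le.
  rewrite !Rminus_diag, Rabs_R0; lra.
Qed.

Lemma dist3_sym p q : dist3 p q = dist3 q p.
Proof.
  destruct p as [[x y] z], q as [[x' y'] z']; unfold dist3.
  rewrite (Rabs_minus_sym x), (Rabs_minus_sym y), (Rabs_minus_sym z); reflexivity.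
Qed.

Lemma dist3_triangle p q r : dist3 p r <= dist3 p q + dist3 q r.
Proof.
  rewrite !dist3_nrm.
  replace (vsub p r) with (vadd (vsub p q) (vsub q r)); [apply nrm_vadd|].
  destruct p as [[? ?] ?], q as [[? ?] ?], r as [[? ?] ?]; simpl; f_equal; [f_equal|]; ring.
Qed.

Lemma dist3_eq0 p q : dist3 p q <= 0 -> p = q.
Proof.
  destruct p as [[x y] z], q as [[x' y'] z']; rewrite dist3_nrm; simpl vsub.
  rewrite nrm_le; intros (H1 & H2 & H3).
  assert (aux : forall a b, Rabs (a - b) <= 0 -> a = b).
  { intros a b H. pose proof (Rle_abs (a - b)). pose proof (Rle_abs (- (a - b))) as H'.
    rewrite Rabs_Ropp in H'. lra. }
  rewrite (aux _ _ H1), (aux _ _ H2), (aux _ _ H3); reflexivity.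
Qed.

(** * Isotopies with a jointly continuous inverse *)

Definition jointly_continuous (H : R -> pt -> pt) : Prop :=
  forall t x, 0 <= t <= 1 -> forall eps, 0 < eps -> exists delta, 0 < delta /\
    forall s y, 0 <= s <= 1 -> Rabs (s - t) < delta -> dist3 x y < delta ->
      dist3 (H t x) (H s y) < eps.

(** [ambient_isotopic] gives an inverse at each time separately. Carrying along an inverse that is
    continuous in time and space together makes symmetry immediate: the inverse family is itself an
    isotopy. *)
Definition iso (A B : pt -> Prop) : Prop :=
  exists H G : R -> pt -> pt,
    jointly_continuous H /\ jointly_continuous G /\
    (forall x, H 0 x = x) /\
    (forall t x, 0 <= t <= 1 -> G t (H t x) = x /\ H t (G t x) = x) /\
    (forall y, B y <-> exists x, A x /\ H 1 x = y).

Lemma iso_ambient A B : iso A B -> ambient_isotopic A B.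
Proof.
  intros (H & G & cH & cG & H0 & HG & HAB).
  exists H; repeat split; try assumption; try apply HAB.
  intros t Ht; exists (G t); split.
  - intros x eps Heps. destruct (cG t x Ht eps Heps) as (d & Hd & K).
    exists d; split; [exact Hd|]. intros y Hy. apply K; try assumption.
    rewrite Rminus_diag, Rabs_R0; exact Hd.
  - intros x; apply HG, Ht.
Qed.

Lemma jointly_continuous_comp H1 H2 :
  jointly_continuous H1 -> jointly_continuous H2 ->
  jointly_continuous (fun t x => H2 t (H1 t x)).
Proof.
  intros c1 c2 t x Ht eps Heps.
  destruct (c2 t (H1 t x) Ht eps Heps) as (d2 & Hd2 & K2).
  destruct (c1 t x Ht d2 Hd2) as (d1 & Hd1 & K1).
  exists (Rmin d1 d2); split; [apply Rmin_glb_lt; assumption|].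
  intros s y Hs H H'.
  pose proof (Rmin_l d1 d2); pose proof (Rmin_r d1 d2).
  apply K2; [exact Hs | lra | apply K1; [exact Hs | lra | lra]].
Qed.

Lemma iso_ext A B : (forall p, A p <-> B p) -> iso A B.
Proof.
  intros E. exists (fun _ x => x), (fun _ x => x).
  assert (c : jointly_continuous (fun _ x => x)).
  { intros t x _ eps Heps; exists eps; split; auto. }
  repeat split; auto.
  - intros Hy; exists y; split; [apply E|]; auto.
  - intros (x & Hx & <-); apply E, Hx.
Qed.

Lemma iso_sym A B : iso A B -> iso B A.
Proof.
  intros (H & G & cH & cG & H0 & HG & HAB).
  exists G, H; repeat split; auto.
  - intros x. rewrite <- (H0 x) at 1. apply HG; lra.
  - apply HG; assumption.
  - apply HG; assumption.
  - intros Ay. exists (H 1 y); split; [apply HAB; exists y; auto | apply HG; lra].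
  - intros (x & Bx & <-). apply HAB in Bx as (a & Aa & <-).
    replace (G 1 (H 1 a)) with a; [exact Aa | symmetry; apply HG; lra].
Qed.

Lemma iso_trans A B C : iso A B -> iso B C -> iso A C.
Proof.
  intros (H & G & cH & cG & H0 & HG & HAB) (H' & G' & cH' & cG' & H0' & HG' & HBC).
  exists (fun t x => H' t (H t x)), (fun t x => G t (G' t x)); repeat split.
  - apply jointly_continuous_comp; assumption.
  - apply jointly_continuous_comp; assumption.
  - intros x; rewrite H0'; apply H0.
  - rewrite (proj1 (HG' t (H t x) H1)). apply HG; assumption.
  - rewrite (proj2 (HG t (G' t x) H1)). apply HG'; assumption.
  - intros Cy. apply HBC in Cy as (b & Bb & <-). apply HAB in Bb as (a & Aa & <-).
    exists a; auto.
  - intros (a & Aa & <-). apply HBC. exists (H 1 a); split; [apply HAB; exists a; auto|auto].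
Qed.

(** * Lipschitz perturbations *)

(** The extension at [x] is the supremum over [s] of [d s - L * dist3 x (f s)]. The set is given by
    a parametrisation [f]; the hypothesis makes [d] constant on its fibres. *)
Lemma mcshane_extension (S : Type) (P : S -> Prop) (f : S -> pt) (d : S -> R) (L : R) :
  0 <= L ->
  (forall s s', P s -> P s' -> Rabs (d s - d s') <= L * dist3 (f s) (f s')) ->
  exists g : pt -> R, (forall x y, Rabs (g x - g y) <= L * dist3 x y) /\
    forall s, P s -> g (f s) = d s.
Proof.
  intros HL Hd.
  destruct (classic (exists s, P s)) as [[s0 P0]|no].
  (* Over the empty set there is no supremum, so this case is treated apart. *)
  2:{ exists (fun _ => 0); split.
      - intros x y. rewrite Rminus_diag, Rabs_R0.
        apply Rmult_le_pos; [lra | apply dist3_nonneg].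
      - intros s Ps; exfalso; eauto. }
  pose (E := fun (x : pt) (r : R) => exists s, P s /\ r = d s - L * dist3 x (f s)).
  assert (Eb : forall x, bound (E x)).
  { intros x. exists (d s0 + L * dist3 x (f s0)). intros r (s & Ps & ->).
    pose proof (Rle_trans _ _ _ (Rle_abs _) (Hd s s0 Ps P0)).
    pose proof (dist3_triangle (f s) x (f s0)) as T. rewrite (dist3_sym (f s) x) in T.
    pose proof (Rmult_le_compat_l L _ _ HL T). lra. }
  assert (En : forall x, exists r, E x r) by (intros x; eexists; exists s0; split; auto).
  pose (g := fun x => proj1_sig (completeness (E x) (Eb x) (En x))).
  assert (Hg : forall x, is_lub (E x) (g x)) by (intros x; apply (proj2_sig (completeness _ _ _))).
  assert (gl : forall x y, g x <= g y + L * dist3 x y).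
  { intros x y. apply (Hg x). intros r (s & Ps & ->).
    pose proof (proj1 (Hg y) _ (ex_intro _ s (conj Ps eq_refl))).
    pose proof (dist3_triangle y x (f s)) as T. rewrite (dist3_sym y x) in T.
    pose proof (Rmult_le_compat_l L _ _ HL T). lra. }
  exists g; split.
  - intros x y. pose proof (gl x y). pose proof (gl y x) as H1. rewrite dist3_sym in H1.
    apply Rabs_le; lra.
  - intros s Ps. apply Rle_antisym.
    + apply (Hg (f s)). intros r (s' & Ps' & ->).
      pose proof (Rle_trans _ _ _ (Rle_abs _) (Hd s' s Ps' Ps)) as H1.
      rewrite dist3_sym in H1. lra.
    + apply (Hg (f s)). exists s; split; [exact Ps|]. rewrite dist3_refl. ring.
Qed.

Lemma geometric_cauchy (u : nat -> R) (D : R) :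
  (forall n, Rabs (u (S n) - u n) <= D * (1/2) ^ n) ->
  exists l, forall n, Rabs (u n - l) <= 2 * D * (1/2) ^ n.
Proof.
  intros Hu.
  assert (D0 : 0 <= D).
  { pose proof (Hu 0%nat). pose proof (Rabs_pos (u 1%nat - u 0%nat)). simpl in H. lra. }
  assert (pw : forall n, 0 < (1/2)^n) by (intros; apply pow_lt; lra).
  (* The subtracted term is what makes the induction on [k] close; [tail'] drops it. *)
  assert (tail : forall n k, Rabs (u (n + k)%nat - u n) <= 2 * D * (1/2)^n - 2 * D * (1/2)^(n+k)).
  { intros n k; induction k.
    - rewrite Nat.add_0_r, Rminus_diag, Rabs_R0; lra.
    - replace (n + S k)%nat with (S (n + k)) by lia.
      replace (u (S (n+k)) - u n) with ((u (S (n + k)) - u (n+k)%nat) + (u (n+k)%nat - u n)) by ring.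
      eapply Rle_trans; [apply Rabs_triang|]. pose proof (Hu (n+k)%nat).
      replace (2 * D * (1/2)^(S (n+k))) with (D * (1/2)^(n+k)) by (simpl; lra). lra. }
  assert (tail' : forall n k, Rabs (u (n + k)%nat - u n) <= 2 * D * (1/2)^n).
  { intros n k. pose proof (tail n k). pose proof (pw (n+k)%nat).
    assert (0 <= 2 * D * (1/2)^(n+k)) by (apply Rmult_le_pos; lra). lra. }
  assert (small : forall eps, 0 < eps -> exists N, forall n, (n >= N)%nat -> 2 * D * (1/2)^n < eps).
  { intros eps He.
    destruct (pow_lt_1_zero (1/2) ltac:(rewrite Rabs_pos_eq; lra) (eps / (2 * D + 1))) as [N HN].
    { apply Rdiv_lt_0_compat; lra. }
    exists N; intros n Hn. pose proof (HN n Hn) as H1. rewrite Rabs_pos_eq in H1 by (left; apply pw).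
    apply Rmult_lt_compat_l with (r := 2 * D + 1) in H1; [| lra].
    replace ((2 * D + 1) * (eps / (2 * D + 1))) with eps in H1 by (field; lra).
    pose proof (pw n). nra. }
  assert (C : Cauchy_crit u).
  { intros eps He. destruct (small (eps/2) ltac:(lra)) as [N HN]. exists N.
    intros n m Hn Hm. unfold Rdist.
    replace (u n - u m) with ((u n - u N) - (u m - u N)) by ring.
    replace n with (N + (n - N))%nat by lia. replace m with (N + (m - N))%nat by lia.
    pose proof (tail' N (n - N)%nat); pose proof (tail' N (m - N)%nat).
    pose proof (HN N (Nat.le_refl N)).
    eapply Rle_lt_trans; [apply Rabs_triang|]. rewrite Rabs_Ropp. lra. }
  destruct (R_complete u C) as [l Hl]. exists l. intros n.
  apply le_epsilon. intros eps He. destruct (Hl eps He) as [N HN].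
  pose proof (HN (n + N)%nat ltac:(lia)) as H1. unfold Rdist in H1.
  pose proof (tail' n N).
  replace (u n - l) with (- (u (n + N)%nat - u n) + (u (n+N)%nat - l)) by ring.
  eapply Rle_trans; [apply Rabs_triang|]. rewrite Rabs_Ropp. lra.
Qed.

Lemma banach_half (F : pt -> pt) :
  (forall x y, dist3 (F x) (F y) <= 1/2 * dist3 x y) -> exists x, F x = x.
Proof.
  intros HF.
  pose (u := fun n => Nat.iter n F (0,0,0)).
  pose (D := dist3 (u 1%nat) (u 0%nat)).
  assert (Hu : forall n, dist3 (u (S n)) (u n) <= D * (1/2)^n).
  { induction n; [unfold D; simpl; lra|].
    change (u (S (S n))) with (F (u (S n))). change (u (S n)) with (F (u n)) at 2.
    eapply Rle_trans; [apply HF|]. simpl pow. lra. }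
  pose (c1 := fun p : pt => fst (fst p)). pose (c2 := fun p : pt => snd (fst p)).
  pose (c3 := fun p : pt => snd p).
  assert (comp : forall p q : pt, Rabs (c1 p - c1 q) <= dist3 p q /\
     Rabs (c2 p - c2 q) <= dist3 p q /\ Rabs (c3 p - c3 q) <= dist3 p q).
  { intros [[x y] z] [[x' y'] z']. rewrite dist3_nrm. apply nrm_bounds. }
  destruct (geometric_cauchy (fun n => c1 (u n)) D) as [l1 H1].
  { intros n; eapply Rle_trans; [apply comp | apply Hu]. }
  destruct (geometric_cauchy (fun n => c2 (u n)) D) as [l2 H2].
  { intros n; eapply Rle_trans; [apply comp | apply Hu]. }
  destruct (geometric_cauchy (fun n => c3 (u n)) D) as [l3 H3].
  { intros n; eapply Rle_trans; [apply comp | apply Hu]. }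
  pose (l := (l1, l2, l3) : pt). exists l.
  assert (Hl : forall n, dist3 (u n) l <= 2 * D * (1/2)^n).
  { intros n. pose proof (H1 n); pose proof (H2 n); pose proof (H3 n).
    destruct (u n) as [[x y] z]. rewrite dist3_nrm. apply nrm_le; auto. }
  (* With [u] the iterates, [F l] is within D/2^N of [u (S N)], and so is [l]. Hence [F l] and [l]
     are within 2D/2^N of each other; [3 * D + 1] leaves room and is positive even for D = 0. *)
  apply dist3_eq0. apply le_epsilon. intros eps He.
  assert (D0 : 0 <= D) by apply dist3_nonneg.
  destruct (pow_lt_1_zero (1/2) ltac:(rewrite Rabs_pos_eq; lra) (eps / (3 * D + 1))) as [N HN].
  { apply Rdiv_lt_0_compat; lra. }
  pose proof (HN N (Nat.le_refl N)) as H.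
  rewrite Rabs_pos_eq in H by (left; apply pow_lt; lra).
  apply Rmult_lt_compat_l with (r := 3 * D + 1) in H; [| lra].
  replace ((3 * D + 1) * (eps / (3 * D + 1))) with eps in H by (field; lra).
  assert (0 < (1/2)^N) by (apply pow_lt; lra).
  pose proof (dist3_triangle (F l) (u (S N)) l) as T.
  pose proof (HF l (u N)) as K. change (F (u N)) with (u (S N)) in K.
  rewrite (dist3_sym l) in K. pose proof (Hl N). pose proof (Hl (S N)) as K'. simpl pow in K'. nra.
Qed.

(** Solving x + t g(x) = y means finding the fixed point of y - t g, a contraction with factor 1/2.
    The estimate [low], that images are at least half as far apart as the points up to the change of
    time, gives both uniqueness and continuity of the solution. *)
Lemma lipschitz_flow (g : pt -> pt) :
  (forall x y, dist3 (g x) (g y) <= 1/2 * dist3 x y) ->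
  exists G : R -> pt -> pt,
    jointly_continuous (fun t x => vadd x (vscal t (g x))) /\ jointly_continuous G /\
    forall t x, 0 <= t <= 1 ->
      G t (vadd x (vscal t (g x))) = x /\ vadd (G t x) (vscal t (g (G t x))) = x.
Proof.
  intros Hg.
  pose (H := fun t x => vadd x (vscal t (g x))).
  assert (key : forall t s x y, 0 <= s <= 1 ->
     dist3 (vscal t (g x)) (vscal s (g y)) <= Rabs (t - s) * nrm (g x) + 1/2 * dist3 x y).
  { intros t s x y Hs. rewrite !dist3_nrm.
    replace (vsub (vscal t (g x)) (vscal s (g y))) with
      (vadd (vscal (t - s) (g x)) (vscal s (vsub (g x) (g y)))).
    2:{ destruct (g x) as [[? ?] ?], (g y) as [[? ?] ?]; simpl; f_equal; [f_equal|]; ring. }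
    eapply Rle_trans; [apply nrm_vadd|]. apply Rplus_le_compat; [apply nrm_vscal|].
    eapply Rle_trans; [apply nrm_vscal|]. rewrite <- !dist3_nrm.
    rewrite Rabs_pos_eq by lra. pose proof (Hg x y). pose proof (dist3_nonneg (g x) (g y)). nra. }
  (* The condition on [t] stands inside the existence statement so that [G] can be chosen as a total
     function; outside [0, 1] its value is arbitrary. *)
  assert (ex : forall t y, exists x, 0 <= t <= 1 -> H t x = y).
  { intros t y. destruct (classic (0 <= t <= 1)) as [Ht|]; [|exists y; tauto].
    destruct (banach_half (fun x => vsub y (vscal t (g x)))) as [x Hx].
    - intros x x'. pose proof (key t t x x' Ht) as K. rewrite Rminus_diag, Rabs_R0 in K.
      replace (dist3 (vsub y (vscal t (g x))) (vsub y (vscal t (g x'))))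
        with (dist3 (vscal t (g x')) (vscal t (g x))).
      2:{ rewrite !dist3_nrm. f_equal.
          destruct y as [[? ?] ?], (vscal t (g x)) as [[? ?] ?], (vscal t (g x')) as [[? ?] ?];
            simpl; f_equal; [f_equal|]; ring. }
      rewrite dist3_sym. lra.
    - exists x. intros _. unfold H. rewrite <- Hx at 1.
      destruct y as [[? ?] ?], (vscal t (g x)) as [[? ?] ?]; simpl; f_equal; [f_equal|]; ring. }
  pose (G := fun t y => proj1_sig (constructive_indefinite_description _ (ex t y))).
  assert (HG : forall t y, 0 <= t <= 1 -> H t (G t y) = y).
  { intros t y Ht. unfold G. destruct (constructive_indefinite_description _ _) as [x Hx]. auto. }
  assert (low : forall t s x y, 0 <= t <= 1 -> 0 <= s <= 1 ->
     1/2 * dist3 x y <= dist3 (H t x) (H s y) + Rabs (t - s) * nrm (g x)).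
  { intros t s x y Ht Hs. pose proof (key t s x y Hs) as K.
    assert (dist3 x y <= dist3 (H t x) (H s y) + dist3 (vscal t (g x)) (vscal s (g y))); [|lra].
    rewrite !dist3_nrm.
    replace (vsub x y) with (vadd (vsub (H t x) (H s y)) (vsub (vscal s (g y)) (vscal t (g x)))).
    2:{ unfold H. destruct x as [[? ?] ?], y as [[? ?] ?], (vscal t (g _)) as [[? ?] ?], (vscal s (g _)) as [[? ?] ?];
         simpl; f_equal; [f_equal|]; ring. }
    eapply Rle_trans; [apply nrm_vadd|]. rewrite <- !dist3_nrm.
    rewrite (dist3_sym (vscal s (g y))). lra. }
  exists G; repeat split.
  - intros t x Ht eps He. pose proof (nrm_nonneg (g x)).
    exists (eps / (2 + nrm (g x))); split; [apply Rdiv_lt_0_compat; lra|].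
    intros s y Hs Hts Hxy.
    assert (dist3 (H t x) (H s y) <= dist3 x y + dist3 (vscal t (g x)) (vscal s (g y))).
    { unfold H. rewrite !dist3_nrm.
      replace (vsub (vadd x (vscal t (g x))) (vadd y (vscal s (g y)))) with
        (vadd (vsub x y) (vsub (vscal t (g x)) (vscal s (g y)))); [apply nrm_vadd|].
      destruct x as [[? ?] ?], y as [[? ?] ?], (vscal t (g _)) as [[? ?] ?], (vscal s (g _)) as [[? ?] ?];
         simpl; f_equal; [f_equal|]; ring. }
    pose proof (key t s x y Hs). rewrite Rabs_minus_sym in Hts.
    set (d := eps / (2 + nrm (g x))) in *.
    assert (d * (2 + nrm (g x)) = eps) by (unfold d; field; lra).
    fold (H t x) (H s y).
    pose proof (Rmult_le_compat_r (nrm (g x)) _ _ (nrm_nonneg _) (Rlt_le _ _ Hts)). nra.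
  - intros t x Ht eps He. pose proof (nrm_nonneg (g (G t x))).
    set (d := eps / (4 * (1 + nrm (g (G t x))))).
    assert (0 < d) by (apply Rdiv_lt_0_compat; lra).
    assert (4 * (d * (1 + nrm (g (G t x)))) = eps) by (unfold d; field; lra).
    exists d; split; [assumption|]. intros s y Hs Hts Hxy. rewrite Rabs_minus_sym in Hts.
    pose proof (low t s (G t x) (G s y) Ht Hs) as K. rewrite !HG in K by assumption.
    pose proof (Rmult_le_compat_r (nrm (g (G t x))) _ _ (nrm_nonneg _) (Rlt_le _ _ Hts)). nra.
  - pose proof (low t t (G t (H t x)) x H0 H0) as K. rewrite HG in K by assumption.
    rewrite dist3_refl, Rminus_diag, Rabs_R0 in K.
    apply dist3_eq0. fold (H t x). lra.
  - apply (HG t x H0).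
Qed.

(** * From displacement estimates to isotopies *)

Definition image {S : Type} (P : S -> Prop) (f : S -> pt) (p : pt) : Prop :=
  exists s, P s /\ p = f s.

(** The displacement g - f is a 1/2-Lipschitz function on the image of [f]. It is extended
    coordinate by coordinate, which keeps the constant because the distance is the maximum norm, and
    the extension is the field of [lipschitz_flow]. *)
Lemma iso_perturb (S : Type) (P : S -> Prop) (f g : S -> pt) :
  (forall s s', P s -> P s' ->
     nrm (vsub (vsub (g s) (g s')) (vsub (f s) (f s'))) <= 1/2 * dist3 (f s) (f s')) ->
  iso (image P f) (image P g).
Proof.
  intros Hfg.
  pose (d := fun s => vsub (g s) (f s)).
  assert (Hd : forall s s', P s -> P s' -> dist3 (d s) (d s') <= 1/2 * dist3 (f s) (f s')).
  { intros s s' Ps Ps'. eapply Rle_trans; [|apply Hfg; assumption]. right.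
    rewrite dist3_nrm. f_equal. unfold d.
    destruct (f s) as [[? ?] ?], (f s') as [[? ?] ?], (g s) as [[? ?] ?], (g s') as [[? ?] ?];
      simpl; f_equal; [f_equal|]; ring. }
  pose (c1 := fun p : pt => fst (fst p)). pose (c2 := fun p : pt => snd (fst p)).
  pose (c3 := fun p : pt => snd p).
  assert (comp : forall p q : pt, Rabs (c1 p - c1 q) <= dist3 p q /\
     Rabs (c2 p - c2 q) <= dist3 p q /\ Rabs (c3 p - c3 q) <= dist3 p q).
  { intros [[x y] z] [[x' y'] z']. rewrite dist3_nrm. apply nrm_bounds. }
  destruct (mcshane_extension S P f (fun s => c1 (d s)) (1/2)) as (g1 & L1 & E1); [lra| |].
  { intros s s' Ps Ps'. eapply Rle_trans; [apply comp | auto]. }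
  destruct (mcshane_extension S P f (fun s => c2 (d s)) (1/2)) as (g2 & L2 & E2); [lra| |].
  { intros s s' Ps Ps'. eapply Rle_trans; [apply comp | auto]. }
  destruct (mcshane_extension S P f (fun s => c3 (d s)) (1/2)) as (g3 & L3 & E3); [lra| |].
  { intros s s' Ps Ps'. eapply Rle_trans; [apply comp | auto]. }
  pose (h := fun x => (g1 x, g2 x, g3 x) : pt).
  destruct (lipschitz_flow h) as (G & cH & cG & HG).
  { intros x y. rewrite dist3_nrm. apply nrm_le; auto. }
  assert (Hh : forall s, P s -> vadd (f s) (vscal 1 (h (f s))) = g s).
  { intros s Ps. unfold h. rewrite E1, E2, E3 by assumption. unfold d, c1, c2, c3.
    destruct (f s) as [[? ?] ?], (g s) as [[? ?] ?]; simpl; f_equal; [f_equal|]; ring. }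
  exists (fun t x => vadd x (vscal t (h x))), G; repeat split; auto; try apply HG; auto.
  - intros x. destruct x as [[? ?] ?]. unfold h; simpl; f_equal; [f_equal|]; ring.
  - intros (s & Ps & ->). exists (f s); split; [exists s; auto | auto].
  - intros (x & (s & Ps & ->) & <-). exists s; auto.
Qed.

Definition I01 (t : R) : Prop := 0 <= t <= 1.

(** Cut the time into N > 2/c equal steps. Each step changes a difference by at most 1/(cN) < 1/2 of
    its length, so it is a perturbation covered by [iso_perturb]. *)
Lemma iso_path (S : Type) (P : S -> Prop) (f : R -> S -> pt) (c : R) :
  0 < c ->
  (forall u u' s s', I01 u -> I01 u' -> P s -> P s' ->
     c * nrm (vsub (vsub (f u' s) (f u' s')) (vsub (f u s) (f u s')))
       <= Rabs (u' - u) * dist3 (f u s) (f u s')) ->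
  iso (image P (f 0)) (image P (f 1)).
Proof.
  intros Hc Hf.
  destruct (INR_archimed 1 (2 / c)) as [N HN]; [lra|].
  assert (HN0 : 0 < INR N).
  { assert (0 < 2 / c) by (apply Rdiv_lt_0_compat; lra). lra. }
  assert (Hk : forall k, (k <= N)%nat -> iso (image P (f 0)) (image P (f (INR k / INR N)))).
  { induction k; intros Hk.
    - simpl INR. unfold Rdiv; rewrite Rmult_0_l. apply iso_ext; reflexivity.
    - eapply iso_trans; [apply IHk; lia|]. apply iso_perturb. intros s s' Ps Ps'.
      assert (b : forall j, (j <= N)%nat -> I01 (INR j / INR N)).
      { intros j Hj. apply le_INR in Hj. pose proof (pos_INR j). split.
        - apply Rmult_le_pos; [lra | left; apply Rinv_0_lt_compat; lra].
        - apply Rmult_le_reg_r with (INR N); [lra|].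
          unfold Rdiv. rewrite Rmult_assoc, Rinv_l; lra. }
      pose proof (Hf _ _ s s' (b k ltac:(lia)) (b (Datatypes.S k) Hk) Ps Ps') as K.
      replace (INR (Datatypes.S k) / INR N - INR k / INR N) with (/ INR N) in K
        by (rewrite S_INR; field; lra).
      rewrite Rabs_pos_eq in K by (left; apply Rinv_0_lt_compat; lra).
      set (X := nrm _) in *. set (Y := dist3 _ _) in *.
      assert (0 <= Y) by apply dist3_nonneg. assert (0 <= X) by apply nrm_nonneg.
      assert (c * INR N > 2).
      { apply Rmult_lt_compat_l with (r := c) in HN; [|lra].
        replace (c * (2 / c)) with 2 in HN by (field; lra). lra. }
      apply Rmult_le_compat_l with (r := INR N) in K; [|lra].
      rewrite <- !Rmult_assoc, Rinv_r in K by lra. nra. }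
  specialize (Hk N (Nat.le_refl N)).
  replace (INR N / INR N) with 1 in Hk by (field; lra). exact Hk.
Qed.

(** * Moving arcs *)

Definition marc : Type := R -> R -> pt.

(** The hypothesis of [iso_path] for one point on each arc, the parameters being fixed while time
    passes. The case f = g is meant too: it expresses that a single arc stays embedded. *)
Definition pairgood (f g : marc) : Prop :=
  exists c, 0 < c /\ forall u u' t t', I01 u -> I01 u' -> I01 t -> I01 t' ->
    c * nrm (vsub (vsub (f u' t) (g u' t')) (vsub (f u t) (g u t')))
      <= Rabs (u' - u) * nrm (vsub (f u t) (g u t')).

Definition arcset (L : list marc) (u : R) (p : pt) : Prop :=
  exists f, In f L /\ exists t, I01 t /\ p = f u t.

Lemma pairgood_weaken f g c c' : 0 < c' <= c ->
  (forall u u' t t', I01 u -> I01 u' -> I01 t -> I01 t' ->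
    c * nrm (vsub (vsub (f u' t) (g u' t')) (vsub (f u t) (g u t')))
      <= Rabs (u' - u) * nrm (vsub (f u t) (g u t'))) ->
  forall u u' t t', I01 u -> I01 u' -> I01 t -> I01 t' ->
    c' * nrm (vsub (vsub (f u' t) (g u' t')) (vsub (f u t) (g u t')))
      <= Rabs (u' - u) * nrm (vsub (f u t) (g u t')).
Proof.
  intros Hc H u u' t t' Hu Hu' Ht Ht'. eapply Rle_trans; [|apply H; assumption].
  apply Rmult_le_compat_r; [apply nrm_nonneg | lra].
Qed.

Lemma pairgood_uniform (L L' : list marc) :
  (forall f g, In f L -> In g L' -> pairgood f g) ->
  exists c, 0 < c /\ forall f g, In f L -> In g L' ->
    forall u u' t t', I01 u -> I01 u' -> I01 t -> I01 t' ->
    c * nrm (vsub (vsub (f u' t) (g u' t')) (vsub (f u t) (g u t')))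
      <= Rabs (u' - u) * nrm (vsub (f u t) (g u t')).
Proof.
  induction L as [|f L IH]; intros H.
  { exists 1; split; [lra|]. intros f g []. }
  destruct IH as (c1 & Hc1 & H1). { intros; apply H; simpl; auto. }
  assert (H2 : forall L'', incl L'' L' -> exists c, 0 < c /\ forall g, In g L'' ->
    forall u u' t t', I01 u -> I01 u' -> I01 t -> I01 t' ->
    c * nrm (vsub (vsub (f u' t) (g u' t')) (vsub (f u t) (g u t')))
      <= Rabs (u' - u) * nrm (vsub (f u t) (g u t'))).
  { induction L'' as [|g L'' IH]; intros Hi.
    { exists 1; split; [lra|]. intros g []. }
    destruct IH as (c & Hc & K). { intros x Hx; apply Hi; simpl; auto. }
    destruct (H f g) as (c' & Hc' & K'). { simpl; auto. } { apply Hi; simpl; auto. }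
    exists (Rmin c c'); split; [apply Rmin_glb_lt; assumption|].
    pose proof (Rmin_glb_lt _ _ _ Hc Hc'). pose proof (Rmin_l c c'). pose proof (Rmin_r c c').
    intros g' [<-|Hg'].
    - apply (pairgood_weaken f g c'); [lra | assumption].
    - apply (pairgood_weaken f g' c); [lra | apply K, Hg']. }
  destruct (H2 L' (fun x Hx => Hx)) as (c2 & Hc2 & K2).
  exists (Rmin c1 c2); split; [apply Rmin_glb_lt; assumption|].
  pose proof (Rmin_glb_lt _ _ _ Hc1 Hc2). pose proof (Rmin_l c1 c2). pose proof (Rmin_r c1 c2).
  intros f' g [<-|Hf'] Hg.
  - apply (pairgood_weaken f g c2); [lra | apply K2, Hg].
  - apply (pairgood_weaken f' g c1); [lra | apply H1; assumption].
Qed.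

Theorem iso_arcset (L : list marc) :
  (forall f g, In f L -> In g L -> pairgood f g) -> iso (arcset L 0) (arcset L 1).
Proof.
  intros H. destruct (pairgood_uniform L L H) as (c & Hc & K).
  assert (E : forall u p, arcset L u p <->
     image (fun s : marc * R => In (fst s) L /\ I01 (snd s)) (fun s => fst s u (snd s)) p).
  { intros u p; split.
    - intros (f & Hf & t & Ht & ->). exists (f, t); auto.
    - intros ([f t] & [Hf Ht] & ->). exists f; split; [exact Hf|]. exists t; auto. }
  eapply iso_trans; [apply iso_ext, E|].
  eapply iso_trans; [|apply iso_sym, iso_ext, E].
  apply (iso_path _ _ (fun u s => fst s u (snd s)) c Hc).
  intros u u' [f t] [g t'] Hu Hu' [Hf Ht] [Hg Ht']. rewrite dist3_nrm. apply K; assumption.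
Qed.

Arguments nrm : simpl never.

(** * Bounded functions, uniformly Lipschitz in time *)

(** Boundedness is included so that the class is closed under products. All coordinates that occur
    are polynomials in the parameters, the time, and sines and cosines of affine functions of time,
    so membership is found by syntax alone. *)
Definition bounded_lipschitz {T : Type} (P : T -> Prop) (f : R -> T -> R) : Prop :=
  exists K, 0 <= K /\ forall u u' t, I01 u -> I01 u' -> P t ->
    Rabs (f u t) <= K /\ Rabs (f u' t - f u t) <= K * Rabs (u' - u).

Lemma bl_ext {T} (P : T -> Prop) f g :
  (forall u t, f u t = g u t) -> bounded_lipschitz P f -> bounded_lipschitz P g.
Proof.
  intros E (K & HK & H). exists K; split; [exact HK|]. intros. rewrite <- !E. auto.
Qed.

Lemma bl_still {T} (P : T -> Prop) (h : T -> R) K :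
  (forall t, P t -> Rabs (h t) <= K) -> bounded_lipschitz P (fun _ t => h t).
Proof.
  intros H. exists (Rmax K 0); split; [apply Rmax_r|]. intros u u' t _ _ Pt. split.
  - eapply Rle_trans; [apply H, Pt | apply Rmax_l].
  - rewrite Rminus_diag, Rabs_R0. apply Rmult_le_pos; [apply Rmax_r | apply Rabs_pos].
Qed.

Lemma bl_const {T} (P : T -> Prop) a : bounded_lipschitz P (fun _ _ => a).
Proof. apply (bl_still P (fun _ => a) (Rabs a)); intros; lra. Qed.

Lemma bl_plus {T} (P : T -> Prop) f g :
  bounded_lipschitz P f -> bounded_lipschitz P g -> bounded_lipschitz P (fun u t => f u t + g u t).
Proof.
  intros (K & HK & H) (K' & HK' & H'). exists (K + K'); split; [lra|].
  intros u u' t Hu Hu' Ht. destruct (H u u' t Hu Hu' Ht), (H' u u' t Hu Hu' Ht). split.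
  - eapply Rle_trans; [apply Rabs_triang | lra].
  - replace (f u' t + g u' t - (f u t + g u t)) with ((f u' t - f u t) + (g u' t - g u t)) by ring.
    eapply Rle_trans; [apply Rabs_triang | lra].
Qed.

Lemma bl_mult {T} (P : T -> Prop) f g :
  bounded_lipschitz P f -> bounded_lipschitz P g -> bounded_lipschitz P (fun u t => f u t * g u t).
Proof.
  intros (K & HK & H) (K' & HK' & H'). exists (2 * K * K'); split; [nra|].
  intros u u' t Hu Hu' Ht.
  destruct (H u u' t Hu Hu' Ht) as [a1 a2], (H' u' u t Hu' Hu Ht) as [b1 _],
    (H' u u' t Hu Hu' Ht) as [b0 b2].
  assert (m : forall a b A B, Rabs a <= A -> Rabs b <= B -> Rabs (a * b) <= A * B).
  { intros. rewrite Rabs_mult. apply Rmult_le_compat; auto using Rabs_pos. }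
  split.
  - pose proof (m _ _ _ _ a1 b0). nra.
  - replace (f u' t * g u' t - f u t * g u t)
      with ((f u' t - f u t) * g u' t + f u t * (g u' t - g u t)) by ring.
    eapply Rle_trans; [apply Rabs_triang|].
    pose proof (m _ _ _ _ a2 b1). pose proof (m _ _ _ _ a1 b2). nra.
Qed.

Lemma bl_opp {T} (P : T -> Prop) f : bounded_lipschitz P f -> bounded_lipschitz P (fun u t => - f u t).
Proof.
  intros H. apply (bl_ext P (fun u t => (-1) * f u t)); [intros; ring|].
  apply bl_mult; [apply bl_const | exact H].
Qed.

Lemma bl_minus {T} (P : T -> Prop) f g :
  bounded_lipschitz P f -> bounded_lipschitz P g -> bounded_lipschitz P (fun u t => f u t - g u t).
Proof. intros Hf Hg. apply (bl_plus P f (fun u t => - g u t)); auto using bl_opp. Qed.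

Definition bounded_lipschitz0 (h : R -> R) : Prop := bounded_lipschitz (fun _ : unit => True) (fun u _ => h u).

Lemma bl_of0 {T} (P : T -> Prop) h : bounded_lipschitz0 h -> bounded_lipschitz P (fun u _ => h u).
Proof.
  intros (K & HK & H). exists K; split; [exact HK|]. intros u u' t Hu Hu' _.
  apply (H u u' tt Hu Hu' I).
Qed.

Definition aff (a b u : R) : R := a + u * (b - a).

Lemma bl0_id : bounded_lipschitz0 (fun u => u).
Proof.
  exists 1; split; [lra|]. intros u u' _ [] []. split; [apply Rabs_le|]; lra.
Qed.

Lemma bl0_aff a b : bounded_lipschitz0 (aff a b).
Proof.
  unfold bounded_lipschitz0, aff. apply (bl_plus _ (fun _ _ => a)); [apply bl_const|].
  apply (bl_mult _ (fun u _ => u)); [apply bl0_id | apply bl_const].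
Qed.

Lemma bl0_lipschitz (h : R -> R) f :
  (forall x, Rabs (h x) <= 1) -> (forall x y, Rabs (h x - h y) <= Rabs (x - y)) ->
  bounded_lipschitz0 f -> bounded_lipschitz0 (fun u => h (f u)).
Proof.
  intros Hb Hl (K & HK & H). exists (1 + K); split; [lra|]. intros u u' [] Hu Hu' _.
  destruct (H u u' tt Hu Hu' I). pose proof (Rabs_pos (u' - u)). split.
  - pose proof (Hb (f u)); lra.
  - eapply Rle_trans; [apply Hl|]. nra.
Qed.

Lemma sin_cos_lipschitz x y :
  Rabs (sin x - sin y) <= Rabs (x - y) /\ Rabs (cos x - cos y) <= Rabs (x - y).
Proof.
  assert (aux : forall d, Rabs (2 * sin (d / 2)) <= Rabs d).
  { intros d. assert (H : forall z, 0 <= z -> Rabs (sin z) <= z).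
    { intros z Hz. destruct (Rle_dec z 1).
      - destruct (Req_dec z 0) as [->|]; [rewrite sin_0, Rabs_R0; lra|].
        pose proof PI2_1. pose proof (sin_lt_x z ltac:(lra)).
        assert (0 < sin z) by (apply sin_gt_0; lra). rewrite Rabs_pos_eq; lra.
      - pose proof (SIN_bound z). apply Rabs_le; lra. }
    rewrite Rabs_mult, (Rabs_pos_eq 2) by lra.
    destruct (Rle_dec 0 d).
    - pose proof (H (d/2) ltac:(lra)). rewrite (Rabs_pos_eq d); lra.
    - pose proof (H (-d/2) ltac:(lra)) as K.
      replace (-d/2) with (-(d/2)) in K by lra. rewrite sin_neg, Rabs_Ropp in K.
      rewrite (Rabs_left d); lra. }
  specialize (aux (x - y)).
  assert (m : forall s c, Rabs c <= 1 -> Rabs (2 * s * c) <= Rabs (2 * s)).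
  { intros s c Hc. rewrite Rabs_mult. pose proof (Rabs_pos (2 * s)). pose proof (Rabs_pos c). nra. }
  split.
  - rewrite form4. rewrite Rmult_assoc, (Rmult_comm (cos _)), <- Rmult_assoc.
    eapply Rle_trans; [apply m | exact aux].
    pose proof (COS_bound ((x + y)/2)); apply Rabs_le; lra.
  - rewrite form2.
    replace (-2 * sin ((x - y) / 2) * sin ((x + y) / 2))
      with (2 * sin ((x - y)/2) * (- sin ((x + y)/2))) by ring.
    eapply Rle_trans; [apply m | exact aux].
    pose proof (SIN_bound ((x + y)/2)); apply Rabs_le; lra.
Qed.

Lemma bl0_cos f : bounded_lipschitz0 f -> bounded_lipschitz0 (fun u => cos (f u)).
Proof.
  apply bl0_lipschitz; intros; [|apply sin_cos_lipschitz].
  pose proof (COS_bound x); apply Rabs_le; lra.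
Qed.

Lemma bl0_sin f : bounded_lipschitz0 f -> bounded_lipschitz0 (fun u => sin (f u)).
Proof.
  apply bl0_lipschitz; intros; [|apply sin_cos_lipschitz].
  pose proof (SIN_bound x); apply Rabs_le; lra.
Qed.

(** * Criteria for pairs of moving arcs *)

(** The weight bounds the distance from below and the rate of its change from above, so it cancels.
    It is 1 for arcs that stay apart, |t - t'| for an arc against itself, and t + t' for two arcs
    with a common start. *)
Lemma pairgood_weight (f g : marc) (w : R -> R -> R) K e :
  0 <= K -> 0 < e ->
  (forall u u' t t', I01 u -> I01 u' -> I01 t -> I01 t' ->
    nrm (vsub (vsub (f u' t) (g u' t')) (vsub (f u t) (g u t'))) <= K * Rabs (u' - u) * w t t' /\
    e * w t t' <= nrm (vsub (f u t) (g u t'))) ->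
  pairgood f g.
Proof.
  intros HK He H. exists (e / (K + 1)); split; [apply Rdiv_lt_0_compat; lra|].
  intros u u' t t' Hu Hu' Ht Ht'. destruct (H u u' t t' Hu Hu' Ht Ht') as [H1 H2].
  set (X := nrm (vsub (vsub _ _) _)) in *. set (Y := nrm (vsub (f u t) (g u t'))) in *.
  set (W := w t t') in *.
  pose proof (Rabs_pos (u' - u)) as HE. set (E := Rabs _) in *.
  assert (0 <= X) by apply nrm_nonneg.
  assert (0 <= Y) by apply nrm_nonneg.
  assert (e * X <= K * E * Y).
  { apply Rle_trans with (e * (K * E * W)); [apply Rmult_le_compat_l; lra|].
    replace (e * (K * E * W)) with (K * E * (e * W)) by ring.
    apply Rmult_le_compat_l; [apply Rmult_le_pos; [lra | exact HE] | exact H2]. }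
  apply Rmult_le_reg_l with (K + 1); [lra|].
  replace ((K + 1) * (e / (K + 1) * X)) with (e * X) by (field; lra).
  assert (0 <= E * Y) by (apply Rmult_le_pos; lra). lra.
Qed.

Lemma pairgood_sym f g : pairgood f g -> pairgood g f.
Proof.
  intros (c & Hc & H). exists c; split; [exact Hc|]. intros u u' t t' Hu Hu' Ht Ht'.
  specialize (H u u' t' t Hu Hu' Ht' Ht).
  replace (vsub (g u t) (f u t')) with (vscal (-1) (vsub (f u t') (g u t))).
  2:{ destruct (f u t') as [[? ?] ?], (g u t) as [[? ?] ?]; simpl; f_equal; [f_equal|]; ring. }
  replace (vsub (g u' t) (f u' t')) with (vscal (-1) (vsub (f u' t') (g u' t))).
  2:{ destruct (f u' t') as [[? ?] ?], (g u' t) as [[? ?] ?]; simpl; f_equal; [f_equal|]; ring. }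
  assert (N : forall p, nrm (vscal (-1) p) = nrm p).
  { intros [[x y] z]; simpl. rewrite <- (nrm_opp x y z). f_equal; f_equal; [f_equal|]; ring. }
  rewrite N. eapply Rle_trans; [|exact H]. right. f_equal. rewrite <- N. f_equal.
  destruct (f u t') as [[? ?] ?], (g u t) as [[? ?] ?], (f u' t') as [[? ?] ?], (g u' t) as [[? ?] ?];
    simpl; f_equal; [f_equal|]; ring.
Qed.

Lemma pairgood_rev f f' g :
  (forall u t, f u t = f' u (1 - t)) -> pairgood f' g -> pairgood f g.
Proof.
  intros E (c & Hc & H). exists c; split; [exact Hc|]. intros u u' t t' Hu Hu' Ht Ht'.
  rewrite !E. apply H; auto. unfold I01 in *; lra.
Qed.

Lemma pairgood_static f g :
  (forall u t, f u t = f 0 t) -> (forall u t, g u t = g 0 t) -> pairgood f g.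
Proof.
  intros Ef Eg. exists 1; split; [lra|]. intros u u' t t' _ _ _ _.
  rewrite (Ef u), (Eg u), (Ef u'), (Eg u').
  pose proof (dist3_refl (vsub (f 0 t) (g 0 t'))) as Z. rewrite dist3_nrm in Z. rewrite Z, Rmult_0_r.
  apply Rmult_le_pos; [apply Rabs_pos | apply nrm_nonneg].
Qed.

Definition blmarc (f : marc) : Prop :=
  bounded_lipschitz I01 (fun u t => fst (fst (f u t))) /\ bounded_lipschitz I01 (fun u t => snd (fst (f u t))) /\
  bounded_lipschitz I01 (fun u t => snd (f u t)).

Lemma blmarc_bound f : blmarc f -> exists K, 0 <= K /\
  forall u u' t, I01 u -> I01 u' -> I01 t ->
    nrm (f u t) <= K /\ nrm (vsub (f u' t) (f u t)) <= K * Rabs (u' - u).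
Proof.
  intros ((K1 & H1 & L1) & (K2 & H2 & L2) & (K3 & H3 & L3)).
  exists (K1 + K2 + K3); split; [lra|]. intros u u' t Hu Hu' Ht.
  destruct (L1 u u' t Hu Hu' Ht), (L2 u u' t Hu Hu' Ht), (L3 u u' t Hu Hu' Ht).
  destruct (f u t) as [[x y] z], (f u' t) as [[x' y'] z']. simpl in *.
  pose proof (Rabs_pos (u' - u)).
  assert (0 <= K1 * Rabs (u' - u)) by nra. assert (0 <= K2 * Rabs (u' - u)) by nra.
  assert (0 <= K3 * Rabs (u' - u)) by nra.
  split; apply nrm_le; repeat split; lra.
Qed.

Definition far (f g : marc) : Prop := exists e, 0 < e /\
  forall u t t', I01 u -> I01 t -> I01 t' -> e <= nrm (vsub (f u t) (g u t')).

Lemma pairgood_far f g : blmarc f -> blmarc g -> far f g -> pairgood f g.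
Proof.
  intros Hf Hg (e & He & H).
  destruct (blmarc_bound f Hf) as (K & HK & L), (blmarc_bound g Hg) as (K' & HK' & L').
  apply (pairgood_weight f g (fun _ _ => 1) (K + K') e); [lra | exact He |].
  intros u u' t t' Hu Hu' Ht Ht'. split; [|rewrite Rmult_1_r; apply H; assumption].
  destruct (L u u' t Hu Hu' Ht) as [_ A], (L' u' u t' Hu' Hu Ht') as [_ B].
  rewrite (Rabs_minus_sym u) in B.
  replace (vsub (vsub (f u' t) (g u' t')) (vsub (f u t) (g u t')))
    with (vadd (vsub (f u' t) (f u t)) (vsub (g u t') (g u' t'))).
  2:{ destruct (f u t) as [[? ?] ?], (g u t') as [[? ?] ?], (f u' t) as [[? ?] ?], (g u' t') as [[? ?] ?];
    simpl; f_equal; [f_equal|]; ring. }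
  eapply Rle_trans; [apply nrm_vadd|]. lra.
Qed.

(** [F] is the divided difference of the arc in its parameter; its Lipschitz dependence on time
    makes the change of a difference proportional to |t - t'|. *)
Lemma pairgood_self f (F : R -> R * R -> pt) e :
  let P2 := fun p : R * R => I01 (fst p) /\ I01 (snd p) in
  bounded_lipschitz P2 (fun u p => fst (fst (F u p))) -> bounded_lipschitz P2 (fun u p => snd (fst (F u p))) ->
  bounded_lipschitz P2 (fun u p => snd (F u p)) ->
  (forall u t t', vsub (f u t) (f u t') = vscal (t - t') (F u (t, t'))) ->
  0 < e -> 
  (forall u t t', I01 u -> I01 t -> I01 t' -> e * Rabs (t - t') <= nrm (vsub (f u t) (f u t'))) ->
  pairgood f f.
Proof.
  intros P2 (K1 & H1 & L1) (K2 & H2 & L2) (K3 & H3 & L3) E He H.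
  apply (pairgood_weight f f (fun t t' => Rabs (t - t')) (K1 + K2 + K3) e); [lra | exact He |].
  intros u u' t t' Hu Hu' Ht Ht'. split; [|apply H; assumption].
  rewrite !E.
  replace (vsub (vscal (t - t') (F u' (t, t'))) (vscal (t - t') (F u (t, t'))))
    with (vscal (t - t') (vsub (F u' (t, t')) (F u (t, t')))).
  2:{ destruct (F u' (t,t')) as [[? ?] ?], (F u (t,t')) as [[? ?] ?];
     simpl; f_equal; [f_equal|]; ring. }
  eapply Rle_trans; [apply nrm_vscal|]. rewrite Rmult_comm.
  apply Rmult_le_compat_r; [apply Rabs_pos|].
  assert (Pt : P2 (t, t')) by (split; assumption).
  destruct (L1 u u' _ Hu Hu' Pt), (L2 u u' _ Hu Hu' Pt), (L3 u u' _ Hu Hu' Pt).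
  destruct (F u (t,t')) as [[x y] z], (F u' (t,t')) as [[x' y'] z']. simpl in *.
  pose proof (Rabs_pos (u' - u)).
  assert (0 <= K1 * Rabs (u' - u)) by nra. assert (0 <= K2 * Rabs (u' - u)) by nra.
  assert (0 <= K3 * Rabs (u' - u)) by nra.
  apply nrm_le; repeat split; lra.
Qed.

(** The common starting point, which may itself move, cancels in the difference; [F] and [G] are the
    divided secants from it. *)
Lemma pairgood_adj f g (F G : marc) e :
  blmarc F -> blmarc G ->
  (forall u t t', vsub (f u t) (g u t') = vsub (vscal t (F u t)) (vscal t' (G u t'))) ->
  0 < e -> 
  (forall u t t', I01 u -> I01 t -> I01 t' -> e * (t + t') <= nrm (vsub (f u t) (g u t'))) ->
  pairgood f g.
Proof.
  intros HF HG E He H.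
  destruct (blmarc_bound F HF) as (K & HK & L), (blmarc_bound G HG) as (K' & HK' & L').
  apply (pairgood_weight f g (fun t t' => t + t') (K + K') e); [lra | exact He |].
  intros u u' t t' Hu Hu' Ht Ht'. split; [|apply H; assumption].
  rewrite !E.
  replace (vsub (vsub (vscal t (F u' t)) (vscal t' (G u' t')))
       (vsub (vscal t (F u t)) (vscal t' (G u t'))))
    with (vadd (vscal t (vsub (F u' t) (F u t))) (vscal t' (vsub (G u t') (G u' t')))).
  2:{ destruct (F u' t) as [[? ?] ?], (F u t) as [[? ?] ?], (G u' t') as [[? ?] ?], (G u t') as [[? ?] ?];
     simpl; f_equal; [f_equal|]; ring. }
  destruct (L u u' t Hu Hu' Ht) as [_ A], (L' u' u t' Hu' Hu Ht') as [_ B].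
  rewrite (Rabs_minus_sym u) in B.
  eapply Rle_trans; [apply nrm_vadd|].
  pose proof (nrm_vscal t (vsub (F u' t) (F u t))) as C1.
  pose proof (nrm_vscal t' (vsub (G u t') (G u' t'))) as C2.
  unfold I01 in *. rewrite (Rabs_pos_eq t) in C1 by lra. rewrite (Rabs_pos_eq t') in C2 by lra.
  pose proof (Rmult_le_compat_l t _ _ (proj1 Ht) A).
  pose proof (Rmult_le_compat_l t' _ _ (proj1 Ht') B).
  pose proof (Rabs_pos (u' - u)).
  assert (0 <= K * Rabs (u' - u) * t') by (repeat apply Rmult_le_pos; lra).
  assert (0 <= K' * Rabs (u' - u) * t) by (repeat apply Rmult_le_pos; lra).
  lra.
Qed.

(** * Moving chords lifted to paraboloids *)

Definition p2 : Type := (R * R)%type.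

Definition moving_point (A : R -> p2) : Prop :=
  bounded_lipschitz0 (fun u => fst (A u)) /\ bounded_lipschitz0 (fun u => snd (A u)) /\
  forall u, I01 u -> Rabs (fst (A u)) <= 1 /\ Rabs (snd (A u)) <= 1.

(** Twice the signed area of the triangle, positive when it is run through counterclockwise, and
    affine in each of the points. *)
Definition orient (p q r : p2) : R :=
  (fst q - fst p) * (snd r - snd p) - (snd q - snd p) * (fst r - fst p).

Definition dsq (p q : p2) : R :=
  (fst p - fst q) * (fst p - fst q) + (snd p - snd q) * (snd p - snd q).

Definition cap (p : p2) : R := 1 - fst p * fst p - snd p * snd p.

Definition seg (A B : R -> p2) (u t : R) : p2 :=
  ((1 - t) * fst (A u) + t * fst (B u), (1 - t) * snd (A u) + t * snd (B u)).

Definition ch (A B : R -> p2) (c : R -> R) : marc := fun u t =>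
  (fst (seg A B u t), snd (seg A B u t), c u * cap (seg A B u t)).

Lemma bl_time : bounded_lipschitz I01 (fun _ t => t).
Proof. apply (bl_still I01 (fun t => t) 1). intros t []; apply Rabs_le; lra. Qed.

Ltac blt :=
  repeat first
    [ apply bl_time | apply bl_const | apply bl_of0; assumption
    | apply bl_minus | apply bl_plus | apply bl_mult | apply bl_opp ].

Lemma ch_blmarc A B c : moving_point A -> moving_point B -> bounded_lipschitz0 c -> blmarc (ch A B c).
Proof.
  intros (H1 & H2 & _) (H3 & H4 & _) Hc. unfold ch, seg, cap; simpl.
  repeat split; simpl; blt.
Qed.

Lemma ch_rev A B c u t : ch A B c u t = ch B A c u (1 - t).
Proof. unfold ch, seg, cap; simpl. f_equal; [f_equal|]; ring. Qed.

Lemma seg_box A B u t : moving_point A -> moving_point B -> I01 u -> I01 t ->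
  Rabs (fst (seg A B u t)) <= 1 /\ Rabs (snd (seg A B u t)) <= 1.
Proof.
  intros (_ & _ & HA) (_ & _ & HB) Hu [Ht Ht']. destruct (HA u Hu), (HB u Hu). unfold seg; simpl.
  assert (aux : forall a b, Rabs a <= 1 -> Rabs b <= 1 -> Rabs ((1 - t) * a + t * b) <= 1).
  { intros a b Ha Hb. eapply Rle_trans; [apply Rabs_triang|].
    rewrite !Rabs_mult, (Rabs_pos_eq t), (Rabs_pos_eq (1 - t)) by lra. nra. }
  auto.
Qed.

Lemma orient_seg E F A B u t :
  orient E F (seg A B u t) = (1 - t) * orient E F (A u) + t * orient E F (B u).
Proof. unfold orient, seg; simpl; ring. Qed.

Lemma Rabs_le_mult a b A B : Rabs a <= A -> Rabs b <= B -> Rabs (a * b) <= A * B.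
Proof. intros. rewrite Rabs_mult. apply Rmult_le_compat; auto using Rabs_pos. Qed.

Lemma Rabs_minus_le a b A B : Rabs a <= A -> Rabs b <= B -> Rabs (a - b) <= A + B.
Proof.
  intros. replace (a - b) with (a + - b) by ring.
  eapply Rle_trans; [apply Rabs_triang|]. rewrite Rabs_Ropp; lra.
Qed.

Lemma Rabs_plus_le a b A B : Rabs a <= A -> Rabs b <= B -> Rabs (a + b) <= A + B.
Proof. intros. eapply Rle_trans; [apply Rabs_triang|]; lra. Qed.

Definition inbox (p : p2) : Prop := Rabs (fst p) <= 1 /\ Rabs (snd p) <= 1.

Lemma mp_box A u : moving_point A -> I01 u -> inbox (A u).
Proof. intros (_ & _ & H) Hu; apply H, Hu. Qed.

Lemma orient_bound p q r : inbox p -> inbox q -> inbox r -> Rabs (orient p q r) <= 8.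
Proof.
  intros [] [] []. unfold orient.
  replace 8 with ((1 + 1) * (1 + 1) + (1 + 1) * (1 + 1)) by ring.
  apply Rabs_minus_le; apply Rabs_le_mult; apply Rabs_minus_le; assumption.
Qed.

Lemma orient_lipschitz p q r s n : inbox p -> inbox q ->
  Rabs (fst r - fst s) <= n -> Rabs (snd r - snd s) <= n ->
  Rabs (orient p q r - orient p q s) <= 4 * n.
Proof.
  intros [] [] Hx Hy.
  replace (orient p q r - orient p q s) with
    ((fst q - fst p) * (snd r - snd s) - (snd q - snd p) * (fst r - fst s)) by (unfold orient; ring).
  replace (4 * n) with ((1 + 1) * n + (1 + 1) * n) by ring.
  apply Rabs_minus_le; apply Rabs_le_mult; try assumption; apply Rabs_minus_le; assumption.
Qed.

Lemma gg_lipschitz r s n : inbox r -> inbox s ->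
  Rabs (fst r - fst s) <= n -> Rabs (snd r - snd s) <= n -> Rabs (cap r - cap s) <= 4 * n.
Proof.
  intros [] [] Hx Hy.
  replace (cap r - cap s) with
    ((fst r + fst s) * (-(fst r - fst s)) - (snd r + snd s) * (snd r - snd s)) by (unfold cap; ring).
  replace (4 * n) with ((1 + 1) * n + (1 + 1) * n) by ring.
  apply Rabs_minus_le; apply Rabs_le_mult; try rewrite Rabs_Ropp; try assumption;
    apply Rabs_plus_le; assumption.
Qed.

Lemma ch_diff A B c C D c' u t t' :
  let n := nrm (vsub (ch A B c u t) (ch C D c' u t')) in
  Rabs (fst (seg A B u t) - fst (seg C D u t')) <= n /\
  Rabs (snd (seg A B u t) - snd (seg C D u t')) <= n /\
  Rabs (c u * cap (seg A B u t) - c' u * cap (seg C D u t')) <= n.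
Proof. unfold ch. apply nrm_bounds. Qed.

(** The moving line EF separates the two projections. On the box [orient] is 4-Lipschitz in its last
    argument, which gives the distance o/4 whatever the heights are. *)
Lemma ch_far_side A B c C D c' E F o :
  moving_point A -> moving_point B -> moving_point C -> moving_point D -> moving_point E -> moving_point F -> 0 < o ->
  (forall u, I01 u -> o <= orient (E u) (F u) (A u)) ->
  (forall u, I01 u -> o <= orient (E u) (F u) (B u)) ->
  (forall u, I01 u -> orient (E u) (F u) (C u) <= 0) ->
  (forall u, I01 u -> orient (E u) (F u) (D u) <= 0) ->
  far (ch A B c) (ch C D c').
Proof.
  intros mA mB mC mD mE mF Ho HA HB HC HD. exists (o / 4); split; [lra|].
  intros u t t' Hu Ht Ht'.
  destruct (ch_diff A B c C D c' u t t') as (dx & dy & _). set (n := nrm _) in *.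
  pose proof (orient_lipschitz (E u) (F u) _ _ n (mp_box _ _ mE Hu) (mp_box _ _ mF Hu) dx dy) as L.
  rewrite !orient_seg in L. pose proof (Rle_trans _ _ _ (Rle_abs _) L).
  specialize (HA u Hu). specialize (HB u Hu). specialize (HC u Hu). specialize (HD u Hu).
  unfold I01 in *. nra.
Qed.

(** Minus the power of a point of the chord with respect to the unit circle, that is, the product of
    its distances from the two ends. *)
Lemma gg_chord C D u t :
  cap (C u) = 0 -> cap (D u) = 0 -> cap (seg C D u t) = t * (1 - t) * dsq (C u) (D u).
Proof.
  intros HC HD.
  replace (cap (seg C D u t)) with
    ((1 - t) * cap (C u) + t * cap (D u) + t * (1 - t) * dsq (C u) (D u)); [rewrite HC, HD; ring|].
  unfold cap, seg, dsq; simpl; ring.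
Qed.

(* Near the ends of CD the projections are apart; elsewhere the paraboloids are. *)
Lemma ch_far_cross A B c C D c' E F G H o :
  moving_point A -> moving_point B -> moving_point C -> moving_point D -> moving_point E -> moving_point F -> moving_point G -> moving_point H -> bounded_lipschitz0 c ->
  (forall u, cap (C u) = 0) -> (forall u, cap (D u) = 0) -> 0 < o ->
  (forall u, I01 u -> 0 <= orient (E u) (F u) (A u)) ->
  (forall u, I01 u -> 0 <= orient (E u) (F u) (B u)) ->
  (forall u, I01 u -> orient (E u) (F u) (C u) <= - o) ->
  (forall u, I01 u -> 0 <= orient (G u) (H u) (A u)) ->
  (forall u, I01 u -> 0 <= orient (G u) (H u) (B u)) ->
  (forall u, I01 u -> orient (G u) (H u) (D u) <= - o) ->
  (forall u, I01 u -> o <= dsq (C u) (D u)) ->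
  (forall u, I01 u -> o <= Rabs (c u - c' u)) ->
  far (ch A B c) (ch C D c').
Proof.
  intros mA mB mC mD mE mF mG mH (K & HK & Lc) gC gD Ho' EA EB EC GA GB GD HCD Hcc.
  set (p := Rmin o 1). assert (Hp : 0 < p) by (apply Rmin_glb_lt; lra).
  assert (p1 : p <= 1) by apply Rmin_r. assert (po : p <= o) by apply Rmin_l.
  (* Away from the ends of CD, by more than p/32 in the parameter, [cap] is at least p^2/64, so the
     sheets over a point are at least p^3/64 apart. Passing from one projected point to the other
     costs at most 4K times their distance. *)
  exists (p * p * p / 64 / (1 + 4 * K)). split.
  { apply Rdiv_lt_0_compat; [|lra]. apply Rdiv_lt_0_compat; [|lra].
    repeat apply Rmult_lt_0_compat; lra. }
  intros u t t' Hu Ht Ht'.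
  destruct (ch_diff A B c C D c' u t t') as (dx & dy & dz). set (n := nrm _) in *.
  assert (Hn : 0 <= n) by apply nrm_nonneg.
  apply Rmult_le_reg_r with (1 + 4 * K); [lra|].
  replace (p * p * p / 64 / (1 + 4 * K) * (1 + 4 * K)) with (p * p * p / 64) by (field; lra).
  assert (pp : p * p * p <= p) by nra.
  assert (side : forall X Y U V s, moving_point X -> moving_point Y -> I01 s -> moving_point U -> moving_point V ->
     0 <= orient (X u) (Y u) (A u) -> 0 <= orient (X u) (Y u) (B u) ->
     orient (X u) (Y u) (U u) <= - o ->
     Rabs (fst (seg A B u t) - fst (seg U V u s)) <= n ->
     Rabs (snd (seg A B u t) - snd (seg U V u s)) <= n ->
     s <= p / 32 -> p / 8 <= n).
  { intros X Y U V s mX mY Hs mU mV XA XB XU dx' dy' Hs'.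
    pose proof (orient_lipschitz (X u) (Y u) _ _ n (mp_box _ _ mX Hu) (mp_box _ _ mY Hu) dx' dy') as L.
    rewrite !orient_seg in L. pose proof (Rle_trans _ _ _ (Rle_abs _) L) as L'.
    pose proof (orient_bound _ _ _ (mp_box _ _ mX Hu) (mp_box _ _ mY Hu) (mp_box _ _ mV Hu)) as OB.
    pose proof (Rle_trans _ _ _ (Rle_abs _) OB).
    unfold I01 in *.
    assert (0 <= (1 - t) * orient (X u) (Y u) (A u)) by (apply Rmult_le_pos; lra).
    assert (0 <= t * orient (X u) (Y u) (B u)) by (apply Rmult_le_pos; lra).
    assert (s * orient (X u) (Y u) (V u) <= s * 8) by (apply Rmult_le_compat_l; lra).
    assert ((1 - s) * orient (X u) (Y u) (U u) <= (1 - s) * - o) by (apply Rmult_le_compat_l; lra).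
    assert ((1 - s) * p <= (1 - s) * o) by (apply Rmult_le_compat_l; lra).
    assert (s * p <= p / 32) by nra. lra. }
  assert (Hfin : p / 8 <= n -> p * p * p / 64 <= n * (1 + 4 * K)) by nra.
  destruct (Rle_dec t' (p / 32)) as [s1|s1].
  { apply Hfin. apply (side E F C D t'); auto. }
  destruct (Rle_dec (1 - t') (p / 32)) as [s2|s2].
  { apply Hfin. apply (side G H D C (1 - t')); auto.
    - unfold I01 in *; lra.
    - replace (fst (seg D C u (1 - t'))) with (fst (seg C D u t')) by (unfold seg; simpl; ring). exact dx.
    - replace (snd (seg D C u (1 - t'))) with (snd (seg C D u t')) by (unfold seg; simpl; ring). exact dy. }
  assert (Hg : p * p / 64 <= cap (seg C D u t')).
  { rewrite gg_chord by auto. specialize (HCD u Hu).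
    assert (p / 64 <= t' * (1 - t')) by nra.
    assert (p / 64 * p <= t' * (1 - t') * dsq (C u) (D u)); [|lra].
    apply Rmult_le_compat; lra. }
  pose proof (gg_lipschitz _ _ n (seg_box A B u t mA mB Hu Ht) (seg_box C D u t' mC mD Hu Ht') dx dy) as L.
  destruct (Lc u u tt Hu Hu I) as [Kc _].
  pose proof (Rabs_le_mult _ _ _ _ Kc L) as L2.
  replace (c u * cap (seg A B u t) - c' u * cap (seg C D u t'))
     with ((c u - c' u) * cap (seg C D u t') + c u * (cap (seg A B u t) - cap (seg C D u t'))) in dz by ring.
  set (Q := c u * (cap _ - cap _)) in *.
  pose proof (Rabs_triang ((c u - c' u) * cap (seg C D u t') + Q) (- Q)) as T.
  replace ((c u - c' u) * cap (seg C D u t') + Q + - Q) with ((c u - c' u) * cap (seg C D u t')) in T by ring.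
  rewrite Rabs_Ropp, Rabs_mult, (Rabs_pos_eq (cap _)) in T by nra.
  specialize (Hcc u Hu).
  assert (p * (p * p / 64) <= Rabs (c u - c' u) * cap (seg C D u t')).
  { apply Rmult_le_compat; nra. }
  lra.
Qed.

Lemma ch_self A B c o : moving_point A -> moving_point B -> bounded_lipschitz0 c -> 0 < o ->
  (forall u, I01 u -> o <= dsq (A u) (B u)) -> pairgood (ch A B c) (ch A B c).
Proof.
  intros mA mB Hc Ho HAB.
  (* The divided difference of the lifted chord: [cap] is quadratic along a line, so its difference
     contains the factor t - t'. *)
  pose (F := fun u (p : R * R) =>
    (fst (B u) - fst (A u), snd (B u) - snd (A u),
     - (c u * ((fst (B u) - fst (A u)) * ((1 - fst p) * fst (A u) + fst p * fst (B u) +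
                                     ((1 - snd p) * fst (A u) + snd p * fst (B u)))
             + (snd (B u) - snd (A u)) * ((1 - fst p) * snd (A u) + fst p * snd (B u) +
                                     ((1 - snd p) * snd (A u) + snd p * snd (B u)))))) : pt).
  destruct mA as (a1 & a2 & bA), mB as (b1 & b2 & bB).
  set (P2 := fun p : R * R => I01 (fst p) /\ I01 (snd p)).
  assert (t1 : bounded_lipschitz P2 (fun _ p => fst p)).
  { apply (bl_still P2 (fun p => fst p) 1). intros p [[] _]; apply Rabs_le; lra. }
  assert (t2 : bounded_lipschitz P2 (fun _ p => snd p)).
  { apply (bl_still P2 (fun p => snd p) 1). intros p [_ []]; apply Rabs_le; lra. }
  apply (pairgood_self _ F (o / 4)); fold P2; unfold F; simpl.
  - blt.
  - blt.
  - repeat first [apply t1 | apply t2 | progress blt].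
  - intros u t t'. unfold ch, seg, cap; simpl. f_equal; [f_equal|]; ring.
  - lra.
  - intros u t t' Hu Ht Ht'.
    destruct (ch_diff A B c A B c u t t') as (dx & dy & _). set (n := nrm _) in *.
    unfold seg in dx, dy; simpl in dx, dy.
    replace ((1 - t) * fst (A u) + t * fst (B u) - ((1 - t') * fst (A u) + t' * fst (B u)))
      with ((fst (A u) - fst (B u)) * (- (t - t'))) in dx by ring.
    replace ((1 - t) * snd (A u) + t * snd (B u) - ((1 - t') * snd (A u) + t' * snd (B u)))
      with ((snd (A u) - snd (B u)) * (- (t - t'))) in dy by ring.
    rewrite Rabs_mult, Rabs_Ropp in dx, dy.
    specialize (HAB u Hu). unfold dsq in HAB. destruct (bA u Hu), (bB u Hu).
    set (X := fst (A u) - fst (B u)) in *. set (Y := snd (A u) - snd (B u)) in *.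
    assert (Rabs X <= 1 + 1) by (apply Rabs_minus_le; assumption).
    assert (Rabs Y <= 1 + 1) by (apply Rabs_minus_le; assumption).
    (* Since |X| and |Y| are at most 2, o <= X^2 + Y^2 <= 2(|X| + |Y|), so one of them is at least
       o/4. *)
    assert (X * X <= 2 * Rabs X).
    { rewrite <- (Rabs_pos_eq (X * X)) by nra. rewrite Rabs_mult. pose proof (Rabs_pos X). nra. }
    assert (Y * Y <= 2 * Rabs Y).
    { rewrite <- (Rabs_pos_eq (Y * Y)) by nra. rewrite Rabs_mult. pose proof (Rabs_pos Y). nra. }
    pose proof (Rabs_pos (t - t')). nra.
Qed.

(** The condition on [cap (V u)] says that the two lifts agree over V: either V lies on the circle,
    where all sheets have height 0, or both chords lie in one sheet. The second case serves corners
    inside the disk. *)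
Lemma ch_adj V B c D c' e : moving_point V -> moving_point B -> moving_point D -> bounded_lipschitz0 c -> bounded_lipschitz0 c' ->
  (forall u, (c u - c' u) * cap (V u) = 0) -> 0 < e ->
  (forall u t t' n, I01 u -> I01 t -> I01 t' ->
     Rabs (t * (fst (B u) - fst (V u)) - t' * (fst (D u) - fst (V u))) <= n ->
     Rabs (t * (snd (B u) - snd (V u)) - t' * (snd (D u) - snd (V u))) <= n -> e * (t + t') <= n) ->
  pairgood (ch V B c) (ch V D c').
Proof.
  intros (v1 & v2 & _) (b1 & b2 & _) (d1 & d2 & _) Hc Hc' Hg He H.
  pose (F := fun (B : R -> p2) (c : R -> R) u t =>
    (fst (B u) - fst (V u), snd (B u) - snd (V u),
      - (c u * ((fst (B u) - fst (V u)) * (fst (V u) + fst (V u) + t * (fst (B u) - fst (V u)))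
              + (snd (B u) - snd (V u)) * (snd (V u) + snd (V u) + t * (snd (B u) - snd (V u)))))) : pt).
  apply (pairgood_adj _ _ (F B c) (F D c') e); unfold F; [| | |exact He|].
  - repeat split; simpl; blt.
  - repeat split; simpl; blt.
  - intros u t t'. specialize (Hg u). unfold ch, seg; simpl. f_equal; [f_equal; ring|].
    match goal with |- ?l = ?r => replace l with (r + (c u - c' u) * cap (V u)) end.
    + rewrite Hg; ring.
    + unfold cap; simpl; ring.
  - intros u t t' Hu Ht Ht'.
    destruct (ch_diff V B c V D c' u t t') as (dx & dy & _). set (n := nrm _) in *.
    unfold seg in dx, dy; simpl in dx, dy.
    apply (H u t t' n); auto.
    + eapply Rle_trans; [right; apply (f_equal Rabs) | exact dx]; ring.
    + eapply Rle_trans; [right; apply (f_equal Rabs) | exact dy]; ring.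
Qed.

(** Cramer's rule: t and t' times the determinant of the two directions are combinations, with
    coefficients at most 2, of the coordinates of the difference. *)
Lemma ch_adj_orient V B c D c' o : moving_point V -> moving_point B -> moving_point D -> bounded_lipschitz0 c -> bounded_lipschitz0 c' ->
  (forall u, (c u - c' u) * cap (V u) = 0) -> 0 < o ->
  (forall u, I01 u -> o <= Rabs (orient (V u) (B u) (D u))) ->
  pairgood (ch V B c) (ch V D c').
Proof.
  intros mV mB mD Hc Hc' Hg Ho HO. apply (ch_adj _ _ _ _ _ (o / 8)); auto; [lra|].
  intros u t t' n Hu Ht Ht' dx dy. specialize (HO u Hu).
  destruct (mp_box _ _ mV Hu), (mp_box _ _ mB Hu), (mp_box _ _ mD Hu).
  unfold orient in HO.
  set (X1 := fst (B u) - fst (V u)) in *. set (X2 := snd (B u) - snd (V u)) in *.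
  set (Y1 := fst (D u) - fst (V u)) in *. set (Y2 := snd (D u) - snd (V u)) in *.
  assert (Rabs X1 <= 1 + 1) by (apply Rabs_minus_le; assumption).
  assert (Rabs X2 <= 1 + 1) by (apply Rabs_minus_le; assumption).
  assert (Rabs Y1 <= 1 + 1) by (apply Rabs_minus_le; assumption).
  assert (Rabs Y2 <= 1 + 1) by (apply Rabs_minus_le; assumption).
  assert (A : Rabs (t * (X1 * Y2 - X2 * Y1)) <= 4 * n).
  { replace (t * (X1 * Y2 - X2 * Y1)) with (Y2 * (t * X1 - t' * Y1) - Y1 * (t * X2 - t' * Y2)) by ring.
    replace (4 * n) with ((1 + 1) * n + (1 + 1) * n) by ring.
    apply Rabs_minus_le; apply Rabs_le_mult; assumption. }
  assert (B' : Rabs (t' * (X1 * Y2 - X2 * Y1)) <= 4 * n).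
  { replace (t' * (X1 * Y2 - X2 * Y1)) with (X2 * (t * X1 - t' * Y1) - X1 * (t * X2 - t' * Y2)) by ring.
    replace (4 * n) with ((1 + 1) * n + (1 + 1) * n) by ring.
    apply Rabs_minus_le; apply Rabs_le_mult; assumption. }
  unfold I01 in *. rewrite Rabs_mult, Rabs_pos_eq in A, B' by lra.
  assert (t * o <= 4 * n) by nra. assert (t' * o <= 4 * n) by nra. nra.
Qed.

(** Serves a corner that is straightened, where the determinant of the two legs tends to 0. A linear
    functional, positive on one leg and negative on the other, takes its place. *)
Lemma ch_bend V B D c o (N1 N2 : R -> R) K : moving_point V -> moving_point B -> moving_point D -> bounded_lipschitz0 c ->
  0 < o -> 0 < K ->
  (forall u, I01 u -> Rabs (N1 u) <= K /\ Rabs (N2 u) <= K /\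
     o <= N1 u * (fst (B u) - fst (V u)) + N2 u * (snd (B u) - snd (V u)) /\
     N1 u * (fst (D u) - fst (V u)) + N2 u * (snd (D u) - snd (V u)) <= - o) ->
  pairgood (ch V B c) (ch V D c).
Proof.
  intros mV mB mD Hc Ho HK HN. apply (ch_adj _ _ _ _ _ (o / (2 * K))); auto.
  - intros; ring.
  - apply Rdiv_lt_0_compat; lra.
  - intros u t t' n Hu Ht Ht' dx dy. destruct (HN u Hu) as (k1 & k2 & HB & HD).
    pose proof (Rabs_plus_le _ _ _ _ (Rabs_le_mult _ _ _ _ k1 dx) (Rabs_le_mult _ _ _ _ k2 dy)) as L.
    pose proof (Rle_trans _ _ _ (Rle_abs _) L) as L'.
    apply Rmult_le_reg_l with (2 * K); [lra|].
    replace (2 * K * (o / (2 * K) * (t + t'))) with (o * (t + t')) by (field; lra).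
    unfold I01 in *.
    pose proof (Rmult_le_compat_l t _ _ (proj1 Ht) HB).
    pose proof (Rmult_le_compat_l t' _ _ (proj1 Ht') HD). lra.
Qed.

(** * Chords of a circle *)

Definition ecirc (a : R) : p2 := (cos a, sin a).

Lemma gg_ecirc a : cap (ecirc a) = 0.
Proof. unfold cap, ecirc; simpl. pose proof (sin2_cos2 a) as H. unfold Rsqr in H. lra. Qed.

Lemma ecirc_inbox a : inbox (ecirc a).
Proof.
  pose proof (SIN_bound a); pose proof (COS_bound a).
  split; simpl; apply Rabs_le; lra.
Qed.

(** The area of an inscribed triangle is the product of its sides divided by four times the radius;
    the sides are 2 sin of half the arcs. The sign of [orient] is thereby read off from the order of
    the angles. *)
Lemma orient_ecirc a b c :
  orient (ecirc a) (ecirc b) (ecirc c) =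
  4 * (sin ((b - a) / 2) * sin ((c - b) / 2) * sin ((c - a) / 2)).
Proof.
  assert (H : orient (ecirc a) (ecirc b) (ecirc c) = sin (b - a) + sin (c - b) - sin (c - a)).
  { unfold orient, ecirc; simpl. rewrite !sin_minus. ring. }
  rewrite H. set (x := (b - a) / 2). set (y := (c - b) / 2).
  replace (b - a) with (2 * x) by (unfold x; field).
  replace (c - b) with (2 * y) by (unfold y; field).
  replace (c - a) with (2 * (x + y)) by (unfold x, y; field).
  replace (2 * (x + y) / 2) with (x + y) by field.
  rewrite !sin_2a, sin_plus, cos_plus.
  pose proof (sin2_cos2 x) as Hx; pose proof (sin2_cos2 y) as Hy. unfold Rsqr in *.
  assert (Ex : cos x * cos x = 1 - sin x * sin x) by lra.
  assert (Ey : cos y * cos y = 1 - sin y * sin y) by lra.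
  transitivity (2 * sin x * cos x * (1 - cos y * cos y) + 2 * sin y * cos y * (1 - cos x * cos x)
      + 2 * sin x * sin y * (sin x * cos y + cos x * sin y)); [ring|].
  rewrite Ex, Ey. ring.
Qed.

Lemma dsq_ecirc a b : dsq (ecirc a) (ecirc b) = 4 * (sin ((b - a) / 2) * sin ((b - a) / 2)).
Proof.
  assert (H : dsq (ecirc a) (ecirc b) = 2 - 2 * cos (b - a)).
  { unfold dsq, ecirc; simpl. rewrite cos_minus.
    pose proof (sin2_cos2 a) as Hx; pose proof (sin2_cos2 b) as Hy. unfold Rsqr in *. nra. }
  rewrite H. replace (b - a) with (2 * ((b - a) / 2)) at 1 by field.
  rewrite cos_2a_sin. ring.
Qed.

(** * Positive lower bounds that are uniform in time *)

Definition upos (F : R -> R) : Prop := exists o, 0 < o /\ forall u, I01 u -> o <= F u.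

Lemma upos_mult F G : upos F -> upos G -> upos (fun u => F u * G u).
Proof.
  intros (o & Ho & H) (o' & Ho' & H'). exists (o * o'); split; [nra|].
  intros u Hu. apply Rmult_le_compat; auto; lra.
Qed.

Lemma upos_const a : 0 < a -> upos (fun _ => a).
Proof. intros; exists a; split; [assumption | intros; lra]. Qed.

Lemma upos_ext F G : (forall u, F u = G u) -> upos F -> upos G.
Proof. intros E (o & Ho & H). exists o; split; [exact Ho|]. intros; rewrite <- E; auto. Qed.

Lemma upos_and F G : upos F -> upos G ->
  exists o, 0 < o /\ forall u, I01 u -> o <= F u /\ o <= G u.
Proof.
  intros (o & Ho & H) (o' & Ho' & H'). exists (Rmin o o'); split; [apply Rmin_glb_lt; assumption|].
  pose proof (Rmin_l o o'); pose proof (Rmin_r o o').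
  intros u Hu. specialize (H u Hu); specialize (H' u Hu). lra.
Qed.

(** On (0, PI) the sine rises and then falls, so between a and b it is at least the smaller of its
    values at the two ends. *)
Lemma upos_sin a b : 0 < a < PI -> 0 < b < PI -> upos (fun u => sin (aff a b u)).
Proof.
  intros Ha Hb. exists (Rmin (sin a) (sin b)); split.
  { apply Rmin_glb_lt; apply sin_gt_0; lra. }
  intros u [Hu Hu'].
  pose proof (Rmin_l (sin a) (sin b)) as ml; pose proof (Rmin_r (sin a) (sin b)) as mr.
  assert (mono : forall x y, 0 < x < PI -> 0 < y < PI -> x <= PI / 2 -> x <= y -> y <= PI - x -> sin x <= sin y).
  { intros x y Hx Hy Hx2 Hxy Hyx. destruct (Rle_dec y (PI / 2)).
    - apply sin_incr_1; lra.
    - rewrite <- (sin_PI_x y). apply sin_incr_1; lra. }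
  assert (mono' : forall x y, 0 < x < PI -> 0 < y < PI -> y <= x -> x - PI / 2 <= PI/2 ->
            PI / 2 <= x -> PI - x <= y -> sin x <= sin y).
  { intros x y Hx Hy H1 H2 H3 H4. rewrite <- (sin_PI_x x). apply mono; lra. }
  assert (B : forall x y, 0 < x < PI -> 0 < y < PI -> x <= y -> forall z, x <= z <= y ->
       Rmin (sin x) (sin y) <= sin z).
  { intros x y Hx Hy Hxy z Hz.
    pose proof (Rmin_l (sin x) (sin y)); pose proof (Rmin_r (sin x) (sin y)).
    destruct (Rle_dec z (PI / 2)).
    - pose proof (mono x z ltac:(lra) ltac:(lra) ltac:(lra) ltac:(lra) ltac:(lra)). lra.
    - pose proof (mono' y z ltac:(lra) ltac:(lra) ltac:(lra) ltac:(lra) ltac:(lra) ltac:(lra)). lra. }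
  unfold aff. destruct (Rle_dec a b).
  - apply B; try lra. nra.
  - rewrite Rmin_comm. apply B; try lra. nra.
Qed.

(** * Vertices that move on the circle and keep their cyclic order *)

Definition vert (th th' : nat -> R) (i : nat) (u : R) : p2 := ecirc (aff (th i) (th' i) u).

(** The angles are real numbers, not classes modulo 2 PI, and increase within less than one turn.
    This is a convex condition, so it survives linear interpolation of the angles. The window from
    [lo] to [hi] allows the labelling to begin at any vertex, n + i being a second name of vertex
    i. *)
Definition valid (th : nat -> R) (lo hi : nat) : Prop :=
  forall i j, (lo <= i < j)%nat -> (j <= hi)%nat -> th i < th j < th i + 2 * PI.

Lemma mp_vert th th' i : moving_point (vert th th' i).
Proof.
  repeat split.
  - apply bl0_cos, bl0_aff.
  - apply bl0_sin, bl0_aff.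
  - apply ecirc_inbox.
  - apply ecirc_inbox.
Qed.

Lemma gg_vert th th' i u : cap (vert th th' i u) = 0.
Proof. apply gg_ecirc. Qed.

Lemma upos_sin_vert th th' lo hi i j : valid th lo hi -> valid th' lo hi ->
  (lo <= i < j)%nat -> (j <= hi)%nat ->
  upos (fun u => sin ((aff (th j) (th' j) u - aff (th i) (th' i) u) / 2)).
Proof.
  intros V V' Hij Hj. specialize (V i j Hij Hj). specialize (V' i j Hij Hj).
  eapply upos_ext; [|apply (upos_sin ((th j - th i) / 2) ((th' j - th' i) / 2)); lra].
  intros u; simpl. f_equal. unfold aff; field.
Qed.

Lemma upos_orient th th' lo hi i j k : valid th lo hi -> valid th' lo hi ->
  (lo <= i < j)%nat -> (j < k <= hi)%nat ->
  upos (fun u => orient (vert th th' i u) (vert th th' j u) (vert th th' k u)).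
Proof.
  intros V V' Hij Hk.
  eapply upos_ext; [intros u; symmetry; apply orient_ecirc|].
  assert (H1 := upos_sin_vert th th' lo hi i j V V' ltac:(lia) ltac:(lia)).
  assert (H2 := upos_sin_vert th th' lo hi j k V V' ltac:(lia) ltac:(lia)).
  assert (H3 := upos_sin_vert th th' lo hi i k V V' ltac:(lia) ltac:(lia)).
  exact (upos_mult _ _ (upos_const 4 ltac:(lra)) (upos_mult _ _ (upos_mult _ _ H1 H2) H3)).
Qed.

Lemma upos_dsq th th' lo hi i j : valid th lo hi -> valid th' lo hi ->
  (lo <= i < j)%nat -> (j <= hi)%nat -> upos (fun u => dsq (vert th th' i u) (vert th th' j u)).
Proof.
  intros V V' Hij Hj. eapply upos_ext; [intros u; symmetry; apply dsq_ecirc|].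
  assert (H1 := upos_sin_vert th th' lo hi i j V V' ltac:(lia) ltac:(lia)).
  exact (upos_mult _ _ (upos_const 4 ltac:(lra)) (upos_mult _ _ H1 H1)).
Qed.

Lemma orient_cycle p q r : orient p q r = orient q r p.
Proof. unfold orient; ring. Qed.
Lemma orient_swap p q r : orient p q r = - orient q p r.
Proof. unfold orient; ring. Qed.
Lemma orient_left p q : orient p q p = 0.
Proof. unfold orient; ring. Qed.
Lemma orient_right p q : orient p q q = 0.
Proof. unfold orient; ring. Qed.

(** The positive product says that the two heights have the same order at both ends of the time
    interval; linear interpolation cannot exchange them. *)
Lemma upos_gap a a' b b' : 0 < (a - b) * (a' - b') ->
  upos (fun u => Rabs (aff a a' u - aff b b' u)).
Proof.
  intros H. exists (Rmin (Rabs (a - b)) (Rabs (a' - b'))); split.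
  { apply Rmin_glb_lt; apply Rabs_pos_lt; nra. }
  intros u [Hu Hu'].
  replace (aff a a' u - aff b b' u) with ((1 - u) * (a - b) + u * (a' - b')) by (unfold aff; ring).
  set (x := a - b) in *. set (y := a' - b') in *. clearbody x y.
  pose proof (Rmin_l (Rabs x) (Rabs y)) as ml. pose proof (Rmin_r (Rabs x) (Rabs y)) as mr.
  set (m := Rmin _ _) in *.
  destruct (Rlt_dec 0 x).
  - assert (0 < y) by (apply Rmult_lt_reg_l with x; lra). rewrite (Rabs_pos_eq x), (Rabs_pos_eq y) in * by lra.
    rewrite Rabs_pos_eq by nra. nra.
  - assert (x < 0) by (destruct (Req_dec x 0) as [->|]; lra). assert (y < 0) by (apply Rmult_lt_reg_l with (- x); lra).
    rewrite (Rabs_left x), (Rabs_left y) in * by lra. rewrite Rabs_left by nra. nra.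
Qed.

Lemma chord_far_cross th th' lo hi i j k l c c' :
  valid th lo hi -> valid th' lo hi ->
  (lo <= i < k)%nat -> (k < j < l)%nat -> (l <= hi)%nat -> bounded_lipschitz0 c ->
  upos (fun u => Rabs (c u - c' u)) ->
  far (ch (vert th th' i) (vert th th' j) c) (ch (vert th th' k) (vert th th' l) c').
Proof.
  intros V V' Hi Hk Hl Hc Hcc.
  assert (H1 := upos_orient th th' lo hi i k j V V' ltac:(lia) ltac:(lia)).
  assert (H2 := upos_orient th th' lo hi i j l V V' ltac:(lia) ltac:(lia)).
  assert (H3 := upos_dsq th th' lo hi k l V V' ltac:(lia) ltac:(lia)).
  destruct (upos_and _ _ H1 H2) as (o & Ho & H12).
  destruct (upos_and _ _ H3 Hcc) as (o' & Ho' & H34).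
  pose proof (Rmin_l o o'); pose proof (Rmin_r o o').
  (* The chord ij is itself the separating line, oriented one way for the end k and the other way
     for the end l. *)
  apply (ch_far_cross _ _ _ _ _ _ (vert th th' i) (vert th th' j) (vert th th' j) (vert th th' i)
     (Rmin o o')); auto using mp_vert, gg_vert; try (apply Rmin_glb_lt; assumption);
    intros u Hu; destruct (H12 u Hu), (H34 u Hu); unfold orient in *; simpl in *; lra.
Qed.

Lemma Rabs_le_bounds x a : Rabs x <= a -> - a <= x <= a.
Proof.
  intros H. pose proof (Rle_abs x). pose proof (Rle_abs (- x)) as H'.
  rewrite Rabs_Ropp in H'. lra.
Qed.

Lemma chord_far_outside th th' lo hi i j k l c c' :
  valid th lo hi -> valid th' lo hi ->
  (lo <= i < j)%nat -> (j <= hi)%nat -> (k < l)%nat -> (l <= hi)%nat ->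
  (j < k \/ (i < k /\ l < j))%nat ->
  far (ch (vert th th' i) (vert th th' j) c) (ch (vert th th' k) (vert th th' l) c').
Proof.
  intros V V' Hi Hj Hk Hl [H|H].
  - assert (H1 := upos_orient th th' lo hi i k l V V' ltac:(lia) ltac:(lia)).
    assert (H2 := upos_orient th th' lo hi j k l V V' ltac:(lia) ltac:(lia)).
    destruct (upos_and _ _ H1 H2) as (o & Ho & H12).
    apply (ch_far_side _ _ _ _ _ _ (vert th th' k) (vert th th' l) o); auto using mp_vert;
      intros u Hu; destruct (H12 u Hu); unfold orient in *; lra.
  - assert (H1 := upos_orient th th' lo hi i k l V V' ltac:(lia) ltac:(lia)).
    assert (H2 := upos_orient th th' lo hi k l j V V' ltac:(lia) ltac:(lia)).
    destruct (upos_and _ _ H1 H2) as (o & Ho & H12).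
    apply (ch_far_side _ _ _ _ _ _ (vert th th' k) (vert th th' l) o); auto using mp_vert;
      intros u Hu; destruct (H12 u Hu); unfold orient in *; lra.
Qed.

Lemma far_sym f g : far f g -> far g f.
Proof.
  intros (e & He & H). exists e; split; [exact He|]. intros u t t' Hu Ht Ht'.
  rewrite <- dist3_nrm, dist3_sym, dist3_nrm. auto.
Qed.

Lemma upos_abs F : upos F -> upos (fun u => Rabs (F u)).
Proof.
  intros (o & Ho & H). exists o; split; [exact Ho|]. intros u Hu.
  eapply Rle_trans; [apply H, Hu | apply Rle_abs].
Qed.

Lemma upos_abs_orient th th' lo hi i j k : valid th lo hi -> valid th' lo hi ->
  (lo <= i <= hi)%nat -> (lo <= j <= hi)%nat -> (lo <= k <= hi)%nat ->
  i <> j -> i <> k -> j <> k ->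
  upos (fun u => Rabs (orient (vert th th' i u) (vert th th' j u) (vert th th' k u))).
Proof.
  intros V V' Hi Hj Hk.
  assert (sw : forall a b c, upos (fun u => Rabs (orient (vert th th' a u) (vert th th' b u) (vert th th' c u)))
      -> upos (fun u => Rabs (orient (vert th th' b u) (vert th th' a u) (vert th th' c u)))).
  { intros a b c. apply upos_ext. intros u. rewrite orient_swap, Rabs_Ropp. reflexivity. }
  assert (cy : forall a b c, upos (fun u => Rabs (orient (vert th th' a u) (vert th th' b u) (vert th th' c u)))
      -> upos (fun u => Rabs (orient (vert th th' b u) (vert th th' c u) (vert th th' a u)))).
  { intros a b c. apply upos_ext. intros u. rewrite orient_cycle. reflexivity. }
  assert (base : forall a b c, (lo <= a < b)%nat -> (b < c <= hi)%nat ->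
      upos (fun u => Rabs (orient (vert th th' a u) (vert th th' b u) (vert th th' c u)))).
  { intros a b c Hab Hc. apply upos_abs. eapply upos_orient; eauto. }
  intros n1 n2 n3.
  assert (C : (i < j < k \/ j < k < i \/ k < i < j \/ j < i < k \/ i < k < j \/ k < j < i)%nat) by lia.
  destruct C as [C|[C|[C|[C|[C|C]]]]].
  - apply base; lia.
  - apply cy, cy. apply base; lia.
  - apply cy. apply base; lia.
  - apply sw. apply base; lia.
  - apply sw, cy, cy. apply base; lia.
  - apply sw, cy. apply base; lia.
Qed.

Lemma chord_adj th th' lo hi i j k c c' :
  valid th lo hi -> valid th' lo hi -> bounded_lipschitz0 c -> bounded_lipschitz0 c' ->
  (lo <= i <= hi)%nat -> (lo <= j <= hi)%nat -> (lo <= k <= hi)%nat ->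
  i <> j -> i <> k -> j <> k ->
  pairgood (ch (vert th th' i) (vert th th' j) c) (ch (vert th th' i) (vert th th' k) c').
Proof.
  intros V V' Hc Hc' Hi Hj Hk n1 n2 n3.
  destruct (upos_abs_orient th th' lo hi i j k V V' Hi Hj Hk n1 n2 n3) as (o & Ho & H).
  apply (ch_adj_orient _ _ _ _ _ o); auto using mp_vert.
  intros u. rewrite gg_vert. ring.
Qed.

Lemma ch_pairgood_rev_l A B c g : pairgood (ch B A c) g -> pairgood (ch A B c) g.
Proof. apply pairgood_rev, ch_rev. Qed.

Lemma ch_pairgood_rev_r A B c g : pairgood g (ch B A c) -> pairgood g (ch A B c).
Proof. intros H. apply pairgood_sym, ch_pairgood_rev_l, pairgood_sym, H. Qed.

Definition crossing (i j k l : nat) : Prop := (i < k < j /\ j < l)%nat.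

(** The order of the four labels decides: equal chords, chords with a common end (reversed until it
    is the start of both), chords side by side or nested, and crossing chords. Only the last case
    compares heights. *)
Lemma chord_pairgood th th' lo hi i j k l (a b a' b' : R) :
  valid th lo hi -> valid th' lo hi ->
  (lo <= i < j)%nat -> (j <= hi)%nat -> (lo <= k < l)%nat -> (l <= hi)%nat ->
  (i = k -> j = l -> a = b /\ a' = b') ->
  (crossing i j k l \/ crossing k l i j -> 0 < (a - b) * (a' - b')) ->
  pairgood (ch (vert th th' i) (vert th th' j) (aff a a')) (ch (vert th th' k) (vert th th' l) (aff b b')).
Proof.
  intros V V' Hi Hj Hk Hl Hsame Hcross. unfold crossing in Hcross.
  assert (bm : forall x y c c', blmarc (ch (vert th th' x) (vert th th' y) (aff c c')))
    by (intros; apply ch_blmarc; auto using mp_vert, bl0_aff).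
  assert (F : far (ch (vert th th' i) (vert th th' j) (aff a a')) (ch (vert th th' k) (vert th th' l) (aff b b'))
    -> pairgood (ch (vert th th' i) (vert th th' j) (aff a a')) (ch (vert th th' k) (vert th th' l) (aff b b')))
    by (intros; apply pairgood_far; auto).
  destruct (Nat.eq_dec i k) as [<-|ik].
  { destruct (Nat.eq_dec j l) as [<-|jl].
    - destruct (Hsame eq_refl eq_refl) as [<- <-].
      destruct (upos_dsq th th' lo hi i j V V' Hi Hj) as (o & Ho & H).
      apply (ch_self _ _ _ o); auto using mp_vert, bl0_aff.
    - apply (chord_adj th th' lo hi); auto using bl0_aff; lia. }
  destruct (Nat.eq_dec j l) as [<-|jl].
  { apply ch_pairgood_rev_l, ch_pairgood_rev_r.
    apply (chord_adj th th' lo hi); auto using bl0_aff; lia. }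
  destruct (Nat.eq_dec j k) as [<-|jk].
  { apply ch_pairgood_rev_l. apply (chord_adj th th' lo hi); auto using bl0_aff; lia. }
  destruct (Nat.eq_dec i l) as [<-|il].
  { apply ch_pairgood_rev_r. apply (chord_adj th th' lo hi); auto using bl0_aff; lia. }
  assert (C : ((j < k \/ i < k /\ l < j) \/ (l < i \/ k < i /\ j < l) \/
     (i < k < j /\ j < l) \/ (k < i < l /\ l < j))%nat) by lia.
  destruct C as [C|[C|[C|C]]]; apply F.
  - apply (chord_far_outside th th' lo hi); auto; lia.
  - apply far_sym. apply (chord_far_outside th th' lo hi); auto; lia.
  - apply (chord_far_cross th th' lo hi); auto using bl0_aff; try lia.
    apply upos_gap, Hcross; lia.
  - apply far_sym. apply (chord_far_cross th th' lo hi); auto using bl0_aff; try lia.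
    apply upos_gap. specialize (Hcross ltac:(lia)). lra.
Qed.

(** * Knots made of lifted chords *)

Definition arc (a b c t : R) : pt :=
  let u := (1 - t) * cos a + t * cos b in
  let v := (1 - t) * sin a + t * sin b in
  (u, v, c * (1 - u * u - v * v)).

(** No book is involved any more: heights are arbitrary reals, so they can be interpolated, become
    negative, or coincide for chords that do not cross. *)
Definition chord_knot (th : nat -> R) (L : list (nat * nat * R)) (p : pt) : Prop :=
  exists i j c, In (i, j, c) L /\ exists t, I01 t /\ p = arc (th i) (th j) c t.

(** Each chord carries its height before and after the motion; angles and heights are interpolated
    linearly and simultaneously. *)
Lemma chord_knot_iso th th' lo hi (L : list (nat * nat * (R * R))) :
  valid th lo hi -> valid th' lo hi ->
  (forall i j h, In (i, j, h) L -> (lo <= i < j /\ j <= hi)%nat) ->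
  (forall i j h k l h', In (i, j, h) L -> In (k, l, h') L ->
     (i = k -> j = l -> h = h') /\
     (crossing i j k l -> 0 < (fst h - fst h') * (snd h - snd h'))) ->
  iso (chord_knot th (map (fun x => (fst x, fst (snd x))) L))
      (chord_knot th' (map (fun x => (fst x, snd (snd x))) L)).
Proof.
  intros V V' HL HP.
  pose (m := fun x : nat * nat * (R * R) =>
    ch (vert th th' (fst (fst x))) (vert th th' (snd (fst x))) (aff (fst (snd x)) (snd (snd x)))).
  eapply iso_trans; [|eapply iso_trans; [apply (iso_arcset (map m L))|]].
  - apply iso_ext. intros p; split.
    + intros (i & j & c & Hin & t & Ht & ->).
      apply in_map_iff in Hin as ([[i' j'] [a a']] & E & Hin). simpl in E; injection E; intros; subst.
      exists (m (i, j, (c, a'))); split; [apply in_map, Hin|]. exists t; split; [exact Ht|].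
      unfold m, ch, seg, cap, vert, ecirc, arc, aff; simpl. rewrite !Rmult_0_l, !Rplus_0_r.
      reflexivity.
    + intros (f & Hf & t & Ht & ->). apply in_map_iff in Hf as ([[i j] [a a']] & <- & Hin).
      exists i, j, a; split; [apply in_map_iff; exists (i, j, (a, a')); auto|].
      exists t; split; [exact Ht|].
      unfold m, ch, seg, cap, vert, ecirc, arc, aff; simpl. rewrite !Rmult_0_l, !Rplus_0_r.
      reflexivity.
  - intros f g Hf Hg.
    apply in_map_iff in Hf as ([[i j] [a a']] & <- & Hf).
    apply in_map_iff in Hg as ([[k l] [b b']] & <- & Hg).
    destruct (HL _ _ _ Hf), (HL _ _ _ Hg). unfold m; simpl.
    apply (chord_pairgood th th' lo hi); auto.
    + intros -> ->. destruct (HP _ _ _ _ _ _ Hf Hg) as [E _].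
      specialize (E eq_refl eq_refl). injection E; auto.
    + intros [C|C].
      * apply (HP _ _ _ _ _ _ Hf Hg), C.
      * destruct (HP _ _ _ _ _ _ Hg Hf) as [_ E]. specialize (E C). simpl in E. lra.
  - assert (E1 : forall x y, x + 1 * (y - x) = y) by (intros; ring).
    apply iso_ext. intros p; split.
    + intros (f & Hf & t & Ht & ->). apply in_map_iff in Hf as ([[i j] [a a']] & <- & Hin).
      exists i, j, a'; split; [apply in_map_iff; exists (i, j, (a, a')); auto|].
      exists t; split; [exact Ht|].
      unfold m, ch, seg, cap, vert, ecirc, arc, aff; simpl. rewrite !E1. reflexivity.
    + intros (i & j & c & Hin & t & Ht & ->).
      apply in_map_iff in Hin as ([[i' j'] [a a']] & E & Hin). simpl in E; injection E; intros; subst.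
      exists (m (i, j, (a, c))); split; [apply in_map, Hin|]. exists t; split; [exact Ht|].
      unfold m, ch, seg, cap, vert, ecirc, arc, aff; simpl. rewrite !E1. reflexivity.
Qed.

(** * Dropping a vertex *)

Section drop.
Variables (th : nat -> R) (lo hi A B C : nat) (c : R).
Hypothesis V : valid th lo hi.
Hypothesis HA : (lo <= A < B)%nat.
Hypothesis HC : (B < C <= hi)%nat.

Let E i := vert th th i.
(** The corner of the path A, B, C moves along the median from B to the midpoint of A and C, so that
    the two legs sweep out the triangle. *)
Let M (u : R) : p2 :=
  ((1 - u) * fst (E B u) + u * ((fst (E A u) + fst (E C u)) / 2),
   (1 - u) * snd (E B u) + u * ((snd (E A u) + snd (E C u)) / 2)).
Let cc (h : R) : R -> R := fun _ => h.
Let m1 := ch (E A) M (cc c).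
Let m2 := ch M (E C) (cc c).

Let bl0_cc h : bounded_lipschitz0 (cc h).
Proof. exact (bl_const (fun _ : unit => True) h). Qed.

Let mpE i : moving_point (E i).
Proof. apply mp_vert. Qed.

Let mpM : moving_point M.
Proof.
  assert (K : forall h, bounded_lipschitz0 (fun u => h (E A u)) -> bounded_lipschitz0 (fun u => h (E B u)) -> bounded_lipschitz0 (fun u => h (E C u)) ->
     bounded_lipschitz0 (fun u => (1 - u) * h (E B u) + u * ((h (E A u) + h (E C u)) / 2))).
  { intros h a b d. assert (I := bl0_id). unfold Rdiv, bounded_lipschitz0 in *.
    repeat first [ assumption | apply bl_const | apply bl_minus | apply bl_plus | apply bl_mult]. }
  destruct (mpE A) as (a1 & a2 & a3), (mpE B) as (b1 & b2 & b3), (mpE C) as (c1 & c2 & c3).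
  assert (box : forall u a b d, 0 <= u <= 1 -> Rabs a <= 1 -> Rabs b <= 1 -> Rabs d <= 1 ->
     Rabs ((1 - u) * b + u * ((a + d) / 2)) <= 1).
  { intros u a b d Hu Ha Hb Hd. apply Rabs_le_bounds in Ha, Hb, Hd. apply Rabs_le.
    assert (Hm : -1 <= (a + d) / 2 <= 1) by lra.
    set (m := (a + d) / 2) in *. clearbody m. nra. }
  repeat split.
  - apply (K fst); assumption.
  - apply (K snd); assumption.
  - destruct (a3 u H), (b3 u H), (c3 u H). apply box; assumption.
  - destruct (a3 u H), (b3 u H), (c3 u H). apply box; assumption.
Qed.

Let orient_M p q u : orient p q (M u) =
  (1 - u) * orient p q (E B u) + u / 2 * orient p q (E A u) + u / 2 * orient p q (E C u).
Proof. unfold orient, M; simpl. field. Qed.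

Let ups i j k : (lo <= i < j)%nat -> (j < k <= hi)%nat ->
  upos (fun u => orient (E i u) (E j u) (E k u)).
Proof. apply upos_orient; assumption. Qed.

(** Lagrange's identity: a determinant with a vector of squared length at most 8 bounds the length
    of the other vector from below. *)
Lemma dsq_det p q v1 v2 w : 0 <= w -> Rabs v1 <= 2 -> Rabs v2 <= 2 ->
  w <= (fst q - fst p) * v2 - (snd q - snd p) * v1 -> w * w / 8 <= dsq p q.
Proof.
  intros Hw H1 H2 H. unfold dsq.
  replace (fst p - fst q) with (- (fst q - fst p)) by ring.
  replace (snd p - snd q) with (- (snd q - snd p)) by ring.
  apply Rabs_le_bounds in H1, H2.
  set (x := fst q - fst p) in *. set (y := snd q - snd p) in *. clearbody x y.
  assert (w * w <= (x * v2 - y * v1) * (x * v2 - y * v1)) by nra.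
  assert ((x * v2 - y * v1) * (x * v2 - y * v1) <= (x * x + y * y) * (v1 * v1 + v2 * v2)).
  { pose proof (Rle_0_sqr (x * v1 + y * v2)). unfold Rsqr in *. lra. }
  assert (v1 * v1 + v2 * v2 <= 8) by nra.
  assert (0 <= x * x + y * y) by nra. nra.
Qed.

Let dist_box i j : forall u, I01 u ->
  Rabs (fst (E i u) - fst (E j u)) <= 2 /\ Rabs (snd (E i u) - snd (E j u)) <= 2.
Proof.
  intros u Hu. destruct (mp_box _ _ (mpE i) Hu), (mp_box _ _ (mpE j) Hu).
  replace 2 with (1 + 1) by ring. split; apply Rabs_minus_le; assumption.
Qed.

Let m1_self : pairgood m1 m1.
Proof.
  destruct (ups A B C HA ltac:(lia)) as (o & Ho & H).
  apply (ch_self _ _ _ ((o / 2) * (o / 2) / 8)); auto; [nra|].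
  intros u Hu. specialize (H u Hu). destruct (dist_box C B u Hu). destruct Hu.
  (* The leg from A to M is tested against the side BC: as M runs along the median, the determinant
     decreases linearly from [orient] of A, B, C to half of it. *)
  apply (dsq_det _ _ (fst (E C u) - fst (E B u)) (snd (E C u) - snd (E B u))); auto; [lra|].
  replace (_ - _) with ((1 - u / 2) * orient (E A u) (E B u) (E C u)); [nra|].
  unfold orient, M; simpl; field.
Qed.

Let m2_self : pairgood m2 m2.
Proof.
  destruct (ups A B C HA ltac:(lia)) as (o & Ho & H).
  apply (ch_self _ _ _ ((o / 2) * (o / 2) / 8)); auto; [nra|].
  intros u Hu. specialize (H u Hu). destruct (dist_box A B u Hu). destruct Hu.
  apply (dsq_det _ _ (fst (E A u) - fst (E B u)) (snd (E A u) - snd (E B u))); auto; [lra|].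
  replace (_ - _) with ((1 - u / 2) * orient (E A u) (E B u) (E C u)); [nra|].
  unfold orient, M; simpl; field.
Qed.

Let m1_m2 : pairgood m1 m2.
Proof.
  destruct (ups A B C HA ltac:(lia)) as (o & Ho & H).
  apply ch_pairgood_rev_l.
  (* The functional is the determinant with A + C - 2B, the direction of the median. The median
     separates A from C, with values that stay equal to plus and minus [orient] of A, B, C. *)
  apply (ch_bend _ _ _ _ (o / 2)
    (fun u => (snd (E B u) - snd (E A u)) - (snd (E C u) - snd (E B u)))
    (fun u => (fst (E C u) - fst (E B u)) - (fst (E B u) - fst (E A u))) 4); auto; try lra.
  intros u Hu. specialize (H u Hu).
  destruct (dist_box B A u Hu), (dist_box C B u Hu). destruct Hu.
  replace 4 with (2 + 2) by ring.
  split; [apply Rabs_minus_le; assumption|]. split; [apply Rabs_minus_le; assumption|].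
  split.
  - replace (_ + _) with (1 * orient (E A u) (E B u) (E C u)); [nra|].
    unfold orient, M; simpl; field.
  - replace (_ + _) with (- (1 * orient (E A u) (E B u) (E C u))); [nra|].
    unfold orient, M; simpl; field.
Qed.

(** The chords that do not obstruct the sweep of the triangle: those beyond C, those that touch it
    only in A or C, and those that enter through BC and leave through AC, if their height differs
    from that of the moving legs. *)
Definition drop_ok (k l : nat) (h : R) : Prop :=
  (k < l <= hi)%nat /\
  ((C < k)%nat \/ (k = A /\ C < l)%nat \/ k = C \/ ((B < k < C /\ C < l)%nat /\ h <> c)).

Let static k l h : marc := ch (E k) (E l) (cc h).

Let blm1 : blmarc m1. Proof. apply ch_blmarc; auto. Qed.
Let blm2 : blmarc m2. Proof. apply ch_blmarc; auto. Qed.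
Let bls k l h : blmarc (static k l h). Proof. apply ch_blmarc; auto. Qed.

Let upos_conv F G : upos F -> upos G -> upos (fun u => (1 - u) * F u + u / 2 * G u).
Proof.
  intros HF HG. destruct (upos_and _ _ HF HG) as (o & Ho & H). exists (o / 2); split; [lra|].
  intros u Hu. destruct (H u Hu), Hu. nra.
Qed.

Let outside k l h : (C < k)%nat -> (k < l <= hi)%nat ->
  pairgood m1 (static k l h) /\ pairgood m2 (static k l h).
Proof.
  intros Hk Hl.
  destruct (upos_and _ _ (ups A C k ltac:(lia) ltac:(lia)) (ups A C l ltac:(lia) ltac:(lia))) as (o & Ho & H).
  destruct (ups A B C ltac:(lia) ltac:(lia)) as (o' & Ho' & H').
  split; (apply pairgood_far; [auto | auto | apply far_sym]);
    apply (ch_far_side _ _ _ _ _ _ (E A) (E C) o); auto; intros u Hu;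
    rewrite ?orient_M, ?orient_left, ?orient_right; try apply (H u Hu); try lra;
    specialize (H' u Hu); destruct Hu;
    replace (orient (E A u) (E C u) (E B u)) with (- orient (E A u) (E B u) (E C u))
      by (unfold orient; ring); nra.
Qed.

Let at_A l h : (C < l <= hi)%nat -> pairgood m1 (static A l h) /\ pairgood m2 (static A l h).
Proof.
  intros Hl.
  destruct (upos_conv _ _ (ups A B l ltac:(lia) ltac:(lia)) (ups A C l ltac:(lia) ltac:(lia))) as (o & Ho & H).
  destruct (ups A C l ltac:(lia) ltac:(lia)) as (o' & Ho' & H').
  split.
  - apply (ch_adj_orient _ _ _ _ _ o); auto.
    + intros u. unfold E. rewrite gg_vert. ring.
    + intros u Hu. eapply Rle_trans; [apply (H u Hu) | eapply Rle_trans; [|apply Rle_abs]].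
      right. rewrite <- (orient_cycle (E l u) (E A u) (M u)), orient_M. unfold orient; field.
  - apply pairgood_far; auto.
    pose proof (Rmin_l o o'); pose proof (Rmin_r o o').
    apply (ch_far_side _ _ _ _ _ _ (E l) (E A) (Rmin o o')); auto; [apply Rmin_glb_lt; assumption | | | |];
      intros u Hu; specialize (H u Hu); specialize (H' u Hu); simpl in *.
    + rewrite orient_M. unfold orient in *; lra.
    + unfold orient in *; lra.
    + rewrite orient_right; lra.
    + rewrite orient_left; lra.
Qed.

Let at_C l h : (C < l <= hi)%nat -> pairgood m1 (static C l h) /\ pairgood m2 (static C l h).
Proof.
  intros Hl.
  destruct (upos_conv _ _ (ups B C l ltac:(lia) ltac:(lia)) (ups A C l ltac:(lia) ltac:(lia))) as (o & Ho & H).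
  destruct (ups A C l ltac:(lia) ltac:(lia)) as (o' & Ho' & H').
  split.
  - apply pairgood_far; auto.
    pose proof (Rmin_l o o'); pose proof (Rmin_r o o').
    apply (ch_far_side _ _ _ _ _ _ (E C) (E l) (Rmin o o')); auto; [apply Rmin_glb_lt; assumption | | | |];
      intros u Hu; specialize (H u Hu); specialize (H' u Hu); simpl in *.
    + unfold orient in *; lra.
    + rewrite orient_M. unfold orient in *; lra.
    + rewrite orient_left; lra.
    + rewrite orient_right; lra.
  - apply ch_pairgood_rev_l. apply (ch_adj_orient _ _ _ _ _ o); auto.
    + intros u. unfold E. rewrite gg_vert. ring.
    + intros u Hu. eapply Rle_trans; [apply (H u Hu)|].
      rewrite <- (orient_cycle (E l u) (E C u) (M u)), orient_M.
      rewrite <- Rabs_Ropp. eapply Rle_trans; [|apply Rle_abs]. unfold orient; right; field.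
Qed.

Let cross_ok k l h : (B < k < C)%nat -> (C < l <= hi)%nat -> h <> c ->
  pairgood m1 (static k l h) /\ pairgood m2 (static k l h).
Proof.
  intros Hk Hl Hh.
  assert (G : upos (fun u => Rabs (cc c u - cc h u))).
  { exists (Rabs (c - h)); split; [apply Rabs_pos_lt; lra | intros; apply Rle_refl]. }
  assert (D : upos (fun u => dsq (E k u) (E l u))) by (eapply upos_dsq; eauto; lia).
  destruct (upos_and _ _ (ups B k C ltac:(lia) ltac:(lia)) (ups A C l ltac:(lia) ltac:(lia))) as (o & Ho & H).
  destruct (upos_and _ _ G D) as (o' & Ho' & H').
  destruct (ups A B C ltac:(lia) ltac:(lia)) as (o'' & Ho'' & H'').
  pose proof (Rmin_l o o'); pose proof (Rmin_r o o').
  assert (gE : forall i u, cap (E i u) = 0) by (intros; apply gg_vert).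
  split; apply pairgood_far; auto;
    (* Both legs stay in the triangle, so the line BC separates them from k and the line CA from l
       throughout the motion. *)
    apply (ch_far_cross _ _ _ _ _ _ (E B) (E C) (E C) (E A) (Rmin o o')); auto;
    try (apply Rmin_glb_lt; assumption); intros u Hu;
    specialize (H u Hu); specialize (H' u Hu); specialize (H'' u Hu); destruct Hu; simpl in *;
    rewrite ?orient_M, ?orient_left, ?orient_right; try lra.
  all: try (replace (orient (E B u) (E C u) (E A u)) with (orient (E A u) (E B u) (E C u))
    by (unfold orient; ring)).
  all: try (replace (orient (E C u) (E A u) (E B u)) with (orient (E A u) (E B u) (E C u))
    by (unfold orient; ring)).
  all: try nra.
  all: unfold orient in *; lra.
Qed.

(** At time 1 the two legs run through the two halves of the lifted chord AC, so their union is that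
    chord. This works because both legs have the same height factor [c]. *)
Lemma chord_knot_drop L : (forall k l h, In (k, l, h) L -> drop_ok k l h) ->
  iso (chord_knot th ((A, B, c) :: (B, C, c) :: L)) (chord_knot th ((A, C, c) :: L)).
Proof.
  intros HL.
  pose (s := fun x : nat * nat * R => static (fst (fst x)) (snd (fst x)) (snd x)).
  assert (same : forall i u, aff (th i) (th i) u = th i) by (intros; unfold aff; ring).
  assert (sarc : forall i j h u t, static i j h u t = arc (th i) (th j) h t).
  { intros. unfold static, ch, seg, cap, E, vert, ecirc, arc, cc. simpl. rewrite !same. reflexivity. }
  assert (mst : forall f k l h, (f = m1 \/ f = m2) -> In (k, l, h) L -> pairgood f (static k l h)).
  { intros f k l h Hf Hin. destruct (HL _ _ _ Hin) as (Hl & [K|[[-> K]|[->|[K Hh]]]]).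
    - destruct (outside k l h K Hl); destruct Hf as [-> | ->]; assumption.
    - destruct (at_A l h ltac:(lia)); destruct Hf as [-> | ->]; assumption.
    - destruct (at_C l h ltac:(lia)); destruct Hf as [-> | ->]; assumption.
    - destruct (cross_ok k l h ltac:(lia) ltac:(lia) Hh);
      destruct Hf as [-> | ->]; assumption. }
  assert (E0 : forall t, m1 0 t = arc (th A) (th B) c t /\ m2 0 t = arc (th B) (th C) c t).
  { intros t. unfold m1, m2, ch, seg, cap, M, E, vert, ecirc, arc, cc; simpl.
    rewrite !same. split; (f_equal; [f_equal|]); field. }
  assert (E1 : forall t, m1 1 t = arc (th A) (th C) c (t / 2) /\ m2 1 t = arc (th A) (th C) c ((1 + t) / 2)).
  { intros t. unfold m1, m2, ch, seg, cap, M, E, vert, ecirc, arc, cc; simpl.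
    rewrite !same. split; (f_equal; [f_equal|]); field. }
  eapply iso_trans; [|eapply iso_trans; [apply (iso_arcset (m1 :: m2 :: map s L))|]].
  - apply iso_ext. intros p; split.
    + intros (i & j & h & [Hin|[Hin|Hin]] & t & Ht & ->).
      * injection Hin; intros; subst. exists m1; split; [left; reflexivity|]. exists t.
        rewrite (proj1 (E0 t)); auto.
      * injection Hin; intros; subst. exists m2; split; [right; left; reflexivity|]. exists t.
        rewrite (proj2 (E0 t)); auto.
      * exists (s (i, j, h)); split; [right; right; apply in_map, Hin|]. exists t.
        unfold s; simpl; rewrite sarc; auto.
    + intros (f & [<-|[<-|Hf]] & t & Ht & ->).
      * rewrite (proj1 (E0 t)). exists A, B, c; split; [left; reflexivity | exists t; auto].
      * rewrite (proj2 (E0 t)). exists B, C, c; split; [right; left; reflexivity | exists t; auto].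
      * apply in_map_iff in Hf as ([[i j] h] & <- & Hf). unfold s; simpl; rewrite sarc.
        exists i, j, h; split; [right; right; exact Hf | exists t; auto].
  - assert (st : forall x u t, s x u t = s x 0 t) by (intros; unfold s; rewrite !sarc; reflexivity).
    assert (X : forall f, f = m1 \/ f = m2 -> forall g, In g (m1 :: m2 :: map s L) -> pairgood f g).
    { intros f Hf g [<-|[<-|Hg]].
      - destruct Hf as [-> | ->]; auto using pairgood_sym.
      - destruct Hf as [-> | ->]; auto.
      - apply in_map_iff in Hg as ([[i j] h] & <- & Hg). apply mst; auto. }
    intros f g [<-|[<-|Hf]] Hg; auto.
    destruct Hg as [<-|[<-|Hg]].
    + apply pairgood_sym, X; simpl; auto.
    + apply pairgood_sym, X; simpl; auto.
    + apply in_map_iff in Hf as (x & <- & Hf). apply in_map_iff in Hg as (y & <- & Hg).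
      apply pairgood_static; apply st.
  - apply iso_ext. intros p; split.
    + intros (f & [<-|[<-|Hf]] & t & Ht & ->).
      * rewrite (proj1 (E1 t)). exists A, C, c; split; [left; reflexivity|].
        exists (t / 2); split; [unfold I01 in *; lra | reflexivity].
      * rewrite (proj2 (E1 t)). exists A, C, c; split; [left; reflexivity|].
        exists ((1 + t) / 2); split; [unfold I01 in *; lra | reflexivity].
      * apply in_map_iff in Hf as ([[i j] h] & <- & Hf). unfold s; simpl; rewrite sarc.
        exists i, j, h; split; [right; exact Hf | exists t; auto].
    + intros (i & j & h & [Hin|Hin] & t & Ht & ->).
      * injection Hin; intros; subst. destruct (Rle_dec t (1 / 2)).
        -- exists m1; split; [left; reflexivity|]. exists (2 * t); split; [unfold I01 in *; lra|].
           rewrite (proj1 (E1 _)). f_equal; field.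
        -- exists m2; split; [right; left; reflexivity|]. exists (2 * t - 1); split; [unfold I01 in *; lra|].
           rewrite (proj2 (E1 _)). f_equal; field.
      * exists (s (i, j, h)); split; [right; right; apply in_map, Hin|]. exists t.
        unfold s; simpl; rewrite sarc; auto.
Qed.
End drop.

(** * Swinging a chord around the vertex it cuts off *)

Section flip.
Variable h : R.
Hypothesis Hh : 0 <= h.

Let s := sin (PI / 3).

(* The chord from angle -PI/3 to PI/3, for e = 1, leaves its vertical plane x = 1/2 outwards
   and returns below; e = -1 is the same arc with reversed parameter. *)
Definition swing (e : R) : marc := fun u t =>
  (1 / 2 + 4 * u * (1 - u) * (h * (t * (1 - t))), e * ((2 * t - 1) * sin (PI / 3)),
   (1 - 2 * u) * (h * (t * (1 - t)))).

Let s2 : s * s = 3 / 4.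
Proof.
  pose proof (sin2_cos2 (PI / 3)) as H. unfold Rsqr in H. rewrite cos_PI3 in H. unfold s. lra.
Qed.

Let s_ge : 86 / 100 <= s.
Proof.
  assert (0 < s) by (apply sin_gt_0; pose proof PI_RGT_0; lra). nra.
Qed.

Lemma swing_rev e u t : swing e u t = swing (- e) u (1 - t).
Proof. unfold swing. f_equal; [f_equal|]; ring. Qed.

Lemma bl0_time : bounded_lipschitz I01 (fun u _ => u).
Proof. apply (bl_of0 I01 (fun u => u)), bl0_id. Qed.

Lemma swing_blmarc e : blmarc (swing e).
Proof.
  unfold swing; repeat split; simpl; unfold Rdiv; repeat first [apply bl0_time | progress blt].
Qed.

(** The second coordinate does not depend on time and is linear in the parameter with slope 2
    sin(PI/3) > 1; it alone keeps the points apart. *)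
Lemma swing_self : pairgood (swing 1) (swing 1).
Proof.
  set (P2 := fun p : R * R => I01 (fst p) /\ I01 (snd p)).
  assert (t1 : bounded_lipschitz P2 (fun _ p => fst p)).
  { apply (bl_still P2 (fun p => fst p) 1). intros p [[] _]; apply Rabs_le; lra. }
  assert (t2 : bounded_lipschitz P2 (fun _ p => snd p)).
  { apply (bl_still P2 (fun p => snd p) 1). intros p [_ []]; apply Rabs_le; lra. }
  assert (tu : bounded_lipschitz P2 (fun u _ => u)) by (apply (bl_of0 P2 (fun u => u)), bl0_id).
  apply (pairgood_self _ (fun u p => (4 * u * (1 - u) * (h * (1 - fst p - snd p)), 2 * sin (PI / 3),
     (1 - 2 * u) * (h * (1 - fst p - snd p)))) 1); fold P2; simpl.
  - repeat first [apply t1 | apply t2 | apply tu | progress blt].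
  - blt.
  - repeat first [apply t1 | apply t2 | apply tu | progress blt].
  - intros u t t'. unfold swing; simpl. f_equal; [f_equal|]; ring.
  - lra.
  - intros u t t' Hu Ht Ht'. unfold swing; simpl vsub.
    eapply Rle_trans; [|apply (proj1 (proj2 (nrm_bounds _ _ _)))].
    replace (1 * ((2 * t - 1) * sin (PI / 3)) - 1 * ((2 * t' - 1) * sin (PI / 3)))
      with ((2 * s) * (t - t')) by (unfold s; ring).
    rewrite Rabs_mult. apply Rmult_le_compat_r; [apply Rabs_pos|].
    rewrite Rabs_pos_eq; lra.
Qed.

Let cc (c : R) : R -> R := fun _ => c.

Lemma mp_still a : moving_point (fun _ => ecirc a).
Proof.
  repeat split; try apply ecirc_inbox; exact (bl_const (fun _ : unit => True) _).
Qed.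

Let bl0_cc c : bounded_lipschitz0 (cc c).
Proof. exact (bl_const (fun _ : unit => True) c). Qed.

(** The swinging arc stays in x >= 1/2 and the chord in x <= 0. *)
Lemma swing_outside e a b c : cos a <= 0 -> cos b <= 0 ->
  pairgood (swing e) (ch (fun _ => ecirc a) (fun _ => ecirc b) (fun _ => c)).
Proof.
  intros Ha Hb. apply pairgood_far.
  - apply swing_blmarc.
  - apply ch_blmarc; [apply mp_still | apply mp_still | apply bl0_cc].
  - exists (1 / 2); split; [lra|]. intros u t t' [] [] []. unfold swing, ch, seg; simpl.
    eapply Rle_trans; [|apply (proj1 (nrm_bounds _ _ _))]. eapply Rle_trans; [|apply Rle_abs].
    assert (0 <= 4 * u * (1 - u) * (h * (t * (1 - t)))).
    { repeat apply Rmult_le_pos; lra. }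
    nra.
Qed.

(** From the common end the chord goes inwards and the arc does not: for two points at distance n,
    the first coordinates give t' <= 2n and the second ones t - 2t' <= n. Together t + t' <= 7n,
    whence 1/7. *)
Lemma swing_adj e a b c : e * e = 1 -> cos a = 1 / 2 -> sin a = - e * s -> cos b <= 0 ->
  pairgood (swing e) (ch (fun _ => ecirc a) (fun _ => ecirc b) (fun _ => c)).
Proof.
  intros He Ha Ha' Hb.
  pose (X := cos b - cos a). pose (Y := sin b - sin a).
  apply (pairgood_adj _ _
    (fun u t => (4 * u * (1 - u) * (h * (1 - t)), e * (2 * s), (1 - 2 * u) * (h * (1 - t))))
    (fun u t => (X, Y, - (c * (X * (cos a + cos a + t * X) + Y * (sin a + sin a + t * Y))))) (1 / 7)).
  - repeat split; simpl; repeat first [apply bl0_time | progress blt].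
  - repeat split; simpl; blt.
  - intros u t t'. pose proof (gg_ecirc a) as G. unfold swing, ch, seg, X, Y; simpl.
    f_equal; [f_equal|].
    + rewrite Ha; ring.
    + rewrite Ha'; unfold s; ring.
    + match goal with |- ?l = ?r => replace l with (r - c * cap (ecirc a)) end.
      * rewrite G; ring.
      * unfold cap, ecirc; simpl; ring.
  - lra.
  - intros u t t' Hu Ht Ht'. destruct Hu, Ht, Ht'.
    unfold swing, ch, seg; simpl vsub.
    match goal with |- _ <= nrm (?x, ?y, ?z) => destruct (nrm_bounds x y z) as (dx & dy & _);
      set (n := nrm _) in * end.
    assert (N1 : t' / 2 <= n).
    { eapply Rle_trans; [|exact dx]. eapply Rle_trans; [|apply Rle_abs]. rewrite Ha.
      assert (0 <= 4 * u * (1 - u) * (h * (t * (1 - t)))).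
      { repeat apply Rmult_le_pos; lra. }
      nra. }
    assert (N2 : t - 2 * t' <= n).
    { assert (E : e * ((2 * t - 1) * sin (PI / 3)) - ((1 - t') * sin a + t' * sin b)
          = e * (2 * s * t) - t' * (sin b - sin a)) by (rewrite Ha'; unfold s; ring).
      rewrite E in dy. eapply Rle_trans; [|exact dy].
      pose proof (Rabs_triang_inv (e * (2 * s * t)) (t' * (sin b - sin a))) as T.
      assert (Ae : Rabs e = 1).
      { pose proof (Rabs_mult e e) as M. rewrite He, Rabs_R1 in M. pose proof (Rabs_pos e). nra. }
      rewrite !Rabs_mult, Ae, (Rabs_pos_eq t), (Rabs_pos_eq t'), (Rabs_pos_eq 2), (Rabs_pos_eq s) in T by lra.
      assert (Rabs (sin b - sin a) <= 1 + 1).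
      { apply Rabs_minus_le; [apply (ecirc_inbox b) | apply (ecirc_inbox a)]. }
      nra. }
    lra.
Qed.

(* By the height of the swinging arc, it can only meet the corner near its own ends,
   where the corner is not. *)
Lemma swing_corner e a c : e * e = 1 -> cos a = - (1 / 2) -> (sin a = s \/ sin a = - s) -> 5 * (Rabs c + 1) <= h ->
  pairgood (swing e) (ch (fun _ => ecirc 0) (fun _ => ecirc a) (fun _ => c)).
Proof.
  intros He Ha Ha' Hc. apply pairgood_far.
  - apply swing_blmarc.
  - apply ch_blmarc; [apply mp_still | apply mp_still | apply bl0_cc].
  - exists (1 / 20); split; [lra|]. intros u t b [] [] Hb. apply Rnot_lt_le. intros L.
    unfold swing, ch in L; simpl vsub in L.
    match type of L with nrm (?x, ?y, ?z) < _ => destruct (nrm_bounds x y z) as (dx & dy & dz) end.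
    set (n := nrm _) in *.
    rewrite gg_chord in dz by apply gg_ecirc. unfold seg in dx, dy; simpl in dx, dy.
    assert (D : dsq (ecirc 0) (ecirc a) = 3).
    { unfold dsq, ecirc; simpl. rewrite cos_0, sin_0, Ha. destruct Ha' as [-> | ->]; nra. }
    rewrite D in dz. rewrite cos_0, Ha in dx. rewrite sin_0 in dy.
    destruct Hb as [b0 b1].
    set (f := t * (1 - t)) in *.
    assert (f0 : 0 <= f) by (unfold f; nra).
    assert (O : 0 <= 4 * u * (1 - u) * (h * f)) by (repeat apply Rmult_le_pos; lra).
    apply Rabs_le_bounds in dx.
    assert (b2 : b <= 37 / 100) by nra.
    assert (Y : Rabs ((2 * t - 1) * s) <= b * s + 1 / 20).
    { assert (E1 : Rabs (e * ((2 * t - 1) * s)) = Rabs ((2 * t - 1) * s)).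
      { pose proof (Rabs_mult e e) as M. rewrite He, Rabs_R1 in M. pose proof (Rabs_pos e).
        rewrite (Rabs_mult e). replace (Rabs e) with 1 by nra. ring. }
      rewrite <- E1.
      replace (e * ((2 * t - 1) * s)) with
        ((e * ((2 * t - 1) * s) - ((1 - b) * 0 + b * sin a)) + b * sin a) by ring.
      eapply Rle_trans; [apply Rabs_triang|].
      assert (Rabs (b * sin a) = b * s).
      { rewrite Rabs_mult, (Rabs_pos_eq b) by lra. destruct Ha' as [-> | ->];
          rewrite ?Rabs_Ropp; rewrite Rabs_pos_eq by lra; reflexivity. }
      unfold s in *. lra. }
    rewrite Rabs_mult, (Rabs_pos_eq s) in Y by lra.
    assert (Y' : Rabs (2 * t - 1) <= 43 / 100).
    { apply Rmult_le_reg_r with s; [lra|]. nra. }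
    apply Rabs_le_bounds in Y'.
    assert (F : 1 / 5 <= f) by (unfold f; nra).
    assert (Z : Rabs ((1 - 2 * u) * (h * f)) <= Rabs c + 1 / 20).
    { replace ((1 - 2 * u) * (h * f)) with
       (((1 - 2 * u) * (h * f) - c * (b * (1 - b) * 3)) + c * (b * (1 - b) * 3)) by ring.
      eapply Rle_trans; [apply Rabs_triang|].
      assert (Rabs (c * (b * (1 - b) * 3)) <= Rabs c * 1).
      { rewrite Rabs_mult. apply Rmult_le_compat_l; [apply Rabs_pos|]. rewrite Rabs_pos_eq; nra. }
      lra. }
    apply Rabs_le_bounds in Z.
    assert (hf : h / 5 <= h * f) by nra.
    assert (P : 4 * u * (1 - u) * (h * f) <= 6 / 10) by nra.
    pose proof (Rabs_pos c).
    (* Here f >= 1/5, so the factor 5 in the hypothesis gives w >= |c| + 1. The vertical excursion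
       |1 - 2u| w and the outward one 4u(1 - u) w add up to at least w, but closeness to the chord
       bounds them by |c| + 1/20 and 6/10. *)
    set (w := h * f) in *. assert (w0 : Rabs c + 1 <= w) by lra. clearbody w.
    destruct (Rle_dec u (1 / 2)).
    + assert ((1 - 2 * u) * w + 4 * u * (1 - u) * w >= w); [|lra].
      replace ((1 - 2 * u) * w + 4 * u * (1 - u) * w) with (w + w * (2 * u * (1 - 2 * u))) by ring.
      assert (0 <= w * (2 * u * (1 - 2 * u))) by (repeat apply Rmult_le_pos; lra). lra.
    + assert (- ((1 - 2 * u) * w) + 4 * u * (1 - u) * w >= w); [|lra].
      replace (- ((1 - 2 * u) * w) + 4 * u * (1 - u) * w) with (w + w * (2 * (1 - u) * (2 * u - 1))) by ring.
      assert (0 <= w * (2 * (1 - u) * (2 * u - 1))) by (repeat apply Rmult_le_pos; lra). lra.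
Qed.
End flip.

(** * Knots with the projection of the heptagram *)

(* The edges are listed so that each one crosses exactly its two cyclic neighbours. *)
Definition hepta (a0 a1 a2 a3 a4 a5 a6 : R) : list (nat * nat * R) :=
  [(0, 2, a0); (1, 3, a1); (2, 4, a2); (3, 5, a3); (4, 6, a4); (0, 5, a5); (1, 6, a6)]%nat.

(** The position for the swing: the chord 02 lies on the line x = 1/2 and cuts off the vertex 1 at
    (1, 0); all other vertices have x <= 0, and the neighbours 3 and 6 of vertex 1 along chords have
    x = -1/2. *)
Definition thflip (i : nat) : R :=
  match i with
  | 0%nat => - (PI / 3) | 1%nat => 0 | 2%nat => PI / 3 | 3%nat => 2 * (PI / 3)
  | 4%nat => 5 * (PI / 6) | 5%nat => PI | _ => PI / 3 + PI
  end.

Lemma valid_thflip : valid thflip 0 6.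
Proof.
  pose proof PI_RGT_0 as P. intros i j Hij Hj.
  assert (Hi : (i <= 5)%nat) by lia.
  do 6 (destruct i as [|i]; [do 7 (destruct j as [|j]; [try lia; simpl; lra|]); lia|]). lia.
Qed.

(** Only the chord 02 moves. The chords 13 and 16, which meet in the vertex that is passed, are the
    ones it crosses; a large height makes the arc swing clear of them. *)
Lemma hepta_swing (a1 a2 a3 a4 a5 a6 : R) :
  exists H, forall a, H <= a ->
    iso (chord_knot thflip (hepta a a1 a2 a3 a4 a5 a6)) (chord_knot thflip (hepta (- a) a1 a2 a3 a4 a5 a6)).
Proof.
  exists (5 * (Rabs a1 + Rabs a6 + 1)). intros a Ha.
  pose proof (Rabs_pos a1); pose proof (Rabs_pos a6).
  pose proof PI_RGT_0 as P.
  pose (st := fun x : nat * nat * R =>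
    ch (fun _ => ecirc (thflip (fst (fst x)))) (fun _ => ecirc (thflip (snd (fst x)))) (fun _ => snd x)).
  pose (L := [(1, 3, a1); (2, 4, a2); (3, 5, a3); (4, 6, a4); (0, 5, a5); (1, 6, a6)]%nat).
  assert (s_def : sin (PI / 3) * sin (PI / 3) = 3 / 4).
  { pose proof (sin2_cos2 (PI / 3)) as E. unfold Rsqr in E. rewrite cos_PI3 in E. lra. }
  assert (x3 : cos (thflip 3) = - (1 / 2) /\ sin (thflip 3) = sin (PI / 3)).
  { simpl. replace (2 * (PI / 3)) with (PI - PI / 3) by field.
    rewrite sin_PI_x, Rtrigo_facts.cos_pi_minus, cos_PI3. split; lra. }
  assert (x6 : cos (thflip 6) = - (1 / 2) /\ sin (thflip 6) = - sin (PI / 3)).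
  { simpl. rewrite neg_cos, neg_sin, cos_PI3. split; lra. }
  assert (neg : forall i, In i [3; 4; 5; 6]%nat -> cos (thflip i) <= 0).
  { intros i Hi. apply cos_le_0; repeat destruct Hi as [<-|Hi]; simpl; try lra; destruct Hi. }
  assert (arcE : forall i j h u t, st (i, j, h) u t = arc (thflip i) (thflip j) h t).
  { intros. unfold st, ch, seg, cap, ecirc, arc; simpl. reflexivity. }
  (* The chord 02 has squared length 3, so [cap] on it is 3t(1 - t); this is why the height [a] of
     the chord corresponds to the parameter 3a of [swing]. *)
  assert (end0 : forall t, swing (3 * a) 1 0 t = arc (thflip 0) (thflip 2) a t).
  { intros t. unfold swing, arc; simpl. rewrite cos_neg, sin_neg, cos_PI3.
    f_equal; [f_equal; field|].
    transitivity (a * (1 - 1 / 4 - (2 * t - 1) * (2 * t - 1) * (sin (PI / 3) * sin (PI / 3)))); [|field].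
    rewrite s_def. field. }
  assert (end1 : forall t, swing (3 * a) 1 1 t = arc (thflip 0) (thflip 2) (- a) t).
  { intros t. unfold swing, arc; simpl. rewrite cos_neg, sin_neg, cos_PI3.
    f_equal; [f_equal; field|].
    transitivity (- a * (1 - 1 / 4 - (2 * t - 1) * (2 * t - 1) * (sin (PI / 3) * sin (PI / 3)))); [|field].
    rewrite s_def. field. }
  assert (E : forall u b, (forall t, swing (3 * a) 1 u t = arc (thflip 0) (thflip 2) b t) ->
     forall p, chord_knot thflip (hepta b a1 a2 a3 a4 a5 a6) p <-> arcset (swing (3 * a) 1 :: map st L) u p).
  { intros u b Eb p; split.
    - intros (i & j & c & Hin & t & Ht & ->). destruct Hin as [Hin|Hin].
      + injection Hin; intros; subst. exists (swing (3 * a) 1); split; [left; reflexivity|].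
        exists t. rewrite Eb; auto.
      + exists (st (i, j, c)); split; [right; apply in_map, Hin|]. exists t. rewrite arcE; auto.
    - intros (f & [<-|Hf] & t & Ht & ->).
      + exists 0%nat, 2%nat, b; split; [left; reflexivity|]. exists t; auto.
      + apply in_map_iff in Hf as ([[i j] c] & <- & Hin). rewrite arcE.
        exists i, j, c; split; [right; exact Hin|]. exists t; auto. }
  eapply iso_trans; [apply iso_ext, (E 0 a end0)|].
  eapply iso_trans; [|apply iso_sym, iso_ext, (E 1 (- a) end1)].
  apply iso_arcset.
  assert (X : forall g, In g (map st L) -> pairgood (swing (3 * a) 1) g).
  { intros g Hg. simpl in Hg.
    destruct Hg as [<-|[<-|[<-|[<-|[<-|[<-|[]]]]]]]; unfold st; simpl fst; simpl snd.
    - change (thflip 1) with 0. apply swing_corner; lra.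
    (* The chord 24 begins at the vertex 2, where the arc ends, so the arc is run through
       backwards. *)
    - apply (pairgood_rev _ (swing (3 * a) (- (1)))).
      { intros; apply swing_rev. }
      apply swing_adj; [lra | lra | simpl; rewrite cos_PI3; lra | simpl; ring | apply neg; simpl; auto].
    - apply swing_outside; [lra | apply neg; simpl; auto | apply neg; simpl; auto].
    - apply swing_outside; [lra | apply neg; simpl; auto | apply neg; simpl; auto].
    - apply swing_adj; [lra | lra | simpl; rewrite cos_neg, cos_PI3; lra | simpl; rewrite sin_neg; ring | apply neg; simpl; auto].
    - change (thflip 1) with 0. apply swing_corner; lra. }
  intros f g [<-|Hf] [<-|Hg].
  - apply swing_self.
  - apply X, Hg.
  - apply pairgood_sym, X, Hf.
  - apply in_map_iff in Hf as (x & <- & Hf). apply in_map_iff in Hg as (y & <- & Hg).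
    apply pairgood_static; reflexivity.
Qed.

(** * Heptagrams up to isotopy *)

Definition same_angle (a b : R) : Prop := cos a = cos b /\ sin a = sin b.

Lemma arc_swap a b c t : arc a b c t = arc b a c (1 - t).
Proof. unfold arc. f_equal; [f_equal|]; ring. Qed.

Lemma arc_same a a' b b' c t : same_angle a a' -> same_angle b b' -> arc a b c t = arc a' b' c t.
Proof. intros [H1 H2] [H3 H4]. unfold arc. rewrite H1, H2, H3, H4. reflexivity. Qed.

Definition chord_in (th : nat -> R) (L : list (nat * nat * R)) (a b c : R) : Prop :=
  exists i j, In (i, j, c) L /\
    ((same_angle a (th i) /\ same_angle b (th j)) \/ (same_angle a (th j) /\ same_angle b (th i))).

Lemma chord_in_sk th L a b c t : chord_in th L a b c -> I01 t -> chord_knot th L (arc a b c t).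
Proof.
  intros (i & j & Hin & [[H1 H2]|[H1 H2]]) Ht; exists i, j, c; split; auto.
  - exists t; split; [exact Ht | apply arc_same; assumption].
  - exists (1 - t); split; [unfold I01 in *; lra|]. rewrite arc_swap. apply arc_same; assumption.
Qed.

Lemma chord_knot_eq th th' L L' :
  (forall i j c, In (i, j, c) L -> chord_in th' L' (th i) (th j) c) ->
  (forall i j c, In (i, j, c) L' -> chord_in th L (th' i) (th' j) c) ->
  iso (chord_knot th L) (chord_knot th' L').
Proof.
  intros H H'. apply iso_ext. intros p; split; intros (i & j & c & Hin & t & Ht & ->);
    apply chord_in_sk; auto.
Qed.

Lemma same_angle_refl a : same_angle a a.
Proof. split; reflexivity. Qed.

Lemma same_angle_period a : same_angle a (a + 2 * PI).
Proof. split; [rewrite cos_plus | rewrite sin_plus]; rewrite cos_2PI, sin_2PI; ring. Qed.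

Definition hept (l : list R) : list (nat * nat * R) :=
  hepta (nth 0 l 0) (nth 1 l 0) (nth 2 l 0) (nth 3 l 0) (nth 4 l 0) (nth 5 l 0) (nth 6 l 0).

(** Quantified over the positions of the seven vertices on both sides, so that a change of position,
    a renaming of the vertices or the special position [thflip] can be inserted anywhere. *)
Definition hequiv (l l' : list R) : Prop :=
  forall th th', valid th 0 6 -> valid th' 0 6 -> iso (chord_knot th (hept l)) (chord_knot th' (hept l')).

Lemma hequiv_sym l l' : hequiv l l' -> hequiv l' l.
Proof. intros H th th' V V'. apply iso_sym, H; assumption. Qed.

Lemma hequiv_trans l l' l'' : hequiv l l' -> hequiv l' l'' -> hequiv l l''.
Proof.
  intros H H' th th' V V'. apply (iso_trans _ (chord_knot thflip (hept l'))).
  - apply H; auto using valid_thflip.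
  - apply H'; auto using valid_thflip.
Qed.

Definition same_crossings (l l' : list R) : Prop :=
  forall k, (k < 7)%nat ->
    0 < (nth k l 0 - nth (S k mod 7) l 0) * (nth k l' 0 - nth (S k mod 7) l' 0).

Lemma hequiv_crossings l l' : same_crossings l l' -> hequiv l l'.
Proof.
  intros H th th' V V'. unfold same_crossings in H.
  pose proof (H 0%nat ltac:(lia)) as H0. pose proof (H 1%nat ltac:(lia)) as H1.
  pose proof (H 2%nat ltac:(lia)) as H2. pose proof (H 3%nat ltac:(lia)) as H3.
  pose proof (H 4%nat ltac:(lia)) as H4. pose proof (H 5%nat ltac:(lia)) as H5.
  pose proof (H 6%nat ltac:(lia)) as H6.
  change (1 mod 7)%nat with 1%nat in *. change (2 mod 7)%nat with 2%nat in *.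
  change (3 mod 7)%nat with 3%nat in *. change (4 mod 7)%nat with 4%nat in *.
  change (5 mod 7)%nat with 5%nat in *. change (6 mod 7)%nat with 6%nat in *.
  change (7 mod 7)%nat with 0%nat in *. clear H.
  unfold hept. set (a0 := nth 0 l 0) in *. set (a1 := nth 1 l 0) in *. set (a2 := nth 2 l 0) in *.
  set (a3 := nth 3 l 0) in *. set (a4 := nth 4 l 0) in *. set (a5 := nth 5 l 0) in *. set (a6 := nth 6 l 0) in *.
  set (b0 := nth 0 l' 0) in *. set (b1 := nth 1 l' 0) in *. set (b2 := nth 2 l' 0) in *.
  set (b3 := nth 3 l' 0) in *. set (b4 := nth 4 l' 0) in *. set (b5 := nth 5 l' 0) in *. set (b6 := nth 6 l' 0) in *.
  clearbody a0 a1 a2 a3 a4 a5 a6 b0 b1 b2 b3 b4 b5 b6.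
  apply (chord_knot_iso th th' 0 6 [(0, 2, (a0, b0)); (1, 3, (a1, b1)); (2, 4, (a2, b2));
    (3, 5, (a3, b3)); (4, 6, (a4, b4)); (0, 5, (a5, b5)); (1, 6, (a6, b6))]%nat); auto.
  - intros i j h Hin. repeat (destruct Hin as [Hin|Hin]; [injection Hin; intros; subst; lia|]).
    destruct Hin.
  - intros i j h k m h' Hin Hin'. unfold crossing.
    repeat (destruct Hin as [Hin|Hin]; [injection Hin; intros; subst; clear Hin;
      repeat (destruct Hin' as [Hin'|Hin']; [injection Hin'; intros; subst; clear Hin';
         (split; [intros; first [reflexivity | lia] | intros; simpl; first [lia | lra]])|]);
      destruct Hin'|]).
    destruct Hin.
Qed.

Definition rotl (l : list R) : list R := match l with [] => [] | a :: l => l ++ [a] end.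

(** The chord at place k of the list is {k, k + 2} modulo 7. Renaming i + 1 to i, and 0, one turn
    later, to 6, shifts the heights by one place and leaves the point set unchanged. *)
Lemma hequiv_rotl_aux l th : length l = 7%nat -> valid th 0 6 ->
  exists th', valid th' 0 6 /\ iso (chord_knot th (hept l)) (chord_knot th' (hept (rotl l))).
Proof.
  intros Hl V.
  do 8 (destruct l as [|? l]; try discriminate Hl).
  exists (fun i => if (i =? 6)%nat then th 0%nat + 2 * PI else th (S i)). split.
  - intros i j Hij Hj. pose proof (V 0%nat (S i)).
    destruct (Nat.eqb_spec i 6), (Nat.eqb_spec j 6); try lia.
    + specialize (H ltac:(lia) ltac:(lia)). lra.
    + apply V; lia.
  - pose proof same_angle_refl as sr. pose proof (same_angle_period (th 0%nat)) as sp.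
    assert (sp' : same_angle (th 0%nat + 2 * PI) (th 0%nat)).
    { destruct sp as [e1 e2]. split; symmetry; assumption. }
    apply chord_knot_eq; intros i j c Hin; unfold hept, hepta in *; simpl in Hin;
      repeat (destruct Hin as [Hin|Hin]; [injection Hin; intros; subst; clear Hin|]); try destruct Hin.
    1: exists 1%nat, 6%nat. 2: exists 0%nat, 2%nat. 3: exists 1%nat, 3%nat. 4: exists 2%nat, 4%nat.
    5: exists 3%nat, 5%nat. 6: exists 4%nat, 6%nat. 7: exists 0%nat, 5%nat.
    8: exists 1%nat, 3%nat. 9: exists 2%nat, 4%nat. 10: exists 3%nat, 5%nat. 11: exists 4%nat, 6%nat.
    12: exists 0%nat, 5%nat. 13: exists 1%nat, 6%nat. 14: exists 0%nat, 2%nat.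
    all: split; [simpl; tauto|]; simpl; first [left; split; solve [auto] | right; split; solve [auto]].
Qed.

Lemma hequiv_rotl l l' : length l = 7%nat -> length l' = 7%nat ->
  hequiv (rotl l) (rotl l') -> hequiv l l'.
Proof.
  intros Hl Hl' H th th' V V'.
  destruct (hequiv_rotl_aux l th Hl V) as (t1 & V1 & I1).
  destruct (hequiv_rotl_aux l' th' Hl' V') as (t2 & V2 & I2).
  eapply iso_trans; [exact I1|]. eapply iso_trans; [|apply iso_sym, I2]. apply H; assumption.
Qed.

(** The first chord is raised to a height [h] large enough for the swing, which keeps it above its
    two neighbours, swung to [- h], and brought to [b] below both of them. *)
Lemma hequiv_flip a b a1 a2 a3 a4 a5 a6 : a1 < a -> a6 < a -> b < a1 -> b < a6 ->
  a1 <> a2 -> a2 <> a3 -> a3 <> a4 -> a4 <> a5 -> a5 <> a6 ->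
  hequiv [a; a1; a2; a3; a4; a5; a6] [b; a1; a2; a3; a4; a5; a6].
Proof.
  intros H1 H2 H3 H4 n1 n2 n3 n4 n5.
  destruct (hepta_swing a1 a2 a3 a4 a5 a6) as [H HH].
  pose (h := Rmax H (Rabs a1 + Rabs a6 + 1)).
  assert (hH : H <= h) by apply Rmax_l.
  assert (ha : Rabs a1 + Rabs a6 + 1 <= h) by apply Rmax_r.
  pose proof (Rabs_le_bounds a1 _ (Rle_refl _)). pose proof (Rabs_le_bounds a6 _ (Rle_refl _)).
  pose proof (Rabs_pos a1). pose proof (Rabs_pos a6).
  assert (sq : forall x y, x <> y -> 0 < (x - y) * (x - y)).
  { intros x y Hxy. pose proof (Rlt_0_sqr (x - y) ltac:(lra)) as Hs. exact Hs. }
  assert (E : forall x y, (a1 < x /\ a6 < x /\ a1 < y /\ a6 < y) \/ (x < a1 /\ x < a6 /\ y < a1 /\ y < a6) ->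
     hequiv [x; a1; a2; a3; a4; a5; a6] [y; a1; a2; a3; a4; a5; a6]).
  { intros x y C. apply hequiv_crossings. intros k Hk.
    destruct k as [|[|[|[|[|[|[|]]]]]]]; try lia; simpl; try (apply sq; assumption).
    - destruct C as [C|C]; [apply Rmult_lt_0_compat; lra|].
      replace ((x - a1) * (y - a1)) with ((a1 - x) * (a1 - y)) by ring. apply Rmult_lt_0_compat; lra.
    - destruct C as [C|C]; [|apply Rmult_lt_0_compat; lra].
      replace ((a6 - x) * (a6 - y)) with ((x - a6) * (y - a6)) by ring. apply Rmult_lt_0_compat; lra. }
  intros th th' V V'.
  eapply iso_trans; [apply (E a h ltac:(lra) th thflip V valid_thflip)|].
  eapply iso_trans; [apply (HH h hH)|].
  apply (E (- h) b ltac:(lra) thflip th' valid_thflip V').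
Qed.

Ltac flip_here := simpl; apply hequiv_flip; lra.
Ltac rot := apply hequiv_rotl; [reflexivity | reflexivity | ].

(** The heights of the edges {z, z + 2} of K_7 for z = 7, 1, 2, ..., 6: vertex 7 has index 0, and of
    the four sheets the first has height 4. A chord passes below the next one at the positions 0 and
    4. *)
Definition k7_heights : list R := [2; 4; 3; 2; 1; 4; 3].

(* Pairs (i, j): the positions of the two crossings at which a chord passes below the next one. *)
Lemma hequiv_05 : hequiv k7_heights [2; 4; 3; 2; 1; 0; 3].
Proof. do 5 rot. flip_here. Qed.

Lemma hequiv_16 : hequiv k7_heights [2; 1; 3; 2; 1; 0; -1].
Proof.
  apply (hequiv_trans _ _ _ hequiv_05).
  apply (hequiv_trans _ [2; 1; 3; 2; 1; 0; 3]).
  - do 1 rot. flip_here.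
  - do 6 rot. flip_here.
Qed.

Lemma hequiv_26 : hequiv k7_heights [2; 1; 0; 2; 1; 0; -1].
Proof. apply (hequiv_trans _ _ _ hequiv_16). do 2 rot. flip_here. Qed.

Lemma hequiv_46 : hequiv k7_heights [5; 4; 3; 2; 1; 4; 3].
Proof. apply hequiv_sym. flip_here. Qed.

Lemma hequiv_36 : hequiv k7_heights [5; 4; 3; 2; 5; 4; 3].
Proof. apply (hequiv_trans _ _ _ hequiv_46). apply hequiv_sym. do 4 rot. flip_here. Qed.

Lemma hequiv_56 : hequiv k7_heights [5; 4; 3; 2; 1; 0; 3].
Proof. apply (hequiv_trans _ _ _ hequiv_46). do 5 rot. flip_here. Qed.

(** * Sheets of the canonical book representation *)

Lemma nsheets_spec n : (2 * nsheets n = n \/ 2 * nsheets n = n + 1)%nat.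
Proof.
  unfold nsheets. destruct (Nat.even n) eqn:E.
  - apply Nat.even_spec in E as [m ->]. rewrite Nat.div2_double. lia.
  - assert (O : Nat.odd n = true) by (rewrite <- Nat.negb_even, E; reflexivity).
    apply Nat.odd_spec in O as [m ->].
    replace (2 * m + 1)%nat with (S (2 * m)) by lia. rewrite Nat.div2_succ_double. lia.
Qed.

Lemma resid_spec n r : (1 <= r <= 2 * n)%nat ->
  (r <= n /\ resid n r = r \/ n < r /\ resid n r = r - n)%nat.
Proof.
  intros H. unfold resid. destruct (le_lt_dec r n) as [L|L]; [left|right]; split; try exact L.
  - replace (r + n - 1)%nat with ((r - 1) + 1 * n)%nat by lia.
    rewrite Nat.Div0.mod_add, Nat.mod_small; lia.
  - replace (r + n - 1)%nat with ((r - n - 1) + 2 * n)%nat by lia.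
    rewrite Nat.Div0.mod_add, Nat.mod_small; lia.
Qed.

Definition sheet_of (n x : nat) : nat :=
  if (x <=? nsheets n)%nat then x else (x - nsheets n)%nat.

Lemma sheet_of_spec n x :
  (x <= nsheets n /\ sheet_of n x = x \/ nsheets n < x /\ sheet_of n x = x - nsheets n)%nat.
Proof. unfold sheet_of. destruct (Nat.leb_spec x (nsheets n)); lia. Qed.

(** One form for both parities: the vertices up to [nsheets n] open the sheets, the others use them
    again in the same order. Even and odd n differ only in the range of the differences j. *)
Lemma edgeInSheet_spec n a x y : (1 <= n)%nat -> edgeInSheet n a x y <->
  exists j, (1 <= j)%nat /\ (1 <= x)%nat /\ y = resid n (x + j) /\ a = sheet_of n x /\
    (x <= nsheets n /\ 2 * j <= n \/ nsheets n < x <= n /\ 2 * j + 1 <= n)%nat.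
Proof.
  intros Hn. pose proof (nsheets_spec n) as N. pose proof (sheet_of_spec n x) as S.
  unfold edgeInSheet. assert (M : nsheets n = if Nat.even n then Nat.div2 n else (Nat.div2 n + 1)%nat)
    by reflexivity.
  assert (P : (if Nat.even n then n = 2 * Nat.div2 n else n = 2 * Nat.div2 n + 1)%nat).
  { pose proof (Nat.div2_odd n) as D. rewrite <- Nat.negb_even in D.
    destruct (Nat.even n); simpl in D; lia. }
  destruct (Nat.even n); set (m := Nat.div2 n) in *; clearbody m; split.
  - intros (Ha & [(j & Hj & -> & ->)|(j & Hj & -> & ->)]); exists j; repeat split; try lia.
  - intros (j & Hj & Hx & -> & -> & [C|C]).
    + split; [lia|]. left. exists j. repeat split; try lia. f_equal; lia.
    + split; [lia|]. right. exists j. repeat split; try lia. f_equal; lia.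
  - intros [(Ha & [(j & Hj & -> & ->)|(j & Hj & -> & ->)])|(-> & j & Hj & -> & ->)];
      exists j; repeat split; try lia.
    + pose proof (resid_spec n (a + j) ltac:(lia)). lia.
    + f_equal; lia.
    + pose proof (resid_spec n (m + 1 + j) ltac:(lia)). lia.
  - intros (j & Hj & Hx & -> & -> & [C|C]).
    + pose proof (resid_spec n (x + j) ltac:(lia)).
      destruct (Nat.eq_dec x (m + 1)) as [->|].
      * right. split; [lia|]. exists j. lia.
      * left. split; [lia|]. left. exists j. lia.
    + left. split; [lia|]. right. exists j. repeat split; try lia. f_equal; lia.
Qed.

(** Seen from its other end the edge has difference n - d, more than n/2, so it is listed only under
    x, and x determines the sheet. *)
Lemma inSheet_iff n a x d : (1 <= x <= n)%nat -> (1 <= d)%nat -> (2 * d < n)%nat ->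
  inSheet n a x (resid n (x + d)) <-> a = sheet_of n x.
Proof.
  intros Hx Hd Hd'. unfold inSheet. rewrite !edgeInSheet_spec by lia.
  pose proof (nsheets_spec n). pose proof (resid_spec n (x + d) ltac:(lia)) as E.
  set (y := resid n (x + d)) in *. split.
  - intros [(j & Hj & _ & E' & A & C)|(j & Hj & _ & E' & A & C)]; [exact A|].
    exfalso. pose proof (resid_spec n (y + j) ltac:(lia)). lia.
  - intros ->. left. exists d. repeat split; lia.
Qed.

Lemma inSheet_sym n a x y : inSheet n a x y <-> inSheet n a y x.
Proof. unfold inSheet; tauto. Qed.

Definition angle (n i : nat) : R := 2 * PI * INR i / INR n.

Definition height (n x : nat) : R := INR (nsheets n + 1 - sheet_of n x).

Lemma same_angle_sym a b : same_angle a b -> same_angle b a.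
Proof. intros [H1 H2]; split; symmetry; assumption. Qed.

Lemma angle_add n i : (1 <= n)%nat -> angle n (n + i) = angle n i + 2 * PI.
Proof.
  intros Hn. unfold angle. rewrite plus_INR. assert (INR n <> 0) by (apply not_0_INR; lia).
  field. assumption.
Qed.

Lemma angle_resid n r : (1 <= n)%nat -> (1 <= r <= 2 * n)%nat ->
  same_angle (angle n (resid n r)) (angle n r).
Proof.
  intros Hn Hr. destruct (resid_spec n r Hr) as [[_ ->]|[L ->]]; [apply same_angle_refl|].
  replace r with (n + (r - n))%nat at 2 by lia. rewrite angle_add by exact Hn.
  apply same_angle_period.
Qed.

Lemma onChord_arc n a x y p : onChord n a x y p <->
  exists t, I01 t /\ p = arc (angle n x) (angle n y) (INR (nsheets n + 1 - a)) t.
Proof. reflexivity. Qed.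

(* Every edge is written {z, z + d} with d less than n / 2. *)
Definition edge_curve (n : nat) (DE : nat -> nat -> Prop) (p : pt) : Prop :=
  exists z d, DE z d /\ exists t, I01 t /\
    p = arc (angle n z) (angle n (z + d)) (height n z) t.

(** The order and the direction of the edges are forgotten; each edge is rewritten from the end that
    determines its sheet. *)
Lemma cycleKnot_edges n l (DE : nat -> nat -> Prop) :
  (forall z d, DE z d -> (1 <= z <= n /\ 1 <= d /\ 2 * d < n)%nat) ->
  (forall x y, In (x, y) (cycle_pairs l) -> exists z d, DE z d /\
     (x = z /\ y = resid n (z + d) \/ y = z /\ x = resid n (z + d))) ->
  (forall z d, DE z d -> In (z, resid n (z + d)) (cycle_pairs l) \/ In (resid n (z + d), z) (cycle_pairs l)) ->
  forall p, cycleKnot n l p <-> edge_curve n DE p.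
Proof.
  intros HD H1 H2 p. split.
  - intros (x & y & Hin & a & Ha & Hp). destruct (proj1 (onChord_arc _ _ _ _ _) Hp) as (t & Ht & ->).
    destruct (H1 x y Hin) as (z & d & Hz & [[-> ->]|[-> ->]]); destruct (HD z d Hz) as (B1 & B2 & B3);
      pose proof (angle_resid n (z + d) ltac:(lia) ltac:(lia)).
    + apply inSheet_iff in Ha as ->; try lia. exists z, d; split; [exact Hz|]. exists t; split; [exact Ht|].
      apply arc_same; [apply same_angle_refl | assumption].
    + apply inSheet_sym, inSheet_iff in Ha as ->; try lia. exists z, d; split; [exact Hz|].
      exists (1 - t); split; [unfold I01 in *; lra|]. rewrite arc_swap.
      apply arc_same; [apply same_angle_refl | assumption].
  - intros (z & d & Hz & t & Ht & ->). destruct (HD z d Hz) as (B1 & B2 & B3).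
    pose proof (same_angle_sym _ _ (angle_resid n (z + d) ltac:(lia) ltac:(lia))).
    destruct (H2 z d Hz) as [Hin|Hin].
    + exists z, (resid n (z + d)); split; [exact Hin|]. exists (sheet_of n z).
      split; [apply inSheet_iff; auto|]. apply (proj2 (onChord_arc _ _ _ _ _)). exists t; split; [exact Ht|].
      apply arc_same; [apply same_angle_refl | assumption].
    + exists (resid n (z + d)), z; split; [exact Hin|]. exists (sheet_of n z).
      split; [apply inSheet_sym, inSheet_iff; auto|]. apply (proj2 (onChord_arc _ _ _ _ _)).
      exists (1 - t); split; [unfold I01 in *; lra|]. rewrite (arc_swap (angle n z)).
      apply arc_same; [assumption | apply same_angle_refl].
Qed.

Lemma height_lt n x y : (1 <= x <= n)%nat -> (1 <= y <= n)%nat ->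
  (sheet_of n x < sheet_of n y)%nat -> height n y < height n x.
Proof.
  intros Hx Hy H. unfold height. apply lt_INR.
  pose proof (nsheets_spec n). pose proof (sheet_of_spec n x). pose proof (sheet_of_spec n y). lia.
Qed.

Lemma angle_lt n i j : (1 <= n)%nat -> (i < j)%nat -> angle n i < angle n j.
Proof.
  intros Hn Hij. unfold angle. apply lt_INR in Hij.
  assert (0 < INR n) by (apply lt_0_INR; lia). pose proof PI_RGT_0.
  apply Rmult_lt_compat_r; [apply Rinv_0_lt_compat; assumption|].
  apply Rmult_lt_compat_l; lra.
Qed.

Lemma valid_angle n lo hi : (1 <= n)%nat -> (hi < lo + n)%nat -> valid (angle n) lo hi.
Proof.
  intros Hn H i j Hij Hj. split; [apply angle_lt; lia|].
  rewrite <- angle_add by exact Hn. apply angle_lt; lia.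
Qed.

(** * The trefoil *)

(** The cycle consists of all edges {z, z + 2} modulo 7. With vertex 7 as index 0 it is the
    heptagram of [k7_heights] in the position of a regular heptagon. *)
Lemma trefoil_iso th : valid th 0 6 -> iso (chord_knot th (hept k7_heights)) trefoil.
Proof.
  intros V.
  pose (DE := fun z d : nat => (d = 2 /\ 1 <= z <= 7)%nat).
  assert (V7 : valid (angle 7) 0 6) by (apply valid_angle; lia).
  assert (Q : hequiv k7_heights k7_heights).
  { apply hequiv_crossings. intros k Hk.
    destruct k as [|[|[|[|[|[|[|]]]]]]]; try lia; simpl; lra. }
  eapply iso_trans; [apply (Q th (angle 7) V V7)|].
  apply iso_sym.
  assert (E : forall p, trefoil p <-> edge_curve 7 DE p).
  { apply cycleKnot_edges.
    - intros z d [-> Hz]. lia.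
    - intros x y Hin. unfold DE. simpl in Hin.
      repeat (destruct Hin as [Hin|Hin]; [injection Hin; intros; subst;
        eexists _, 2%nat; split; [split; [reflexivity|]|left; split; [reflexivity | reflexivity]]; lia|]).
      destruct Hin.
    - intros z d [-> Hz]. left.
      destruct z as [|[|[|[|[|[|[|[|]]]]]]]]; try lia; simpl; tauto. }
  eapply iso_trans; [apply iso_ext, E|].
  assert (ht : forall z h, INR (nsheets 7 + 1 - sheet_of 7 z) = h -> height 7 z = h) by auto.
  pose proof (same_angle_refl) as sr.
  assert (sp : forall i, same_angle (angle 7 (7 + i)) (angle 7 i)).
  { intros i. rewrite angle_add by lia. apply same_angle_sym, same_angle_period. }
  assert (H1 := ht 1%nat 4 ltac:(simpl; lra)). assert (H2 := ht 2%nat 3 ltac:(simpl; lra)).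
  assert (H3 := ht 3%nat 2 ltac:(simpl; lra)). assert (H4 := ht 4%nat 1 ltac:(simpl; lra)).
  assert (H5 := ht 5%nat 4 ltac:(simpl; lra)). assert (H6 := ht 6%nat 3 ltac:(simpl; lra)).
  assert (H7 := ht 7%nat 2 ltac:(simpl; lra)).
  pose proof (sp 0%nat) as s7. pose proof (sp 1%nat) as s8. pose proof (sp 2%nat) as s9. simpl Nat.add in s7, s8, s9.
  apply iso_ext. intros p; split.
  - intros (z & d & [-> Hz] & t & Ht & ->). apply chord_in_sk; [|exact Ht].
    destruct z as [|[|[|[|[|[|[|[|]]]]]]]]; try lia; simpl Nat.add.
    + rewrite H1. exists 1%nat, 3%nat; split; [simpl; tauto | left; auto].
    + rewrite H2. exists 2%nat, 4%nat; split; [simpl; tauto | left; auto].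
    + rewrite H3. exists 3%nat, 5%nat; split; [simpl; tauto | left; auto].
    + rewrite H4. exists 4%nat, 6%nat; split; [simpl; tauto | left; auto].
    + rewrite H5. exists 0%nat, 5%nat; split; [simpl; tauto | right; auto].
    + rewrite H6. exists 1%nat, 6%nat; split; [simpl; tauto | right; auto].
    + rewrite H7. exists 0%nat, 2%nat; split; [simpl; tauto | left; auto].
  - assert (put : forall z i j c t, (1 <= z <= 7)%nat -> height 7 z = c -> I01 t ->
      (same_angle (angle 7 i) (angle 7 z) /\ same_angle (angle 7 j) (angle 7 (z + 2)) \/
       same_angle (angle 7 j) (angle 7 z) /\ same_angle (angle 7 i) (angle 7 (z + 2))) ->
      edge_curve 7 DE (arc (angle 7 i) (angle 7 j) c t)).
    { intros z i j c t Hz Hc Ht [[A B]|[A B]]; exists z, 2%nat; (split; [split; auto|]); rewrite Hc.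
      - exists t; split; [exact Ht | apply arc_same; assumption].
      - exists (1 - t); split; [unfold I01 in *; lra|]. rewrite (arc_swap (angle 7 i)). apply arc_same; assumption. }
    pose proof (same_angle_sym _ _ s7). pose proof (same_angle_sym _ _ s8). pose proof (same_angle_sym _ _ s9).
    intros (i & j & c & Hin & t & Ht & ->). simpl in Hin.
    repeat (destruct Hin as [Hin|Hin]; [injection Hin; intros; subst; clear Hin|]); try destruct Hin.
    + apply (put 7%nat); auto; lia.
    + apply (put 1%nat); auto; lia.
    + apply (put 2%nat); auto; lia.
    + apply (put 3%nat); auto; lia.
    + apply (put 4%nat); auto; lia.
    + apply (put 5%nat); auto; lia.
    + apply (put 6%nat); auto; lia.
Qed.

(** * The two halves *)

(** A chord without crossings may take any height. This prepares [chord_knot_drop], which merges two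
    chords only at equal height. *)
Lemma chord_knot_change_height th lo hi i0 j0 c c' L : valid th lo hi ->
  (lo <= i0 < j0)%nat -> (j0 <= hi)%nat ->
  (forall i j h, In (i, j, h) L -> (lo <= i < j /\ j <= hi)%nat /\ (i <> i0 \/ j <> j0) /\
      ~ crossing i0 j0 i j /\ ~ crossing i j i0 j0) ->
  (forall i j h k l h', In (i, j, h) L -> In (k, l, h') L ->
     (i = k -> j = l -> h = h') /\ (crossing i j k l -> h <> h')) ->
  iso (chord_knot th ((i0, j0, c) :: L)) (chord_knot th ((i0, j0, c') :: L)).
Proof.
  intros V H0 H0' HL HP.
  pose (L2 := (i0, j0, (c, c')) :: map (fun x => (fst x, (snd x, snd x))) L).
  assert (E1 : map (fun x : nat * nat * (R * R) => (fst x, fst (snd x))) L2 = (i0, j0, c) :: L).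
  { unfold L2. simpl. f_equal. rewrite map_map. simpl. rewrite <- (map_id L) at 2.
    apply map_ext. intros []; reflexivity. }
  assert (E2 : map (fun x : nat * nat * (R * R) => (fst x, snd (snd x))) L2 = (i0, j0, c') :: L).
  { unfold L2. simpl. f_equal. rewrite map_map. simpl. rewrite <- (map_id L) at 2.
    apply map_ext. intros []; reflexivity. }
  rewrite <- E1, <- E2.
  assert (In2 : forall i j h, In (i, j, h) L2 -> (i = i0 /\ j = j0 /\ h = (c, c')) \/
     exists a, In (i, j, a) L /\ h = (a, a)).
  { intros i j h [Hin|Hin]; [injection Hin; intros; subst; auto|]. right.
    apply in_map_iff in Hin as ([[i' j'] a] & E & Hin). injection E; intros; subst. exists a; auto. }
  apply (chord_knot_iso th th lo hi); auto.
  - intros i j h Hin. destruct (In2 i j h Hin) as [(-> & -> & ->)|(a & Ha & ->)]; [auto|].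
    apply (HL _ _ _ Ha).
  - intros i j h k l h' Hin Hin'.
    destruct (In2 i j h Hin) as [(-> & -> & ->)|(a & Ha & ->)];
    destruct (In2 k l h' Hin') as [(-> & -> & ->)|(a' & Ha' & ->)].
    + split; [auto|]. unfold crossing; lia.
    + destruct (HL _ _ _ Ha') as (_ & D & X & _). split; [lia | tauto].
    + destruct (HL _ _ _ Ha) as (_ & D & _ & X). split; [lia | tauto].
    + destruct (HP _ _ _ _ _ _ Ha Ha') as [D X]. split.
      * intros Ei Ej. rewrite (D Ei Ej); reflexivity.
      * intros C. simpl. apply Rlt_0_sqr. intros E. apply (X C). lra.
Qed.

(** The edges {z, z + d} of the path 14, 15, ..., n, 2, 4, 6, 1, 3, 5, 7; [right_edge] gives those
    of the path 7, 9, 11, 13, 8, 10, 12, 14. *)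
Definition left_edge (n z d : nat) : Prop :=
  (d = 2 /\ (1 <= z <= 5 \/ z = n) \/ d = 5 /\ z = 1 \/ d = 1 /\ 14 <= z < n)%nat.
Definition right_edge (z d : nat) : Prop :=
  (d = 2 /\ 7 <= z <= 12 \/ d = 5 /\ z = 8)%nat.

Definition core (n : nat) : list (nat * nat * R) :=
  [(n + 1, n + 3, height n 1); (n + 2, n + 4, height n 2); (n + 3, n + 5, height n 3);
   (n + 4, n + 6, height n 4); (7, n + 5, height n 5); (n + 1, n + 6, height n 1)]%nat.

Definition next (n j : nat) : nat := if (j <? n)%nat then (j + 1)%nat else (n + 2)%nat.

(* The boundary path B, B + 1, ..., n, 2, where vertices 1..6 carry the labels n + 1..n + 6. *)
Definition tail (n B : nat) : list (nat * nat * R) :=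
  map (fun j => (j, next n j, height n j)) (seq B (n + 1 - B)).

(** The chord from 7 to 14 closes the half. At height 0 it is a straight segment in the plane of the
    circle. *)
Definition left_list (n : nat) : list (nat * nat * R) := (7%nat, 14%nat, 0) :: tail n 14 ++ core n.

(** Here the labels begin at 14, so the vertices 7 to 13 are called n + 7 to n + 13, and the closing
    chord is (14, n + 7). *)
Definition right_list (n : nat) : list (nat * nat * R) :=
  [(14, n + 7, 0%R); (n + 7, n + 9, height n 7); (n + 8, n + 10, height n 8); (n + 9, n + 11, height n 9);
   (n + 10, n + 12, height n 10); (n + 11, n + 13, height n 11); (14, n + 12, height n 12);
   (n + 8, n + 13, height n 8)]%nat.

Lemma in_tail n B i j h : In (i, j, h) (tail n B) <->
  (B <= i <= n /\ j = next n i)%nat /\ h = height n i.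
Proof.
  unfold tail. rewrite in_map_iff. split.
  - intros (x & E & Hx). injection E; intros; subst. apply in_seq in Hx. split; [split|]; auto; lia.
  - intros [[Hi ->] ->]. exists i; split; [reflexivity|]. apply in_seq. lia.
Qed.

Ltac in_cases H :=
  simpl in H; repeat (destruct H as [H|H]; [injection H; intros; subst; clear H|]); try (destruct H).

Lemma left_heights n : (14 <= n)%nat ->
  height n n < height n 5 /\ height n 5 < height n 4 /\ height n 4 < height n 3 /\
  height n 3 < height n 2 /\ height n 2 < height n 1.
Proof.
  intros Hn. pose proof (nsheets_spec n).
  assert (S : forall x, (x <= 7)%nat -> sheet_of n x = x).
  { intros x Hx. pose proof (sheet_of_spec n x). lia. }
  pose proof (sheet_of_spec n n).
  repeat split; apply height_lt; try lia; rewrite ?S by lia; lia.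
Qed.

Lemma left_pairs n B : (14 <= n)%nat -> (14 <= B)%nat ->
  forall i j h k l h', In (i, j, h) (tail n B ++ core n) -> In (k, l, h') (tail n B ++ core n) ->
     (i = k -> j = l -> h = h') /\ (crossing i j k l -> h <> h').
Proof.
  intros Hn HB i j h k l h' H1 H2. pose proof (left_heights n Hn) as HT. unfold crossing.
  apply in_app_or in H1, H2. rewrite in_tail in H1, H2.
  assert (NX : forall j, (j < n /\ next n j = j + 1 \/ n <= j /\ next n j = n + 2)%nat).
  { intros x. unfold next. destruct (Nat.ltb_spec x n); lia. }
  destruct H1 as [[[H1 ->] ->]|H1]; destruct H2 as [[[H2 ->] ->]|H2].
  - split; [intros ->; reflexivity|]. pose proof (NX i); pose proof (NX k). lia.
  - pose proof (NX i) as X. split.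
    + in_cases H2; lia.
    (* Among the boundary edges only the last one, from n to n + 2, passes over a vertex and crosses
       edges of [core]. *)
    + in_cases H2; intros C; try lia; replace i with n in * by lia; lra.
  - pose proof (NX k) as X. split; in_cases H1; lia.
  - in_cases H1; in_cases H2; (split; [first [reflexivity | lia] | first [lia | intros; lra]]).
Qed.

Lemma left_range n B : (14 <= B <= n)%nat ->
  forall i j h, In (i, j, h) (tail n B ++ core n) ->
  (7 <= i < j /\ j <= n + 6)%nat /\ (i = 7%nat /\ j = (n + 5)%nat \/ (B <= i)%nat).
Proof.
  intros HB i j h H. apply in_app_or in H. rewrite in_tail in H.
  destruct H as [[[H ->] ->]|H].
  - unfold next. destruct (Nat.ltb_spec i n); lia.
  - in_cases H; lia.
Qed.

Lemma tail_cons n B : (B <= n)%nat -> tail n B = (B, next n B, height n B) :: tail n (S B).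
Proof.
  intros H. unfold tail. replace (n + 1 - B)%nat with (S (n + 1 - S B)) by lia. reflexivity.
Qed.

(** The chord from 7 absorbs the boundary path vertex by vertex; it crosses nothing, so it can first
    be given the height of the next edge. Only when n is dropped is there a vertex, n + 1, between
    it and its successor n + 2; the two chords from there lie higher. *)
Lemma left_drop n k : forall B c, n = (B + k)%nat -> (14 <= B)%nat ->
  iso (chord_knot (angle n) ((7%nat, B, c) :: tail n B ++ core n))
      (chord_knot (angle n) ((7%nat, (n + 2)%nat, height n n) :: core n)).
Proof.
  induction k; intros B c Hk HB.
  all: eapply iso_trans;
    [apply (chord_knot_change_height _ 7 (n + 6) 7 B c (height n B)); [apply valid_angle; lia | lia | lia | | ];
     [intros i j h Hin; destruct (left_range n B ltac:(lia) i j h Hin); unfold crossing; lia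
     | apply left_pairs; lia] |].
  all: rewrite tail_cons by lia; simpl app.
  all: eapply iso_trans;
    [apply (chord_knot_drop _ 7 (n + 6) 7 B (next n B)); [apply valid_angle; lia | lia | |];
      unfold next; destruct (Nat.ltb_spec B n); try lia |].
  - intros x y h Hin. apply in_app_or in Hin as [Hin|Hin]; [rewrite in_tail in Hin; lia|].
    pose proof (left_heights n ltac:(lia)). replace B with n in * by lia. unfold drop_ok.
    in_cases Hin; (split; [lia|]).
    + do 3 right. split; [lia | lra].
    + right; right; left. lia.
    + left; lia.
    + left; lia.
    + right; left; lia.
    + do 3 right. split; [lia | lra].
  - replace B with n in * by lia. unfold next. rewrite Nat.ltb_irrefl.
    unfold tail. replace (n + 1 - S n)%nat with 0%nat by lia. apply iso_ext; reflexivity.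
  - intros x y h Hin. unfold drop_ok.
    apply in_app_or in Hin as [Hin|Hin].
    + rewrite in_tail in Hin. destruct Hin as [[Hx ->] ->]. unfold next.
      destruct (Nat.ltb_spec x n); lia.
    + in_cases Hin; lia.
  - unfold next. destruct (Nat.ltb_spec B n); [|lia].
    replace (B + 1)%nat with (S B) by lia. apply IHk; lia.
Qed.

Lemma left_half n : (14 <= n)%nat -> iso (chord_knot (angle n) (left_list n)) trefoil.
Proof.
  intros Hn. eapply iso_trans; [apply (left_drop n (n - 14)); lia|].
  pose (th := fun i => if (i =? 0)%nat then angle n 7 else angle n (n + i)).
  assert (V : valid th 0 6).
  { intros i j Hij Hj. unfold th. destruct (Nat.eqb_spec i 0), (Nat.eqb_spec j 0); try lia;
      apply (valid_angle n 7 (n + 6)); lia. }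
  pose (l := [height n n; height n 1; height n 2; height n 3; height n 4; height n 5; height n 1]).
  assert (Q : hequiv l k7_heights).
  (* The heights fall from vertex 1 to vertex 5 and the chord that replaces the path lies lowest, so
     the crossings of the second kind are at the positions 0 and 5. *)
  { apply (hequiv_trans l [2; 4; 3; 2; 1; 0; 3]); [|apply hequiv_sym, hequiv_05].
      pose proof (left_heights n Hn). apply hequiv_crossings. intros k Hk.
      destruct k as [|[|[|[|[|[|[|]]]]]]]; try lia; simpl; lra. }
  eapply iso_trans; [|eapply iso_trans; [apply (Q th th V V) | apply (trefoil_iso th V)]].
  apply iso_ext; intros p; split; intros (i & j & c & Hin & t & Ht & ->).
  - apply chord_in_sk; [|exact Ht]. unfold core in Hin.
    pose proof same_angle_refl.
    in_cases Hin.
    + exists 0%nat, 2%nat; split; [simpl; tauto | left; auto].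
    + exists 1%nat, 3%nat; split; [simpl; tauto | left; auto].
    + exists 2%nat, 4%nat; split; [simpl; tauto | left; auto].
    + exists 3%nat, 5%nat; split; [simpl; tauto | left; auto].
    + exists 4%nat, 6%nat; split; [simpl; tauto | left; auto].
    + exists 0%nat, 5%nat; split; [simpl; tauto | left; auto].
    + exists 1%nat, 6%nat; split; [simpl; tauto | left; auto].
  - unfold hept, l in Hin. in_cases Hin.
    1: exists 7%nat, (n + 2)%nat. 2: exists (n + 1)%nat, (n + 3)%nat. 3: exists (n + 2)%nat, (n + 4)%nat.
    4: exists (n + 3)%nat, (n + 5)%nat. 5: exists (n + 4)%nat, (n + 6)%nat.
    6: exists 7%nat, (n + 5)%nat. 7: exists (n + 1)%nat, (n + 6)%nat.
    all: eexists; split; [simpl; tauto | exists t; split; [exact Ht | reflexivity]].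
Qed.

(** The sheets go down along the vertices 7 to 12 except where the numbering starts again after
    [nsheets n]. The jump lies behind one of 7, ..., 11, or does not occur among these vertices;
    each of the six cases has its own pair of positions. *)
Lemma right_crossings n : (14 <= n)%nat ->
  hequiv k7_heights [height n 7; height n 8; height n 9; height n 10; height n 11; height n 12; height n 8].
Proof.
  intros Hn. pose proof (nsheets_spec n) as N.
  assert (H : forall x y, (x <= 14)%nat -> (y <= 14)%nat -> (1 <= x)%nat -> (1 <= y)%nat ->
     (sheet_of n x < sheet_of n y)%nat -> height n y < height n x).
  { intros x y Hx Hy Hx1 Hy1. apply height_lt; lia. }
  assert (S : forall x, (x <= nsheets n /\ sheet_of n x = x \/ nsheets n < x /\ sheet_of n x = x - nsheets n)%nat)
    by apply sheet_of_spec.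
  assert (C : (nsheets n = 7 \/ nsheets n = 8 \/ nsheets n = 9 \/ nsheets n = 10 \/ nsheets n = 11 \/ 12 <= nsheets n)%nat) by lia.
  pose proof (S 7%nat) as S7; pose proof (S 8%nat) as S8; pose proof (S 9%nat) as S9;
  pose proof (S 10%nat) as S10; pose proof (S 11%nat) as S11; pose proof (S 12%nat) as S12. clear S.
  destruct C as [C|[C|[C|[C|[C|C]]]]].
  - apply (hequiv_trans _ _ _ hequiv_05), hequiv_crossings.
    pose proof (H 8 9 ltac:(lia) ltac:(lia) ltac:(lia) ltac:(lia) ltac:(lia))%nat.
    pose proof (H 9 10 ltac:(lia) ltac:(lia) ltac:(lia) ltac:(lia) ltac:(lia))%nat.
    pose proof (H 10 11 ltac:(lia) ltac:(lia) ltac:(lia) ltac:(lia) ltac:(lia))%nat.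
    pose proof (H 11 12 ltac:(lia) ltac:(lia) ltac:(lia) ltac:(lia) ltac:(lia))%nat.
    pose proof (H 12 7 ltac:(lia) ltac:(lia) ltac:(lia) ltac:(lia) ltac:(lia))%nat.
    intros k Hk. destruct k as [|[|[|[|[|[|[|]]]]]]]; try lia; simpl; lra.
  - apply (hequiv_trans _ _ _ hequiv_16), hequiv_crossings.
    pose proof (H 9 10 ltac:(lia) ltac:(lia) ltac:(lia) ltac:(lia) ltac:(lia))%nat.
    pose proof (H 10 11 ltac:(lia) ltac:(lia) ltac:(lia) ltac:(lia) ltac:(lia))%nat.
    pose proof (H 11 12 ltac:(lia) ltac:(lia) ltac:(lia) ltac:(lia) ltac:(lia))%nat.
    pose proof (H 12 7 ltac:(lia) ltac:(lia) ltac:(lia) ltac:(lia) ltac:(lia))%nat.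
    pose proof (H 7 8 ltac:(lia) ltac:(lia) ltac:(lia) ltac:(lia) ltac:(lia))%nat.
    intros k Hk. destruct k as [|[|[|[|[|[|[|]]]]]]]; try lia; simpl; lra.
  - apply (hequiv_trans _ _ _ hequiv_26), hequiv_crossings.
    pose proof (H 10 11 ltac:(lia) ltac:(lia) ltac:(lia) ltac:(lia) ltac:(lia))%nat.
    pose proof (H 11 12 ltac:(lia) ltac:(lia) ltac:(lia) ltac:(lia) ltac:(lia))%nat.
    pose proof (H 12 7 ltac:(lia) ltac:(lia) ltac:(lia) ltac:(lia) ltac:(lia))%nat.
    pose proof (H 7 8 ltac:(lia) ltac:(lia) ltac:(lia) ltac:(lia) ltac:(lia))%nat.
    pose proof (H 8 9 ltac:(lia) ltac:(lia) ltac:(lia) ltac:(lia) ltac:(lia))%nat.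
    intros k Hk. destruct k as [|[|[|[|[|[|[|]]]]]]]; try lia; simpl; lra.
  - apply (hequiv_trans _ _ _ hequiv_36), hequiv_crossings.
    pose proof (H 11 12 ltac:(lia) ltac:(lia) ltac:(lia) ltac:(lia) ltac:(lia))%nat.
    pose proof (H 12 7 ltac:(lia) ltac:(lia) ltac:(lia) ltac:(lia) ltac:(lia))%nat.
    pose proof (H 7 8 ltac:(lia) ltac:(lia) ltac:(lia) ltac:(lia) ltac:(lia))%nat.
    pose proof (H 8 9 ltac:(lia) ltac:(lia) ltac:(lia) ltac:(lia) ltac:(lia))%nat.
    pose proof (H 9 10 ltac:(lia) ltac:(lia) ltac:(lia) ltac:(lia) ltac:(lia))%nat.
    intros k Hk. destruct k as [|[|[|[|[|[|[|]]]]]]]; try lia; simpl; lra.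
  - apply (hequiv_trans _ _ _ hequiv_46), hequiv_crossings.
    pose proof (H 12 7 ltac:(lia) ltac:(lia) ltac:(lia) ltac:(lia) ltac:(lia))%nat.
    pose proof (H 7 8 ltac:(lia) ltac:(lia) ltac:(lia) ltac:(lia) ltac:(lia))%nat.
    pose proof (H 8 9 ltac:(lia) ltac:(lia) ltac:(lia) ltac:(lia) ltac:(lia))%nat.
    pose proof (H 9 10 ltac:(lia) ltac:(lia) ltac:(lia) ltac:(lia) ltac:(lia))%nat.
    pose proof (H 10 11 ltac:(lia) ltac:(lia) ltac:(lia) ltac:(lia) ltac:(lia))%nat.
    intros k Hk. destruct k as [|[|[|[|[|[|[|]]]]]]]; try lia; simpl; lra.
  - apply (hequiv_trans _ _ _ hequiv_56), hequiv_crossings.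
    pose proof (H 7 8 ltac:(lia) ltac:(lia) ltac:(lia) ltac:(lia) ltac:(lia))%nat.
    pose proof (H 8 9 ltac:(lia) ltac:(lia) ltac:(lia) ltac:(lia) ltac:(lia))%nat.
    pose proof (H 9 10 ltac:(lia) ltac:(lia) ltac:(lia) ltac:(lia) ltac:(lia))%nat.
    pose proof (H 10 11 ltac:(lia) ltac:(lia) ltac:(lia) ltac:(lia) ltac:(lia))%nat.
    pose proof (H 11 12 ltac:(lia) ltac:(lia) ltac:(lia) ltac:(lia) ltac:(lia))%nat.
    intros k Hk. destruct k as [|[|[|[|[|[|[|]]]]]]]; try lia; simpl; lra.
Qed.

Lemma right_heights n : (14 <= n)%nat ->
  height n 7 <> height n 8 /\ height n 8 <> height n 9 /\ height n 9 <> height n 10 /\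
  height n 10 <> height n 11 /\ height n 11 <> height n 12 /\ height n 12 <> height n 8.
Proof.
  intros Hn. pose proof (nsheets_spec n) as N.
  assert (D : forall x y, (1 <= x <= n)%nat -> (1 <= y <= n)%nat -> (sheet_of n x <> sheet_of n y)%nat ->
     height n x <> height n y).
  { intros x y Hx Hy E. destruct (Nat.lt_gt_cases (sheet_of n x) (sheet_of n y)) as [[L|L] _]; auto.
    - pose proof (height_lt n x y Hx Hy L). lra.
    - pose proof (height_lt n y x Hy Hx L). lra. }
  repeat split; apply D; try lia; unfold sheet_of;
    repeat match goal with |- context [(?a <=? ?b)%nat] => destruct (Nat.leb_spec a b) end; lia.
Qed.

(** The only vertex to drop is 7: the closing chord and the edge {7, 9} become one chord. The vertex
    8 lies between 7 and 9, so the heights of its two chords must differ from that of {7, 9}. *)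
Lemma right_half n : (14 <= n)%nat -> iso (chord_knot (angle n) (right_list n)) trefoil.
Proof.
  intros Hn. pose proof (right_heights n Hn) as HT.
  assert (V0 : valid (angle n) 14 (n + 13)) by (apply valid_angle; lia).
  eapply iso_trans; [apply (chord_knot_change_height _ 14 (n + 13) 14 (n + 7) 0 (height n 7)); [exact V0 | lia | lia | | ]|].
  { intros i j h Hin. unfold crossing. in_cases Hin; lia. }
  { intros i j h k l h' Hi Hk. unfold crossing. in_cases Hi; in_cases Hk;
     (split; [first [reflexivity | lia] | first [lia | intros; lra]]). }
  eapply iso_trans; [apply (chord_knot_drop _ 14 (n + 13) 14 (n + 7) (n + 9)); [exact V0 | lia | lia |]|].
  { intros i j h Hin. unfold drop_ok. in_cases Hin; (split; [lia|]).
    - do 3 right. split; [lia | lra].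
    - right; right; left; lia.
    - left; lia.
    - left; lia.
    - right; left; lia.
    - do 3 right. split; [lia | lra]. }
  pose (th := fun i => if (i =? 0)%nat then angle n 14 else angle n (n + 7 + i)).
  assert (V : valid th 0 6).
  { intros i j Hij Hj. unfold th. destruct (Nat.eqb_spec i 0), (Nat.eqb_spec j 0); try lia;
      apply V0; lia. }
  pose (l := [height n 7; height n 8; height n 9; height n 10; height n 11; height n 12; height n 8]).
  assert (Q : hequiv l k7_heights).
  { apply hequiv_sym, right_crossings, Hn. }
  eapply iso_trans; [|eapply iso_trans; [apply (Q th th V V) | apply (trefoil_iso th V)]].
  pose proof same_angle_refl.
  assert (E : forall k, (k <> 0)%nat -> same_angle (angle n (n + (7 + k))) (th k)).
  { intros k Hk. unfold th. destruct (Nat.eqb_spec k 0); [lia|]. rewrite Nat.add_assoc. auto. }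
  assert (E' : forall k, (k <> 0)%nat -> same_angle (th k) (angle n (n + (7 + k)))).
  { intros; apply same_angle_sym; auto. }
  assert (Z : same_angle (angle n 14) (th 0%nat)) by apply same_angle_refl.
  assert (Z' : same_angle (th 0%nat) (angle n 14)) by apply same_angle_refl.
  apply chord_knot_eq; intros i j c Hin.
  - in_cases Hin.
    1: exists 0%nat, 2%nat. 2: exists 1%nat, 3%nat. 3: exists 2%nat, 4%nat. 4: exists 3%nat, 5%nat.
    5: exists 4%nat, 6%nat. 6: exists 0%nat, 5%nat. 7: exists 1%nat, 6%nat.
    all: split; [simpl; tauto | left; split; first [exact Z | apply (E 1%nat); lia | apply (E 2%nat); lia
      | apply (E 3%nat); lia | apply (E 4%nat); lia | apply (E 5%nat); lia | apply (E 6%nat); lia]].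
  - unfold hept, l in Hin. in_cases Hin.
    1: exists 14%nat, (n + 9)%nat. 2: exists (n + 8)%nat, (n + 10)%nat. 3: exists (n + 9)%nat, (n + 11)%nat.
    4: exists (n + 10)%nat, (n + 12)%nat. 5: exists (n + 11)%nat, (n + 13)%nat.
    6: exists 14%nat, (n + 12)%nat. 7: exists (n + 8)%nat, (n + 13)%nat.
    all: split; [simpl; tauto | left; split; first [exact Z' | apply E'; lia]].
Qed.

(** * Splitting the cycle along a vertical plane *)

Definition rigid (a d : R) (p : pt) : pt :=
  match p with (x, y, z) => (cos a * x + sin a * y - d, cos a * y - sin a * x, z) end.

Definition moved (a d : R) (A : pt -> Prop) (q : pt) : Prop := exists p, A p /\ q = rigid a d p.

(** Angle and shift grow linearly with time. The shift cancels in differences, and the rotation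
    changes them at a rate proportional to |a|; the factor 4 appears because the maximum norm is not
    invariant under rotation. *)
Lemma iso_moved a d A : iso A (moved a d A).
Proof.
  pose (f := fun u (p : pt) => rigid (u * a) (u * d) p).
  eapply iso_trans; [|eapply iso_trans; [apply (iso_path pt A f (1 / (4 * (Rabs a + 1))))|]].
  - apply iso_ext. intros p; unfold image, f, rigid. rewrite !Rmult_0_l, cos_0, sin_0.
    assert (E : forall x y z : R, (1 * x + 0 * y - 0, 1 * y - 0 * x, z) = (x, y, z)).
    { intros; f_equal; f_equal; ring. }
    split.
    + intros Ap. exists p; split; [exact Ap|]. destruct p as [[x y] z]. rewrite E; reflexivity.
    + intros ([[x y] z] & Ap & ->). rewrite E; exact Ap.
  - pose proof (Rabs_pos a). apply Rdiv_lt_0_compat; lra.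
  - intros u u' [[x y] z] [[x' y'] z'] _ _ _ _. unfold f, rigid. rewrite dist3_nrm. simpl vsub.
    set (X := x - x'). set (Y := y - y'). set (Z := z - z').
    replace (cos (u' * a) * x + sin (u' * a) * y - u' * d - (cos (u' * a) * x' + sin (u' * a) * y' - u' * d) -
      (cos (u * a) * x + sin (u * a) * y - u * d - (cos (u * a) * x' + sin (u * a) * y' - u * d)))
      with ((cos (u' * a) - cos (u * a)) * X + (sin (u' * a) - sin (u * a)) * Y) by (unfold X, Y; ring).
    replace (cos (u' * a) * y - sin (u' * a) * x - (cos (u' * a) * y' - sin (u' * a) * x') -
      (cos (u * a) * y - sin (u * a) * x - (cos (u * a) * y' - sin (u * a) * x')))
      with ((cos (u' * a) - cos (u * a)) * Y - (sin (u' * a) - sin (u * a)) * X) by (unfold X, Y; ring).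
    replace (Z - Z) with 0 by ring.
    replace (cos (u * a) * x + sin (u * a) * y - u * d - (cos (u * a) * x' + sin (u * a) * y' - u * d))
      with (cos (u * a) * X + sin (u * a) * Y) by (unfold X, Y; ring).
    replace (cos (u * a) * y - sin (u * a) * x - (cos (u * a) * y' - sin (u * a) * x'))
      with (cos (u * a) * Y - sin (u * a) * X) by (unfold X, Y; ring).
    destruct (sin_cos_lipschitz (u' * a) (u * a)) as [Ls Lc].
    replace (u' * a - u * a) with ((u' - u) * a) in Ls, Lc by ring. rewrite Rabs_mult in Ls, Lc.
    pose proof (SIN_bound (u * a)) as Sb. pose proof (COS_bound (u * a)) as Cb.
    apply Rabs_le in Sb, Cb.
    pose proof (sin2_cos2 (u * a)) as SC. unfold Rsqr in SC.
    set (S := sin (u * a)) in *. set (C := cos (u * a)) in *.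
    destruct (nrm_bounds (C * X + S * Y) (C * Y - S * X) Z) as (n1 & n2 & n3).
    set (n := nrm (C * X + S * Y, C * Y - S * X, Z)) in *.
    assert (BX : Rabs X <= 2 * n).
    { replace X with (C * (C * X + S * Y) - S * (C * Y - S * X)).
      2:{ transitivity (X * (S * S + C * C)); [ring | rewrite SC; ring]. }
      replace (2 * n) with (1 * n + 1 * n) by ring.
      apply Rabs_minus_le; apply Rabs_le_mult; assumption. }
    assert (BY : Rabs Y <= 2 * n).
    { replace Y with (S * (C * X + S * Y) + C * (C * Y - S * X)).
      2:{ transitivity (Y * (S * S + C * C)); [ring | rewrite SC; ring]. }
      replace (2 * n) with (1 * n + 1 * n) by ring.
      apply Rabs_plus_le; apply Rabs_le_mult; assumption. }
    pose proof (Rabs_pos a). pose proof (Rabs_pos (u' - u)).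
    assert (N0 : 0 <= n) by apply nrm_nonneg.
    set (k := Rabs (u' - u)) in *. set (b := Rabs a) in *.
    apply Rmult_le_reg_l with (4 * (b + 1)); [lra|].
    rewrite <- Rmult_assoc. replace (4 * (b + 1) * (1 / (4 * (b + 1)))) with 1 by (field; lra).
    rewrite Rmult_1_l. apply Rle_trans with (4 * (k * b * n)).
    2:{ assert (0 <= k * n) by (apply Rmult_le_pos; assumption). nra. }
    apply nrm_le. replace (4 * (k * b * n)) with (k * b * (2 * n) + k * b * (2 * n)) by ring.
    repeat split.
    + apply Rabs_plus_le; apply Rabs_le_mult; assumption.
    + apply Rabs_minus_le; apply Rabs_le_mult; assumption.
    + rewrite Rabs_R0. assert (0 <= k * b * (2 * n)) by (repeat apply Rmult_le_pos; lra). lra.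
  - apply iso_ext. intros p; unfold image, f, moved. rewrite !Rmult_1_l. reflexivity.
Qed.

Lemma rigid_arc a d al be c t :
  rigid a d (arc al be c t) =
  ((1 - t) * (cos (al - a) - d) + t * (cos (be - a) - d),
   (1 - t) * sin (al - a) + t * sin (be - a), snd (arc al be c t)).
Proof.
  unfold rigid, arc; simpl. rewrite !cos_minus, !sin_minus. f_equal. f_equal; ring.
Qed.

(** The direction normal to the line through the vertices 7 and 14; [split_dist] is the distance of
    that line from the centre, and [side] the first coordinate of a vertex once the line has been
    moved to x = 0. *)
Definition split_angle (n : nat) : R := (angle n 7 + angle n 14) / 2.
Definition split_dist (n : nat) : R := cos ((angle n 14 - angle n 7) / 2).
Definition side (n i : nat) : R := cos (angle n i - split_angle n) - split_dist n.

(** In units of e = PI / n the vertex i lies at the angle (2i - 21)e from the normal, and the line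
    cuts the circle at plus and minus 7e, where 14e <= PI. The cosine decides on which side a vertex
    lies. *)
Lemma side_signs n : (14 <= n)%nat ->
  side n 7 = 0 /\ side n 14 = 0 /\
  (forall i, (8 <= i <= 13)%nat -> 0 < side n i) /\
  (forall i, (1 <= i <= 6 \/ 15 <= i <= n + 6)%nat -> side n i < 0) /\
  0 < sin ((angle n 14 - angle n 7) / 2).
Proof.
  intros Hn. pose proof PI_RGT_0 as P.
  assert (N0 : 14 <= INR n) by (apply le_INR in Hn; simpl in Hn; lra).
  set (e := PI / INR n).
  assert (e0 : 0 < e) by (apply Rdiv_lt_0_compat; lra).
  assert (en : INR n * e = PI) by (unfold e; field; lra).
  assert (e14 : 14 * e <= PI) by nra.
  assert (A : forall i, angle n i = 2 * INR i * e) by (intros; unfold angle, e; field; lra).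
  assert (D : (angle n 14 - angle n 7) / 2 = 7 * e).
  { rewrite !A. simpl INR. field. }
  assert (B : forall i, side n i = cos ((2 * INR i - 21) * e) - cos (7 * e)).
  { intros i. unfold side, split_dist. rewrite D. f_equal. f_equal. unfold split_angle. rewrite !A.
    simpl INR. field. }
  assert (cp : forall x, - (7 * e) < x < 7 * e -> cos (7 * e) < cos x).
  { intros x Hx. destruct (Rle_dec 0 x).
    - apply cos_decreasing_1; lra.
    - rewrite <- (cos_neg x). apply cos_decreasing_1; lra. }
  assert (cn : forall x, 7 * e < x < 2 * PI - 7 * e -> cos x < cos (7 * e)).
  { intros x Hx. destruct (Rle_dec x PI).
    - apply cos_decreasing_1; lra.
    - replace (cos x) with (cos (2 * PI - x)).
      + apply cos_decreasing_1; lra.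
      + rewrite cos_minus, cos_2PI, sin_2PI. ring. }
  repeat split.
  - rewrite B. replace ((2 * INR 7 - 21) * e) with (- (7 * e)) by (simpl INR; ring).
    rewrite cos_neg. ring.
  - rewrite B. replace ((2 * INR 14 - 21) * e) with (7 * e) by (simpl INR; ring). ring.
  - intros i [H1 H2]. apply le_INR in H1, H2. simpl INR in H1 at 1. simpl in H1, H2.
    rewrite B. pose proof (cp ((2 * INR i - 21) * e)) as K. nra.
  - intros i [[H1 H2]|[H1 H2]]; apply le_INR in H1, H2; rewrite B.
    + rewrite <- cos_neg. pose proof (cn (- ((2 * INR i - 21) * e))) as K. simpl in H1, H2. nra.
    + rewrite plus_INR in H2. pose proof (cn ((2 * INR i - 21) * e)) as K.
      simpl in H1, H2. nra.
  - rewrite D. apply sin_gt_0; lra.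
Qed.

Lemma consec_seq a k y r :
  consec (seq a (S k) ++ y :: r) = map (fun i => (i, S i)) (seq a k) ++ ((a + k)%nat, y) :: consec (y :: r).
Proof.
  revert a; induction k; intros a.
  - rewrite Nat.add_0_r. reflexivity.
  - transitivity ((a, S a) :: consec (seq (S a) (S k) ++ y :: r)); [reflexivity|].
    rewrite IHk. replace (S a + k)%nat with (a + S k)%nat by lia. reflexivity.
Qed.

Lemma cycle9_pairs k : cycle_pairs (cycle9 (14 + k)) =
  [(1, 3); (3, 5); (5, 7); (7, 9); (9, 11); (11, 13); (13, 8); (8, 10); (10, 12); (12, 14)]%nat ++
  map (fun i => (i, S i)) (seq 14 k) ++ [(14 + k, 2); (2, 4); (4, 6); (6, 1)]%nat.
Proof.
  unfold cycle9. replace (14 + k - 13)%nat with (S k) by lia.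
  transitivity ([(1, 3); (3, 5); (5, 7); (7, 9); (9, 11); (11, 13); (13, 8); (8, 10); (10, 12); (12, 14)]%nat ++
    consec (seq 14 (S k) ++ [2; 4; 6; 1])%nat).
  - change (consec (([1; 3; 5; 7; 9; 11; 13; 8; 10; 12] ++ seq 14 (S k) ++ [2; 4; 6]) ++ [1])%nat =
      [(1, 3); (3, 5); (5, 7); (7, 9); (9, 11); (11, 13); (13, 8); (8, 10); (10, 12); (12, 14)]%nat ++
      consec (seq 14 (S k) ++ [2; 4; 6; 1])%nat).
    rewrite <- !app_assoc. reflexivity.
  - rewrite consec_seq. reflexivity.
Qed.

Lemma cycle9_edges n : (14 <= n)%nat -> forall p,
  cycleKnot n (cycle9 n) p <-> edge_curve n (fun z d => left_edge n z d \/ right_edge z d) p.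
Proof.
  intros Hn. assert (E : exists k, n = (14 + k)%nat) by (exists (n - 14)%nat; lia).
  destruct E as [k ->].
  apply cycleKnot_edges.
  - unfold left_edge, right_edge. intros z d. lia.
  - intros x y Hin. rewrite cycle9_pairs in Hin. unfold left_edge, right_edge.
    pose proof (fun r => resid_spec (14 + k) r) as RS.
    apply in_app_or in Hin as [Hin|Hin]; [|apply in_app_or in Hin as [Hin|Hin]].
    + simpl In in Hin.
      repeat (destruct Hin as [Hin|Hin]; [injection Hin; intros; subst y x; clear Hin|]).
      11: destruct Hin.
      7: exists 8%nat, 5%nat; specialize (RS 13%nat ltac:(lia)); simpl Nat.add in *; split; lia.
      all: match goal with |- context [(?x = _ /\ _)%nat] =>
        exists x, 2%nat; specialize (RS (x + 2)%nat ltac:(lia)); simpl Nat.add in *; split; lia end.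
    + apply in_map_iff in Hin as (i & Ei & Hi). injection Ei; intros; subst. apply in_seq in Hi.
      exists x, 1%nat. specialize (RS (x + 1)%nat ltac:(lia)). split; lia.
    + simpl In in Hin.
      repeat (destruct Hin as [Hin|Hin]; [injection Hin; intros; subst y x; clear Hin|]).
      5: destruct Hin.
      * exists (14 + k)%nat, 2%nat. specialize (RS (14 + k + 2)%nat ltac:(lia)). split; lia.
      * exists 2%nat, 2%nat. specialize (RS (2 + 2)%nat ltac:(lia)). split; lia.
      * exists 4%nat, 2%nat. specialize (RS (4 + 2)%nat ltac:(lia)). split; lia.
      * exists 1%nat, 5%nat. specialize (RS (1 + 5)%nat ltac:(lia)). split; lia.
  - intros z d H. rewrite cycle9_pairs, !in_app_iff.
    assert (H' : (d = 2 /\ (1 <= z <= 5 \/ 7 <= z <= 12) \/ d = 2 /\ z = 14 + k \/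
        d = 5 /\ (z = 1 \/ z = 8) \/ d = 1 /\ 14 <= z < 14 + k)%nat).
    { unfold left_edge, right_edge in H. lia. }
    pose proof (resid_spec (14 + k) (z + d) ltac:(lia)) as RS. clear H Hn.
    set (r := resid (14 + k) (z + d)) in *. clearbody r.
    remember (14 + k)%nat as N eqn:EN. simpl In.
    destruct H' as [[-> H']|[[-> ->]|[[-> [-> | ->]]|[-> H']]]].
    + left. assert (r = z + 2)%nat as -> by lia. clear RS EN.
      do 13 (destruct z as [|z]; [try lia; simpl; tauto|]). lia.
    + left. assert (r = 2)%nat as -> by lia. tauto.
    + right. assert (r = 6)%nat as -> by lia. tauto.
    + right. assert (r = 13)%nat as -> by lia. tauto.
    + left. right. left. apply in_map_iff. exists z. split; [f_equal; lia|]. apply in_seq. lia.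
Qed.

Lemma left_list_curve n : (14 <= n)%nat -> forall p, chord_knot (angle n) (left_list n) p <->
  edge_curve n (left_edge n) p \/ exists t, I01 t /\ p = arc (angle n 7) (angle n 14) 0 t.
Proof.
  intros Hn.
  assert (per : forall i, same_angle (angle n (n + i)) (angle n i)).
  { intros i. rewrite angle_add by lia. apply same_angle_sym, same_angle_period. }
  pose proof same_angle_refl as sr.
  intros p; split.
  - intros (i & j & c & Hin & t & Ht & ->).
    destruct Hin as [Hin|Hin]; [injection Hin; intros; subst; right; exists t; auto|left].
    apply in_app_or in Hin. rewrite in_tail in Hin. destruct Hin as [[[Hi ->] ->]|Hin].
    + unfold next. destruct (Nat.ltb_spec i n).
      * exists i, 1%nat; split; [unfold left_edge; lia|]. exists t; auto.
      * replace i with n by lia. exists n, 2%nat; split; [unfold left_edge; lia|]. exists t; auto.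
    + unfold core in Hin. in_cases Hin.
      1: exists 1%nat, 2%nat. 2: exists 2%nat, 2%nat. 3: exists 3%nat, 2%nat. 4: exists 4%nat, 2%nat.
      5: exists 5%nat, 2%nat. 6: exists 1%nat, 5%nat.
      all: split; [unfold left_edge; lia|]; simpl Nat.add.
      5: exists (1 - t); split; [unfold I01 in *; lra|]; rewrite (arc_swap (angle n 7)); apply arc_same; auto.
      all: exists t; split; [exact Ht|]; apply arc_same; auto.
  - assert (put : forall i j c a b t, In (i, j, c) (left_list n) -> I01 t ->
      same_angle a (angle n i) /\ same_angle b (angle n j) \/
      same_angle a (angle n j) /\ same_angle b (angle n i) -> chord_knot (angle n) (left_list n) (arc a b c t)).
    { intros i j c a b t Hin Ht H. apply chord_in_sk; [exists i, j; auto | exact Ht]. }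
    assert (per' : forall i, same_angle (angle n i) (angle n (n + i))) by (intros; apply same_angle_sym; auto).
    intros [(z & d & Hz & t & Ht & ->)|(t & Ht & ->)].
    + assert (C : forall x, In x (core n) -> In x (left_list n)).
      { intros x Hx. unfold left_list. right. apply in_or_app. right; exact Hx. }
      assert (T : forall i, (14 <= i <= n)%nat -> In (i, next n i, height n i) (left_list n)).
      { intros i Hi. unfold left_list. right. apply in_or_app. left. apply in_tail. auto. }
      assert (Hz' : (d = 2 /\ z = 1 \/ d = 2 /\ z = 2 \/ d = 2 /\ z = 3 \/ d = 2 /\ z = 4 \/ d = 2 /\ z = 5 \/
         d = 2 /\ z = n \/ d = 5 /\ z = 1 \/ d = 1 /\ 14 <= z < n)%nat) by (unfold left_edge in Hz; lia).
      destruct Hz' as [[-> ->]|[[-> ->]|[[-> ->]|[[-> ->]|[[-> ->]|[[-> ->]|[[-> ->]|[-> Hz']]]]]]]]; simpl Nat.add.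
      * apply (put (n + 1)%nat (n + 3)%nat); auto. apply C; simpl; tauto.
      * apply (put (n + 2)%nat (n + 4)%nat); auto. apply C; simpl; tauto.
      * apply (put (n + 3)%nat (n + 5)%nat); auto. apply C; simpl; tauto.
      * apply (put (n + 4)%nat (n + 6)%nat); auto. apply C; simpl; tauto.
      * apply (put 7%nat (n + 5)%nat); auto. apply C; simpl; tauto.
      * specialize (T n ltac:(lia)). unfold next in T. rewrite Nat.ltb_irrefl in T.
        apply (put n (n + 2)%nat); auto.
      * apply (put (n + 1)%nat (n + 6)%nat); auto. apply C; simpl; tauto.
      * specialize (T z ltac:(lia)). unfold next in T. destruct (Nat.ltb_spec z n); [|lia].
        apply (put z (z + 1)%nat); auto.
    + apply (put 7%nat 14%nat); auto. left; reflexivity.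
Qed.

Lemma right_list_curve n : (14 <= n)%nat -> forall p, chord_knot (angle n) (right_list n) p <->
  edge_curve n right_edge p \/ exists t, I01 t /\ p = arc (angle n 7) (angle n 14) 0 t.
Proof.
  intros Hn.
  assert (per : forall i, same_angle (angle n (n + i)) (angle n i)).
  { intros i. rewrite angle_add by lia. apply same_angle_sym, same_angle_period. }
  pose proof same_angle_refl as sr.
  assert (per' : forall i, same_angle (angle n i) (angle n (n + i))) by (intros; apply same_angle_sym; auto).
  intros p; split.
  - intros (i & j & c & Hin & t & Ht & ->).
    assert (rv : I01 (1 - t)) by (unfold I01 in *; lra).
    in_cases Hin.
    1: right; exists (1 - t); split; [exact rv|]; rewrite (arc_swap (angle n 14)); apply arc_same; auto.
    all: left.
    1: exists 7%nat, 2%nat. 2: exists 8%nat, 2%nat. 3: exists 9%nat, 2%nat. 4: exists 10%nat, 2%nat.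
    5: exists 11%nat, 2%nat. 6: exists 12%nat, 2%nat. 7: exists 8%nat, 5%nat.
    all: split; [unfold right_edge; lia|]; simpl Nat.add.
    6: exists (1 - t); split; [exact rv|]; rewrite (arc_swap (angle n 14)); apply arc_same; auto.
    all: exists t; split; [exact Ht|]; apply arc_same; auto.
  - assert (put : forall i j c a b t, In (i, j, c) (right_list n) -> I01 t ->
      same_angle a (angle n i) /\ same_angle b (angle n j) \/
      same_angle a (angle n j) /\ same_angle b (angle n i) -> chord_knot (angle n) (right_list n) (arc a b c t)).
    { intros i j c a b t Hin Ht H. apply chord_in_sk; [exists i, j; auto | exact Ht]. }
    intros [(z & d & Hz & t & Ht & ->)|(t & Ht & ->)].
    + assert (Hz' : (d = 2 /\ z = 7 \/ d = 2 /\ z = 8 \/ d = 2 /\ z = 9 \/ d = 2 /\ z = 10 \/ d = 2 /\ z = 11 \/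
         d = 2 /\ z = 12 \/ d = 5 /\ z = 8)%nat) by (unfold right_edge in Hz; lia).
      destruct Hz' as [[-> ->]|[[-> ->]|[[-> ->]|[[-> ->]|[[-> ->]|[[-> ->]|[-> ->]]]]]]]; simpl Nat.add.
      * apply (put (n + 7)%nat (n + 9)%nat); auto. simpl; tauto.
      * apply (put (n + 8)%nat (n + 10)%nat); auto. simpl; tauto.
      * apply (put (n + 9)%nat (n + 11)%nat); auto. simpl; tauto.
      * apply (put (n + 10)%nat (n + 12)%nat); auto. simpl; tauto.
      * apply (put (n + 11)%nat (n + 13)%nat); auto. simpl; tauto.
      * apply (put 14%nat (n + 12)%nat); auto. simpl; tauto.
      * apply (put (n + 8)%nat (n + 13)%nat); auto. simpl; tauto.
    + apply (put 14%nat (n + 7)%nat); auto. left; reflexivity.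
Qed.

(** * The connected sum *)

Theorem mainTheorem9 (n : nat) (hn : (14 <= n)%nat) :
  is_connected_sum (cycleKnot n (cycle9 n)) trefoil trefoil.
Proof.
  destruct (side_signs n hn) as (S7 & S14 & Spos & Sneg & Ssin).
  set (a := split_angle n). set (d := split_dist n).
  set (y := sin ((angle n 14 - angle n 7) / 2)) in *.
  pose (p := (0, - y, 0) : pt). pose (q := (0, y, 0) : pt).
  assert (Y7 : sin (angle n 7 - a) = - y).
  { unfold y. rewrite <- sin_neg. f_equal. unfold a, split_angle. field. }
  assert (Y14 : sin (angle n 14 - a) = y).
  { unfold y. f_equal. unfold a, split_angle. field. }
  assert (arcE : forall i j c t, rigid a d (arc (angle n i) (angle n j) c t) =
     ((1 - t) * side n i + t * side n j,
      (1 - t) * sin (angle n i - a) + t * sin (angle n j - a), snd (arc (angle n i) (angle n j) c t))).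
  { intros. apply rigid_arc. }
  assert (ends : forall i j c t, (t = 0 /\ (i = 7%nat \/ i = 14%nat)) \/ (t = 1 /\ (j = 7%nat \/ j = 14%nat)) ->
     rigid a d (arc (angle n i) (angle n j) c t) = p \/ rigid a d (arc (angle n i) (angle n j) c t) = q).
  { assert (z0 : forall i j c, snd (arc (angle n i) (angle n j) c 0) = 0 /\ snd (arc (angle n i) (angle n j) c 1) = 0).
    { intros i j c. pose proof (gg_ecirc (angle n i)) as G. pose proof (gg_ecirc (angle n j)) as G'.
      unfold cap, ecirc in G, G'. unfold arc; simpl in *.
      split; [transitivity (c * (1 - cos (angle n i) * cos (angle n i) - sin (angle n i) * sin (angle n i)))
       | transitivity (c * (1 - cos (angle n j) * cos (angle n j) - sin (angle n j) * sin (angle n j)))];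
        try ring; rewrite ?G, ?G'; ring. }
    intros i j c t [[-> [-> | ->]]|[-> [-> | ->]]]; rewrite arcE; unfold p, q;
      rewrite ?(proj1 (z0 _ _ _)), ?(proj2 (z0 _ _ _)), ?S7, ?S14, ?Y7, ?Y14; [left|right|left|right];
      f_equal; f_equal; ring. }
  (* Along an edge the first coordinate is affine between the [side] values of its ends, so an edge
     of the left half can reach 0 only at an end that is 7 or 14. *)
  assert (Lside : forall z k t, left_edge n z k -> I01 t ->
     let x := px (rigid a d (arc (angle n z) (angle n (z + k)) (height n z) t)) in
     x <= 0 /\ (x = 0 -> t = 0 /\ z = 14%nat \/ t = 1 /\ (z + k = 7)%nat)).
  { intros z k t Hz Ht x. unfold x. rewrite arcE; simpl px. clear x. destruct Ht as [t0 t1].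
    assert (Cz : z = 14%nat \/ side n z < 0).
    { destruct (Nat.eq_dec z 14); [left; assumption|right]. apply Sneg. unfold left_edge in Hz. lia. }
    assert (Ck : (z + k = 7)%nat \/ side n (z + k) < 0).
    { destruct (Nat.eq_dec (z + k) 7); [left; assumption|right]. apply Sneg. unfold left_edge in Hz. lia. }
    destruct Cz as [->|Cz], Ck as [Ck|Ck]; rewrite ?Ck, ?S7, ?S14.
    - unfold left_edge in Hz. lia.
    - split; [nra|]. intros E. left. split; [nra | reflexivity].
    - split; [nra|]. intros E. right. split; [nra | reflexivity].
    - split; [nra|]. intros E. exfalso. nra. }
  assert (Rside : forall z k t, right_edge z k -> I01 t ->
     let x := px (rigid a d (arc (angle n z) (angle n (z + k)) (height n z) t)) in
     0 <= x /\ (x = 0 -> t = 0 /\ z = 7%nat \/ t = 1 /\ (z + k = 14)%nat)).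
  { intros z k t Hz Ht x. unfold x. rewrite arcE; simpl px. clear x. destruct Ht as [t0 t1].
    assert (Cz : z = 7%nat \/ 0 < side n z).
    { destruct (Nat.eq_dec z 7); [left; assumption|right]. apply Spos. unfold right_edge in Hz. lia. }
    assert (Ck : (z + k = 14)%nat \/ 0 < side n (z + k)).
    { destruct (Nat.eq_dec (z + k) 14); [left; assumption|right]. apply Spos. unfold right_edge in Hz. lia. }
    destruct Cz as [->|Cz], Ck as [Ck|Ck]; rewrite ?Ck, ?S7, ?S14.
    - unfold right_edge in Hz. lia.
    - split; [nra|]. intros E. left. split; [nra | reflexivity].
    - split; [nra|]. intros E. right. split; [nra | reflexivity].
    - split; [nra|]. intros E. exfalso. nra. }
  (* At height 0 the chord from 7 to 14 is straight, so the rigid motion carries it to the segment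
     from p to q with the same parameter. *)
  assert (seg_pq : forall r, onSegment p q r <->
     exists t, I01 t /\ r = rigid a d (arc (angle n 7) (angle n 14) 0 t)).
  { assert (E : forall t, rigid a d (arc (angle n 7) (angle n 14) 0 t) =
       ((1 - t) * 0 + t * 0, (1 - t) * - y + t * y, (1 - t) * 0 + t * 0)).
    { intros t. rewrite arcE, S7, S14, Y7, Y14. unfold arc; simpl. f_equal. ring. }
    intros r; unfold onSegment, p, q. split; intros (t & Ht & Hr); exists t; split; auto;
      [rewrite E | rewrite <- E]; exact Hr. }
  assert (segp : onSegment p q p).
  { exists 0. split; [lra|]. unfold p, q. f_equal; [f_equal|]; ring. }
  assert (segq : onSegment p q q).
  { exists 1. split; [lra|]. unfold p, q. f_equal; [f_equal|]; ring. }
  pose (K := cycleKnot n (cycle9 n)).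
  assert (KE : forall r, moved a d K r <-> exists z k t, (left_edge n z k \/ right_edge z k) /\ I01 t /\
      r = rigid a d (arc (angle n z) (angle n (z + k)) (height n z) t)).
  { intros r; split.
    - intros (s & Ks & ->). apply (cycle9_edges n hn) in Ks as (z & k & Hz & t & Ht & ->). eauto 6.
    - intros (z & k & t & Hz & Ht & ->). eexists; split; [|reflexivity].
      apply (cycle9_edges n hn). exists z, k; split; [exact Hz|]. exists t; auto. }
  assert (cut : forall r, moved a d K r -> px r = 0 -> r = p \/ r = q).
  { intros r Kr Hr. apply KE in Kr as (z & k & t & [Hz|Hz] & Ht & ->); apply ends.
    - destruct (proj2 (Lside z k t Hz Ht) Hr); tauto.
    - destruct (proj2 (Rside z k t Hz Ht) Hr); tauto. }
  exists (moved a d K), p, q. split; [apply iso_ambient, iso_moved|].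
  split; [intros E; injection E; lra|].
  split; [|split].
  - intros r; split; [intros [H1 H2]; auto|].
    (* The point p is the image of vertex 7, the end of the edge {5, 7}, and q that of vertex 14,
       the end of {12, 14}. *)
    assert (Kp : moved a d K p).
    { apply KE. exists 5%nat, 2%nat, 1. split; [left; unfold left_edge; lia|].
      split; [unfold I01; lra|]. simpl Nat.add. rewrite arcE, S7, Y7. unfold p.
      pose proof (gg_ecirc (angle n 7)) as G. unfold cap, ecirc in G. unfold arc; simpl in *.
      f_equal; [f_equal; ring|].
      transitivity (height n 5 * (1 - cos (angle n 7) * cos (angle n 7) - sin (angle n 7) * sin (angle n 7))); [rewrite G; ring | ring]. }
    assert (Kq : moved a d K q).
    { apply KE. exists 12%nat, 2%nat, 1. split; [right; unfold right_edge; lia|].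
      split; [unfold I01; lra|]. simpl Nat.add. rewrite arcE, S14, Y14. unfold q.
      pose proof (gg_ecirc (angle n 14)) as G. unfold cap, ecirc in G. unfold arc; simpl in *.
      f_equal; [f_equal; ring|].
      transitivity (height n 12 * (1 - cos (angle n 14) * cos (angle n 14) - sin (angle n 14) * sin (angle n 14))); [rewrite G; ring | ring]. }
    intros [-> | ->]; (split; [assumption | reflexivity]).
  - apply iso_ambient. eapply iso_trans; [|apply (left_half n hn)].
    eapply iso_trans; [|apply iso_sym, (iso_moved a d)].
    apply iso_ext. intros r; split.
    + intros [[Kr Hr]|Hr].
      * pose proof (cut r Kr) as Cr. pose proof Kr as Kr'.
        apply KE in Kr' as (z & k & t & [Hz|Hz] & Ht & Er).
        -- eexists; split; [|exact Er]. apply left_list_curve; [exact hn|]. left.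
           exists z, k; split; [exact Hz|]. exists t; auto.
        (* A point of the right half with nonpositive first coordinate lies on the plane, hence is p
           or q and already belongs to the closing segment. *)
        -- pose proof (proj1 (Rside z k t Hz Ht)) as Hr'. cbv zeta in Hr'. rewrite <- Er in Hr'.
           assert (Sr : onSegment p q r) by (destruct (Cr ltac:(lra)) as [-> | ->]; assumption).
           apply seg_pq in Sr as (t' & Ht' & ->). eexists; split; [|reflexivity].
           apply left_list_curve; [exact hn|]. right. exists t'; auto.
      * apply seg_pq in Hr as (t' & Ht' & ->). eexists; split; [|reflexivity].
        apply left_list_curve; [exact hn|]. right. exists t'; auto.
    + intros (s & Hs & ->). apply left_list_curve in Hs; [|exact hn].
      destruct Hs as [(z & k & Hz & t & Ht & ->)|(t & Ht & ->)].
      * left. split; [apply KE; exists z, k, t; auto | apply (Lside z k t Hz Ht)].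
      * right. apply seg_pq. eauto.
  - apply iso_ambient. eapply iso_trans; [|apply (right_half n hn)].
    eapply iso_trans; [|apply iso_sym, (iso_moved a d)].
    apply iso_ext. intros r; split.
    + intros [[Kr Hr]|Hr].
      * pose proof (cut r Kr) as Cr. pose proof Kr as Kr'.
        apply KE in Kr' as (z & k & t & [Hz|Hz] & Ht & Er).
        -- pose proof (proj1 (Lside z k t Hz Ht)) as Hr'. cbv zeta in Hr'. rewrite <- Er in Hr'.
           assert (Sr : onSegment p q r) by (destruct (Cr ltac:(lra)) as [-> | ->]; assumption).
           apply seg_pq in Sr as (t' & Ht' & ->). eexists; split; [|reflexivity].
           apply right_list_curve; [exact hn|]. right. exists t'; auto.
        -- eexists; split; [|exact Er]. apply right_list_curve; [exact hn|]. left.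
           exists z, k; split; [exact Hz|]. exists t; auto.
      * apply seg_pq in Hr as (t' & Ht' & ->). eexists; split; [|reflexivity].
        apply right_list_curve; [exact hn|]. right. exists t'; auto.
    + intros (s & Hs & ->). apply right_list_curve in Hs; [|exact hn].
      destruct Hs as [(z & k & Hz & t & Ht & ->)|(t & Ht & ->)].
      * left. split; [apply KE; exists z, k, t; auto | apply Rle_ge, (Rside z k t Hz Ht)].
      * right. apply seg_pq. eauto.
Qed.
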